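(* Let $\mathbb K\in\{\mathbb R,\mathbb C,\mathbb H\}$ and let $p\ge2$, $q\ge1$ be integers. Then $\mathrm{SL}(p+q,\mathbb K)/\mathrm{SL}(p,\mathbb K)$ does not admit a compact quotient, except possibly when $\mathbb K=\mathbb R$ and $(p,q)\in\{(3,1),(7,1)\}$.
   Context: $\mathrm{SL}(p,\mathbb K)$ is embedded in $\mathrm{SL}(p+q,\mathbb K)$ as the upper-left diagonal block (identity in the lower-right $q\times q$ block). A compact quotient is a compact quotient by a discrete subgroup acting properly discontinuously. *)

(* Defs.v *)
From HB Require Import structures.
From mathcomp Require Import all_boot all_order all_algebra.
From mathcomp Require Import all_classical all_reals all_analysis.
From mathcomp Require Import complex.

Set Implicit Arguments.
Unset Strict Implicit.
Unset Printing Implicit Defensive.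

Import Order.TTheory GRing.Theory Num.Theory.
Import numFieldNormedType.Exports.
Local Open Scope classical_set_scope.
Local Open Scope ring_scope.

Inductive KK := KR | KC | KH.

Section Realification.
Variable R : realType.
Local Notation C := (complex.complex R).

(* Realification of a complex n x n matrix Z = A + iB  as the real
   2n x 2n matrix [[A, -B], [B, A]] (an injective ring homomorphism). *)
Definition realC n (Z : 'M[C]_n) : 'M[R]_(n + n) :=
  block_mx (map_mx (@complex.Re R) Z) (- map_mx (@complex.Im R) Z)
           (map_mx (@complex.Im R) Z) (map_mx (@complex.Re R) Z).

(* The standard complex representation of the quaternionic n x n matrix
   Z + W j  (Z, W complex, j z = conj(z) j) as [[Z, -conj W], [W, conj Z]]. *)
Definition cplxH n (Z W : 'M[C]_n) : 'M[C]_(n + n) :=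
  block_mx Z (- map_mx (@complex.conjc R) W) W (map_mx (@complex.conjc R) Z).

Definition rdim (K : KK) (n : nat) : nat :=
  match K with KR => n | KC => n + n | KH => (n + n) + (n + n) end.

Definition SLK (K : KK) (n : nat) : set 'M[R]_(rdim K n) :=
  match K return set 'M[R]_(rdim K n) with
  | KR => [set X | \det X = 1]
  | KC => [set X | exists Z : 'M[C]_n, \det Z = 1 /\ X = realC Z]
  | KH => [set X | exists Z W : 'M[C]_n,
             \det (cplxH Z W) = 1 /\ X = realC (cplxH Z W)]
  end.

Definition SLKsub (K : KK) (p q : nat) : set 'M[R]_(rdim K (p + q)) :=
  match K return set 'M[R]_(rdim K (p + q)) with
  | KR => [set X | exists Y : 'M[R]_p, \det Y = 1 /\
             X = block_mx Y 0 0 1%:M]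
  | KC => [set X | exists Z : 'M[C]_p, \det Z = 1 /\
             X = realC (block_mx Z 0 0 1%:M)]
  | KH => [set X | exists Z W : 'M[C]_p, \det (cplxH Z W) = 1 /\
             X = realC (cplxH (block_mx Z 0 0 1%:M) (block_mx W 0 0 0))]
  end.

End Realification.

(* G/H admits a compact quotient (compact Clifford-Klein form): there is a
   discrete subgroup Gamma of G acting properly discontinuously on G/H with
   Gamma \ G / H compact.  Expressed on G:
   - proper discontinuity: for every compact S of G/H, {g in Gamma | gS meets S}
     is finite; compact subsets of G/H are (contained in) images C H of compact
     C of G, and gCH meets CH iff g c1 h1 = c2 h2;
   - compactness of Gamma\G/H: G = Gamma C H for some compact C of G. *)
Definition admits_compact_quotient (R : realType) (N : nat)
    (G H : set 'M[R]_N) : Prop :=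
  exists Gamma : set 'M[R]_N,
    [/\ Gamma `<=` G,
        Gamma 1%:M /\
        (forall g h, Gamma g -> Gamma h -> Gamma (g *m h)) /\
        (forall g, Gamma g -> Gamma (invmx g)),
        (forall g, Gamma g -> exists U : set 'M[R]_N,
                     open U /\ U `&` Gamma = [set g]),
        (forall Cc : set 'M[R]_N, compact Cc -> Cc `<=` G ->
           finite_set [set g | Gamma g /\
             exists c1 c2 h1 h2, [/\ Cc c1, Cc c2, H h1, H h2 &
                                     g *m c1 *m h1 = c2 *m h2]]) &
        exists Cc : set 'M[R]_N, [/\ compact Cc, Cc `<=` G &
          forall x, G x -> exists g c h,
            [/\ Gamma g, Cc c, H h & x = g *m c *m h]]].

(* Main.v *)
Require Import Defs.
From HB Require Import structures.
From mathcomp Require Import all_boot all_order all_algebra.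
From mathcomp Require Import all_classical all_reals all_analysis complex.
From mathcomp Require Import ring lra zify.

(* A compact quotient by Gamma yields a family of positive definite forms on the K-span W of the first
   p + 1 coordinates: the forms v |-> |g v|^2 for the g in Gamma that keep the remaining frame vectors
   and covectors bounded. If x in W and f in its dual satisfy f x = 1 and f (J x) = 0 for every imaginary
   unit J, cocompactness provides a form S of the family with S(x) and S^-1(f) bounded by a universal
   constant; proper discontinuity makes any two forms bounded at a common such pair uniformly comparable.
   Hence, in the graph joining comparable forms, an eigenpair of two forms with eigenvalue lambda gives
   a path of length about |log_4 lambda|, so along a quasi-geodesic S_0, ..., S_T no eigenvalue of S_j
   relative to S_i lies in a window around 1 that grows exponentially with |i - j|. This gap makes
   log det (S_i + S_j) nearly additive, and therefore each S_i is bounded, on vectors as well as on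
   covectors, by an exponentially weighted sum of S_0 and S_T.
   Since dim_K W >= 3, one may choose dual bases e_i, f_i (i <= 3) over K. Forms contracting the pairs
   (e1, phi), (e2, phi), (e2, psi) with phi = f3 + t^2 (f1 + f2) and psi = f1 + t^2 f2 combine, through
   common points of quasi-geodesics, into one form Q with Q(e1) <= 1/2 and Q^-1(psi) <= 1/2, although
   psi e1 = 1. *)

Set Implicit Arguments.
Unset Strict Implicit.
Unset Printing Implicit Defensive.

Import Order.TTheory GRing.Theory Num.Theory.
Import numFieldNormedType.Exports.
Local Open Scope ring_scope.

(** * Positive definite forms *)

Section Forms.
Variable R : rcfType.

(** The obstacle is that the graph of forms is known only through its edges; no thin triangles are
    given. The substitute is that every relative eigenvalue of two forms, not only the largest,
    bounds their distance in the graph, so forms far apart have no moderate relative eigenvalue. For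
    such A and B, one-step changes of A and of B act in nearly complementary directions, and the
    cross-ratio of the determinants of the four sums exceeds 1 at most by an exponentially small
    amount. Determinants serve because det (M + P) det (M + Q) / (det M det (P + Q)) dominates M(v)
    / (P(v) + Q(v)) for every v: one scalar controls a whole form. Inversion preserves edges and
    gaps, so covectors need no separate argument. The contradiction is (psi e1)^2 <= Q(e1)
    Q^-1(psi). The pair (e1, psi) cannot be contracted directly. The covector phi is small on e1 and
    e2, yet equals 1 on e3, hence is not small for a fixed base form; this makes the paths from the
    base form towards the first two forms stay together for long. *)

Definition bf n (S : 'M[R]_n) (x y : 'cV[R]_n) : R := (x^T *m S *m y) 0 0.
Notation qf S x := (bf S x x).

Definition posdef n (S : 'M[R]_n) :=
  S^T = S /\ forall x : 'cV[R]_n, x != 0 -> 0 < qf S x.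

Lemma bfDl n (S : 'M[R]_n) x y z : bf S (x + y) z = bf S x z + bf S y z.
Proof. by rewrite /bf linearD /= !mulmxDl mxE. Qed.

Lemma bfDr n (S : 'M[R]_n) x y z : bf S z (x + y) = bf S z x + bf S z y.
Proof. by rewrite /bf mulmxDr mxE. Qed.

Lemma bfZl n (S : 'M[R]_n) a x y : bf S (a *: x) y = a * bf S x y.
Proof. by rewrite /bf linearZ /= -!scalemxAl mxE. Qed.

Lemma bfZr n (S : 'M[R]_n) a x y : bf S x (a *: y) = a * bf S x y.
Proof. by rewrite /bf -!scalemxAr mxE. Qed.

Lemma bfSD n (S T : 'M[R]_n) x y : bf (S + T) x y = bf S x y + bf T x y.
Proof. by rewrite /bf mulmxDr mulmxDl mxE. Qed.

Lemma bfSN n (S : 'M[R]_n) x y : bf (- S) x y = - bf S x y.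
Proof. by rewrite /bf mulmxN mulNmx mxE. Qed.

Lemma bfSZ n a (S : 'M[R]_n) x y : bf (a *: S) x y = a * bf S x y.
Proof. by rewrite /bf -scalemxAr -scalemxAl mxE. Qed.

Lemma bfC n (S : 'M[R]_n) x y : S^T = S -> bf S x y = bf S y x.
Proof.
move=> sS; rewrite /bf -[in LHS](trmxK (x^T *m S *m y)) mxE !trmx_mul trmxK sS.
by rewrite mulmxA.
Qed.

Lemma bfM n (S T : 'M[R]_n) x y : bf S x (T *m y) = bf (S *m T) x y.
Proof. by rewrite /bf !mulmxA. Qed.

Lemma bf_conj m n (S : 'M[R]_n) (V : 'M[R]_(n, m)) x y :
  bf (V^T *m S *m V) x y = bf S (V *m x) (V *m y).
Proof. by rewrite /bf trmx_mul !mulmxA. Qed.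

Lemma bf_sum n (S : 'M[R]_n) x y : bf S x y = \sum_i x i 0 * (S *m y) i 0.
Proof.
by rewrite /bf -mulmxA mxE; apply: eq_bigr => i _; rewrite mxE.
Qed.

Lemma bf1 n (x y : 'cV[R]_n) : bf 1%:M x y = \sum_i x i 0 * y i 0.
Proof. by rewrite bf_sum mul1mx. Qed.

Lemma bf_delta n (S : 'M[R]_n) i j : bf S (delta_mx i 0) (delta_mx j 0) = S i j.
Proof.
rewrite /bf trmx_delta -rowE mxE (bigD1 j) //= big1 ?addr0.
  by rewrite !mxE !eqxx mulr1.
by move=> k kj; rewrite !mxE (negPf kj) mulr0.
Qed.

Lemma posdef_ge0 n (S : 'M[R]_n) x : posdef S -> 0 <= qf S x.
Proof.
move=> [_ pS]; have [->|/pS/ltW//] := eqVneq x 0.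
by rewrite /bf mulmx0 mxE.
Qed.

Lemma posdef_unit n (S : 'M[R]_n) : posdef S -> S \in unitmx.
Proof.
move=> [sS pS]; rewrite -row_free_unit -kermx_eq0; apply/rowV0P => v /sub_kermxP vS.
apply/eqP; apply: contraT => v0.
have := pS v^T; rewrite /bf trmxK vS mul0mx mxE ltxx -(inj_eq trmx_inj) trmx0 trmxK.
by move/(_ v0).
Qed.

Lemma posdef1 n : posdef (1%:M : 'M[R]_n).
Proof.
split=> [|x x0]; first exact: trmx1.
rewrite bf1; have [i xi] : exists i, x i 0 != 0.
  apply/existsP; apply: contraNT x0; rewrite negb_exists => /forallP h.
  by apply/eqP/colP => i; rewrite mxE; apply/eqP; move: (h i); rewrite negbK.
rewrite (bigD1 i) //= ltr_wpDr ?sumr_ge0 // => [j _|]; first by rewrite -expr2 sqr_ge0.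
by rewrite -expr2 exprn_even_gt0.
Qed.

Lemma posdefD n (S T : 'M[R]_n) : posdef S -> posdef T -> posdef (S + T).
Proof.
move=> [sS pS] [sT pT]; split=> [|x x0]; first by rewrite linearD /= sS sT.
by rewrite bfSD addr_gt0 ?pS ?pT.
Qed.

Lemma posdefZ n a (S : 'M[R]_n) : 0 < a -> posdef S -> posdef (a *: S).
Proof.
move=> a0 [sS pS]; split=> [|x x0]; first by rewrite linearZ /= sS.
by rewrite bfSZ mulr_gt0 ?pS.
Qed.

Lemma posdef_conj m n (S : 'M[R]_n) (V : 'M[R]_(n, m)) :
  (forall x : 'cV[R]_m, V *m x = 0 -> x = 0) -> posdef S -> posdef (V^T *m S *m V).
Proof.
move=> iV [sS pS]; split=> [|x x0]; first by rewrite !trmx_mul trmxK sS mulmxA.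
by rewrite bf_conj pS //; apply: contra_neq x0; exact: iV.
Qed.

Lemma posdef_conj_unit n (S V : 'M[R]_n) :
  V \in unitmx -> posdef S -> posdef (V^T *m S *m V).
Proof. by move=> uV; apply: posdef_conj => x Vx; rewrite -(mulKmx uV x) Vx mulmx0. Qed.

Lemma posdef_inv n (S : 'M[R]_n) : posdef S -> posdef (invmx S).
Proof.
move=> pS; have uS := posdef_unit pS; have [sS _] := pS.
have -> : invmx S = (invmx S)^T *m S *m invmx S.
  by rewrite trmx_inv sS mulVmx // mul1mx.
by apply: posdef_conj_unit; rewrite ?unitmx_inv.
Qed.

(** [A *m invmx B] has a row eigenvector over the algebraically closed [R[i]], with real and
    imaginary parts [x] and [y]. Symmetry of [bf A x y] forces [b * (qf B x + qf B y) = 0], so the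
    eigenvalue is real and whichever of [x], [y] is nonzero serves. *)
Lemma pencil_eigenvector n (A B : 'M[R]_n.+1) : A^T = A -> posdef B ->
  exists (x : 'cV[R]_n.+1) a, x != 0 /\ A *m x = a *: (B *m x).
Proof.
move=> sA pB; have uB := posdef_unit pB.
pose toC (M : 'M[R]_n.+1) := map_mx (real_complex R) M.
have [l ev] := eigenvalue_closed (toC (A *m invmx B)) (ltn0Sn n).
move/eigenvalueP: ev => [v vE v0].
pose x := (map_mx (@complex.Re R) v)^T; pose y := (map_mx (@complex.Im R) v)^T.
have vC : v *m toC A = l *: (v *m toC B).
  have := congr1 (mulmx^~ (toC B)) vE.
  rewrite /toC -mulmxA -map_mxM /= mulmxKV //.
  by rewrite -scalemxAl.
have rp (w : 'rV[R[i]]_n.+1) (M : 'M[R]_n.+1) :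
    map_mx (@complex.Re R) (w *m toC M) = map_mx (@complex.Re R) w *m M.
  apply/rowP => j; rewrite !mxE raddf_sum /=; apply: eq_bigr => k _.
  by rewrite !mxE; case: (w 0 k) => a b /=; rewrite mulr0 subr0.
have ip (w : 'rV[R[i]]_n.+1) (M : 'M[R]_n.+1) :
    map_mx (@complex.Im R) (w *m toC M) = map_mx (@complex.Im R) w *m M.
  apply/rowP => j; rewrite !mxE raddf_sum /=; apply: eq_bigr => k _.
  by rewrite !mxE; case: (w 0 k) => a b /=; rewrite mulr0 add0r.
have sB : B^T = B by case: pB.
pose a := complex.Re l; pose b := complex.Im l.
have Ax : A *m x = a *: (B *m x) - b *: (B *m y).
  apply: trmx_inj; rewrite trmx_mul sA linearB /= !linearZ /= !trmx_mul sB !trmxK.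
  rewrite -rp vC -rp -ip; move: (v *m toC B) => w; apply/rowP => j; rewrite !mxE.
  by rewrite /a /b; case: (l) (w 0 j) => [? ?] [? ?] /=; rewrite mulrN.
have Ay : A *m y = b *: (B *m x) + a *: (B *m y).
  apply: trmx_inj; rewrite trmx_mul sA linearD /= !linearZ /= !trmx_mul sB !trmxK.
  rewrite -ip vC -rp -ip; move: (v *m toC B) => w; apply/rowP => j; rewrite !mxE.
  by rewrite /a /b; case: (l) (w 0 j) => [? ?] [? ?] /=; rewrite addrC.
have nz : (x != 0) || (y != 0).
  rewrite -negb_and; apply: contra v0 => /andP[/eqP x0 /eqP y0].
  apply/eqP/rowP => j; rewrite mxE; apply/eqP; rewrite eq_complex /=.
  move/matrixP: x0 => /(_ j 0); move/matrixP: y0 => /(_ j 0).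
  by rewrite !mxE => -> ->; rewrite !eqxx.
have bf0 (u w : 'cV[R]_n.+1) : (u^T *m A *m w) 0 0 = bf A u w by [].
have e1 : bf A y x = a * bf B y x - b * qf B y.
  by rewrite /bf -!mulmxA Ax mulmxBr -!scalemxAr !mxE.
have e2 : bf A x y = b * qf B x + a * bf B x y.
  by rewrite /bf -!mulmxA Ay mulmxDr -!scalemxAr !mxE.
have b0 : b = 0.
  have : b * (qf B x + qf B y) = 0.
    move: e2; rewrite (bfC _ _ sA) e1 (bfC x y sB) => e; lra.
  move/eqP; rewrite mulf_eq0 => /orP[/eqP//|].
  rewrite paddr_eq0 ?posdef_ge0 // => /andP[/eqP hx /eqP hy].
  case/orP: nz => /(proj2 pB); by rewrite ?hx ?hy ltxx.
move: Ax Ay; rewrite b0 !scale0r subr0 add0r => Ax Ay.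
by case/orP: nz => ?; [exists x, a | exists y, a].
Qed.

Lemma row_free_sub_rank m p r (M : 'M[R]_(m, p)) : \rank M = r ->
  exists U : 'M[R]_(r, p), row_free U /\ (U <= M)%MS.
Proof.
by move=> <-; exists (row_base M); rewrite row_base_free eq_row_base.
Qed.

(** An eigenvector [x], normalised for [B], is split off, and both forms are restricted to its
    [B]-orthogonal complement, spanned by the rows of [U]. As [A *m x] is proportional to [B *m x],
    this complement is [A]-orthogonal to [x] too. *)
Lemma simdiag n (A B : 'M[R]_n) : A^T = A -> posdef B ->
  exists (V : 'M[R]_n) (a : 'rV[R]_n),
    V^T *m B *m V = 1%:M /\ V^T *m A *m V = diag_mx a.
Proof.
elim: n A B => [|n IHn] A B sA pB.
  by exists 1%:M, 0; split; apply/matrixP => -[].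
have [x0 [a [x0n0 Ax0]]] := pencil_eigenvector sA pB.
have q0 : 0 < qf B x0 by apply: (proj2 pB).
have sB : B^T = B by case: pB.
pose c := (Num.sqrt (qf B x0))^-1.
pose x := c *: x0.
have Ax : A *m x = a *: (B *m x) by rewrite /x -!scalemxAr Ax0 scalerA mulrC -scalerA.
have qx : x^T *m B *m x = 1%:M.
  apply/matrixP => i j; rewrite !ord1 -[LHS]/(qf B x) bfZl bfZr !mxE /=.
  rewrite mulrA -expr2 exprVn sqr_sqrtr ?ltW // mulVf //; exact: lt0r_neq0.
have xn0 : x != 0.
  rewrite scaler_eq0 negb_or x0n0 andbT invr_eq0 sqrtr_eq0 -ltNge q0 //.
have rk : \rank (kermx (B *m x)) = n.
  rewrite mxrank_ker; have -> : \rank (B *m x) = 1%N; last by rewrite subn1.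
  apply/eqP; rewrite eqn_leq rank_leq_col lt0n mxrank_eq0 /=.
  by apply: contra xn0 => /eqP h; rewrite -(mulKmx (posdef_unit pB) x) h mulmx0.
have [U [fU /sub_kermxP UBx]] := row_free_sub_rank rk.
have iU (y : 'cV[R]_n) : U^T *m y = 0 -> y = 0.
  move=> h; apply: trmx_inj; apply: (row_free_inj fU).
  by rewrite trmx0 mul0mx -(trmxK U) -trmx_mul h trmx0.
have [W [d [hB hA]]] := IHn (U *m A *m U^T) (U *m B *m U^T)
   ltac:(by rewrite !trmx_mul trmxK sA mulmxA)
   ltac:(by rewrite -{1}(trmxK U); apply: posdef_conj).
have xBU : x^T *m B *m (U^T *m W) = 0.
  by apply: trmx_inj; rewrite !trmx_mul !trmxK sB trmx0 -mulmxA UBx mulmx0.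
have UBx' : (U^T *m W)^T *m B *m x = 0.
  by rewrite trmx_mul trmxK -!mulmxA UBx mulmx0.
have xA : x^T *m A = a *: (x^T *m B).
  by apply: trmx_inj; rewrite trmx_mul trmxK sA Ax [RHS]linearZ /= trmx_mul trmxK sB.
have e1 : (U^T *m W)^T *m A *m (U^T *m W) = diag_mx d.
  by rewrite -hA trmx_mul trmxK !mulmxA.
have e2 : (U^T *m W)^T *m B *m (U^T *m W) = 1%:M.
  by rewrite -hB trmx_mul trmxK !mulmxA.
pose V : 'M[R]_(n.+1, 1 + n) := row_mx x (U^T *m W).
pose D : 'rV[R]_(1 + n) := row_mx (const_mx a) d.
suff [VB VA] : V^T *m B *m V = 1%:M /\ V^T *m A *m V = diag_mx D by exists V, D.
split; rewrite /V /D tr_row_mx !mul_col_mx !mul_mx_row.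
  by rewrite qx xBU UBx' e2 scalar_mx_block.
rewrite xA -!scalemxAl qx xBU -(mulmxA _ A x) Ax -scalemxAr (mulmxA _ B x) UBx' e1 !scaler0.
rewrite [RHS]diag_mx_row; congr block_mx.
by apply/matrixP => i j; rewrite !ord1 !mxE /= !mulr1n mulr1.
Qed.

End Forms.

(** * Determinants of sums of forms *)

(** Sylvester's identity, by factoring one block matrix into triangular ones in two ways. *)
Lemma det_1DmulC (K : comNzRingType) m n (U : 'M[K]_(m, n)) (V : 'M[K]_(n, m)) :
  \det (1%:M + U *m V) = \det (1%:M + V *m U).
Proof.
have e1 : block_mx 1%:M (- U) V 1%:M
    = block_mx 1%:M 0 V 1%:M *m block_mx 1%:M (- U) 0 (1%:M + V *m U).
  rewrite mulmx_block !mul0mx !mulmx1 !mul1mx !addr0 mulmxN.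
  by rewrite addrCA addNr addr0.
have e2 : block_mx 1%:M (- U) V 1%:M
    = block_mx 1%:M (- U) 0 1%:M *m block_mx (1%:M + U *m V) 0 V 1%:M.
  by rewrite mulmx_block !mul0mx !mulmx1 !mul1mx !add0r mulNmx addrK.
have := congr1 determinant e1; rewrite [in LHS]e2 !det_mulmx.
by rewrite !(det_lblock, det_ublock) !det1 !mul1r !mulr1.
Qed.

Section Dets.
Variable R : rcfType.
Local Notation qf S x := (bf S x x).

Lemma posdef_det_gt0 n (S : 'M[R]_n) : posdef S -> 0 < \det S.
Proof.
move=> pS; have [V [a [h _]]] := simdiag (proj1 pS) pS.
have := congr1 determinant h; rewrite !det_mulmx det_tr det1 => e.
have d0 : \det V != 0.
  by apply/eqP => d; move: e; rewrite d mulr0 => /esym/eqP; rewrite oner_eq0.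
have : 0 < \det V ^+ 2 by rewrite exprn_even_gt0.
move=> hv; rewrite -(pmulr_rgt0 _ hv).
have -> : \det V ^+ 2 * \det S = \det V * \det S * \det V by ring.
by rewrite e ltr01.
Qed.

Lemma posdef_CS n (S : 'M[R]_n) x y : posdef S ->
  (bf S x y) ^+ 2 <= qf S x * qf S y.
Proof.
move=> pS; have [->|y0] := eqVneq y 0.
  by rewrite /bf !mulmx0 mxE expr0n mulr0.
have qy : 0 < qf S y by apply: (proj2 pS).
have := posdef_ge0 (qf S y *: x - bf S x y *: y) pS.
rewrite -[_ - _]/(_ + - _) -scaleNr !(bfDl, bfDr, bfZl, bfZr).
rewrite (bfC y x (proj1 pS)) => h.
rewrite -(ler_pM2l qy) -subr_ge0; apply: le_trans h _.
by rewrite le_eqVlt; apply/orP; left; apply/eqP; ring.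
Qed.

Lemma posdef_CS_dual n (S : 'M[R]_n) (u : 'rV[R]_n) x : posdef S ->
  ((u *m x) 0 0) ^+ 2 <= qf (invmx S) u^T * qf S x.
Proof.
move=> pS; have uS := posdef_unit pS; have [sS _] := pS.
have := posdef_CS (invmx S *m u^T) x pS.
have -> : bf S (invmx S *m u^T) x = (u *m x) 0 0.
  by rewrite /bf trmx_mul trmx_inv sS trmxK -mulmxA mulmxA mulmxKV.
suff -> : qf S (invmx S *m u^T) = qf (invmx S) u^T by [].
by rewrite /bf !trmx_mul trmx_inv sS trmxK !mulmxA mulmxKV.
Qed.

(** With [w = invmx (X + Q) *m u], the left side [t] is the pairing of [u] with [w] and is at least
    [qf X w]; Cauchy-Schwarz gives [t ^+ 2 <= qf (invmx X) u * t]. *)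
Lemma invmx_antitone n (X Q : 'M[R]_n) (u : 'cV[R]_n) : posdef X -> posdef Q ->
  qf (invmx (X + Q)) u <= qf (invmx X) u.
Proof.
move=> pX pQ; have pS := posdefD pX pQ; have uS := posdef_unit pS.
set w := invmx (X + Q) *m u.
have e : qf (invmx (X + Q)) u = qf (X + Q) w.
  rewrite /bf /w !trmx_mul trmx_inv (proj1 pS) !mulmxA -(mulmxA _ _ (invmx _)) .
  by rewrite mulmxV ?mulmx1.
have e' : qf (invmx (X + Q)) u = (u^T *m w) 0 0 by rewrite /bf /w mulmxA.
have := posdef_CS_dual u^T w pX; rewrite trmxK -e'.
have [->|t0] := eqVneq (qf (invmx (X + Q)) u) 0.
  by move=> _; apply: posdef_ge0; apply: posdef_inv.
have tp : 0 < qf (invmx (X + Q)) u.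
  by rewrite lt_def t0 posdef_ge0 //; apply: posdef_inv.
have le_w : qf X w <= qf (invmx (X + Q)) u.
  by rewrite e bfSD lerDl posdef_ge0.
move=> h; rewrite -(ler_pM2r tp) -expr2 (le_trans h) // ler_wpM2l //.
by apply: posdef_ge0; apply: posdef_inv.
Qed.

Lemma det_rank1D n (X : 'M[R]_n) (u : 'cV[R]_n) : X \in unitmx ->
  \det (X + u *m u^T) = \det X * (1 + qf (invmx X) u).
Proof.
move=> uX; have -> : X + u *m u^T = X *m (1%:M + (invmx X *m u) *m u^T).
  by rewrite mulmxDr mulmx1 !mulmxA mulmxV // mul1mx.
by rewrite det_mulmx det_1DmulC det_mx11 mxE [1%:M _ _]mxE eqxx /bf mulmxA.
Qed.

Lemma posdef_rank1D n (X : 'M[R]_n) (u : 'cV[R]_n) : posdef X ->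
  posdef (X + u *m u^T).
Proof.
move=> [sX pX]; split=> [|x x0].
  by rewrite linearD /= trmx_mul trmxK sX.
rewrite bfSD ltr_wpDr ?pX //.
have -> : qf (u *m u^T) x = (u^T *m x) 0 0 ^+ 2.
  rewrite /bf !mulmxA -(mulmxA (_ *m u)) mxE big_ord1 expr2; congr (_ * _).
  by rewrite -(trmxK (x^T *m u)) mxE trmx_mul trmxK.
exact: sqr_ge0.
Qed.

Lemma posdef_sum_rank1 n (P : 'M[R]_n) : posdef P ->
  exists us : seq 'cV[R]_n, P = \sum_(u <- us) u *m u^T.
Proof.
move=> pP; have [V [a [h _]]] := simdiag (proj1 pP) pP.
have uV : V \in unitmx by have [] := mulmx1_unit h.
exists [seq (row k (invmx V))^T | k <- enum 'I_n].
have -> : P = (invmx V)^T *m invmx V.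
  rewrite -(mulmx1 (invmx V)^T) -h !mulmxA -trmx_mul mulmxV // trmx1 mul1mx.
  by rewrite mulmxK.
rewrite big_map big_enum /=; apply/matrixP => i j.
rewrite mxE summxE; apply: eq_bigr => k _.
by rewrite !mxE big_ord1 !mxE.
Qed.

(** Log-submodularity of the determinant. [P] is added one rank-one term at a time; each multiplies
    [\det X] by [1 + qf (invmx X) u], a factor that does not increase when [Q] is added to [X]. *)
Lemma det_submul n (M P Q : 'M[R]_n) : posdef M -> posdef P -> posdef Q ->
  \det (P + Q + M) * \det M <= \det (M + P) * \det (M + Q).
Proof.
move=> pM pP pQ; have [us ->] := posdef_sum_rank1 pP.
suff [_ h] : let X := M + \sum_(u <- us) u *m u^T in
    posdef X /\ \det (X + Q) * \det M <= \det X * \det (M + Q).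
  by rewrite [_ + M]addrC addrA.
elim: us => [|u us /= [pX IH]] /=; first by rewrite !big_nil addr0 mulrC.
rewrite !big_cons addrCA addrC; set X := M + _ in pX IH *.
split; first exact: posdef_rank1D.
have pXQ := posdefD pX pQ.
rewrite [X + _ + Q]addrAC !det_rank1D ?posdef_unit //.
rewrite mulrAC [leRHS]mulrAC; apply: ler_pM => //.
- by rewrite mulr_ge0 ?ltW ?posdef_det_gt0.
- by rewrite addr_ge0 ?ler01 // posdef_ge0 //; exact: posdef_inv.
- by rewrite lerD2l invmx_antitone.
Qed.

Lemma det_diag_conj n (S V : 'M[R]_n) (a : 'rV[R]_n) : V^T *m S *m V = diag_mx a ->
  \det S * \det V ^+ 2 = \prod_i a 0 i.
Proof. by move=> /(congr1 determinant); rewrite !det_mulmx det_tr det_diag => <-; ring. Qed.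

Lemma diag_qf n (a : 'rV[R]_n) x y : bf (diag_mx a) x y = \sum_i a 0 i * (x i 0 * y i 0).
Proof.
by rewrite bf_sum; apply: eq_bigr => i _; rewrite mul_diag_mx mxE mulrCA.
Qed.

Lemma diag_qf_delta n (a : 'rV[R]_n) i : qf (diag_mx a) (delta_mx i 0) = a 0 i.
Proof. by rewrite bf_delta !mxE eqxx mulr1n. Qed.

(** In a basis with [M = 1] and [X] diagonal with entries [a], the inequality holds term by term,
    since the product of all [a_j] is at most [a_i] times the product of all [a_j + 1]. *)
Lemma det_addl_lower n (X M : 'M[R]_n) v : posdef X -> posdef M ->
  \det X * qf M v <= \det (X + M) * qf X v.
Proof.
move=> pX pM; have [V [a [hM hX]]] := simdiag (proj1 pX) pM.
have uV : V \in unitmx by have [] := mulmx1_unit hM.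
have hXM : V^T *m (X + M) *m V = diag_mx (a + const_mx 1).
  rewrite mulmxDr mulmxDl hM hX linearD /=; congr (_ + _).
  by apply/matrixP => i j; rewrite !mxE.
have a0 i : 0 < a 0 i.
  rewrite -diag_qf_delta -hX; apply: (proj2 (posdef_conj_unit uV pX)).
  by apply/eqP => /matrixP/(_ i 0)/eqP; rewrite !mxE !eqxx oner_eq0.
have dV : 0 < \det V ^+ 2.
  by rewrite exprn_even_gt0 //= -unitfE -unitmxE.
rewrite -(ler_pM2r dV) mulrAC [leRHS]mulrAC (det_diag_conj hX) (det_diag_conj hXM).
rewrite -(mulKVmx uV v); move: (invmx V *m v) => y.
rewrite -!bf_conj hM hX diag_qf bf1 !mulr_sumr; apply: ler_sum => i _.
rewrite [leRHS]mulrA ler_wpM2r -?expr2 ?sqr_ge0 //.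
rewrite (bigD1 i) //= mulrC ler_wpM2r ?(ltW (a0 i)) //.
rewrite [leRHS](bigD1 i) //= !mxE.
rewrite -[leLHS]mul1r; apply: ler_pM; rewrite ?ler01 ?lerDr ?(ltW (a0 i)) //.
  by apply: prodr_ge0 => j _; exact: ltW.
by apply: ler_prod => j _; rewrite !mxE (ltW (a0 j)) lerDl ler01.
Qed.

(** This turns a bound on four determinants into a bound on the middle form [M] at every vector. *)
Lemma det_defect n (M P Q : 'M[R]_n) v : posdef M -> posdef P -> posdef Q ->
  \det (P + Q) * \det M * qf M v <= \det (M + P) * \det (M + Q) * (qf P v + qf Q v).
Proof.
move=> pM pP pQ; have pPQ := posdefD pP pQ.
rewrite mulrAC; apply: (@le_trans _ _ (\det (P + Q + M) * qf (P + Q) v * \det M)).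
  by rewrite ler_wpM2r ?det_addl_lower // ltW // posdef_det_gt0.
rewrite mulrAC -bfSD ler_wpM2r ?posdef_ge0 //; exact: det_submul.
Qed.

Lemma det_le_prod_rows n (X : 'M[R]_n) : `|\det X| <= \prod_i \sum_j `|X i j|.
Proof.
elim: n X => [|n IHn] X; first by rewrite det_mx00 big_ord0 normr1.
rewrite (expand_det_row X ord0) [leRHS]big_ord_recl.
apply: (le_trans (ler_norm_sum _ _ _)).
rewrite mulr_suml; apply: ler_sum => j _.
rewrite normrM ler_wpM2l // /cofactor normrM normrX normrN1 expr1n mul1r.
apply: le_trans (IHn _) _; apply: ler_prod => i _.
rewrite sumr_ge0 //= (bigD1_ord j) //= -[leLHS]add0r lerD //.
by apply: ler_sum => k _; rewrite !mxE.
Qed.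

(** [E] need not be definite, so the inequality comes from polarising at [t *: x + y] and
    [t *: x - y] and optimising over [t]. *)
Lemma form_CS n (E A : 'M[R]_n) (b : R) x y : 0 < b -> E^T = E -> A^T = A ->
  (forall z, `|qf E z| <= b * qf A z) ->
  (bf E x y) ^+ 2 <= b ^+ 2 * (qf A x * qf A y).
Proof.
move=> b0 sE sA h.
set p := qf A x; set r := qf A y; set e := bf E x y.
have A0 z : 0 <= qf A z by rewrite -(pmulr_rge0 _ b0); exact: le_trans (h z).
have p0 : 0 <= p := A0 x; have r0 : 0 <= r := A0 y.
have key t : 0 <= t -> 2 * (t * `|e|) <= b * (t ^+ 2 * p + r).
  move=> t0; have e4 : 4 * (t * e) = qf E (t *: x + y) - qf E (t *: x - y).
    rewrite -[t *: x - y]/(_ + - _) -(scaleN1r y) !(bfDl, bfDr, bfZl, bfZr).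
    by rewrite (bfC y x sE) -/e; ring.
  have : `|4 * (t * e)| <= b * (2 * (t ^+ 2 * p + r)).
    rewrite e4; apply: le_trans (ler_normB _ _) _.
    apply: le_trans (lerD (h _) (h _)) _.
    rewrite -[t *: x - y]/(_ + - _) -(scaleN1r y) !(bfDl, bfDr, bfZl, bfZr).
    rewrite (bfC y x sA) -/p -/r.
    by rewrite le_eqVlt; apply/orP; left; apply/eqP; ring.
  rewrite !normrM (ger0_norm t0) ger0_norm //; lra.
have [pz|pn] := eqVneq p 0.
  have [->|en] := eqVneq e 0; first by rewrite expr0n pz mul0r mulr0.
  have ep : 0 < `|e| by rewrite normr_gt0.
  have := key ((b * r + 1) / (2 * `|e|)).
  rewrite divr_ge0 ?addr_ge0 ?mulr_ge0 ?ler01 ?(ltW b0) // => /(_ isT).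
  have -> : 2 * ((b * r + 1) / (2 * `|e|) * `|e|) = b * r + 1.
    by field; rewrite gt_eqF.
  rewrite pz; lra.
have pp : 0 < p by rewrite lt_def pn.
have := key (`|e| / (b * p)); rewrite divr_ge0 ?mulr_ge0 ?(ltW b0) // => /(_ isT).
have -> : 2 * (`|e| / (b * p) * `|e|) = 2 * (e ^+ 2 / (b * p)).
  by rewrite -(real_normK (num_real e)); field; rewrite !gt_eqF.
have -> : b * ((`|e| / (b * p)) ^+ 2 * p + r) = e ^+ 2 / (b * p) + b * r.
  by rewrite -(real_normK (num_real e)); field; rewrite !gt_eqF.
have bp : 0 < b * p by rewrite mulr_gt0.
move=> k; have : e ^+ 2 / (b * p) <= b * r by lra.
rewrite ler_pdivrMr // => k2; apply: le_trans k2 _.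
by rewrite le_eqVlt; apply/orP; left; apply/eqP; ring.
Qed.

End Dets.

(** * The cross-ratio of determinants of sums *)

Section Cross.
Variable R : rcfType.
Local Notation qf S x := (bf S x x).

Lemma sqr_le_mull_le (t c : R) : 0 <= c -> t ^+ 2 <= c * t -> t <= c.
Proof.
move=> c0 h; have [t0|t0] := lerP t 0; first exact: le_trans t0 c0.
by move: h; rewrite expr2 ler_pM2r.
Qed.

(** The model case, where the two forms are diagonal with sum 1. Since [(1 + F)(1 + E) = M (1 + Z)]
    with [Z = invmx M *m (F *m E)], only [\det (1 + Z)] matters. [E] is dominated by [a] and [F] by
    [1 - a], whose supports almost avoid each other, so the entries of [Z] are at most [e]. In
    [b ^+ 6], the form [E], the form [F] and the vector [u] each contribute [b ^+ 2]. *)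
Lemma cross_frame n (a : 'rV[R]_n) (E F : 'M[R]_n) (b d e : R) :
  1 <= b -> (forall k, 0 <= a 0 k <= 1) -> (forall k, a 0 k * (1 - a 0 k) <= d) ->
  E^T = E -> F^T = F ->
  (forall z, `|qf E z| <= b * qf (diag_mx a) z) ->
  (forall z, `|qf F z| <= b * qf (diag_mx (const_mx 1 - a)) z) ->
  posdef (1%:M + E + F) ->
  (forall z, qf 1%:M z <= b * qf (1%:M + E + F) z) ->
  0 <= e -> b ^+ 6 * d <= e ^+ 2 ->
  \det (1%:M + E) * \det (1%:M + F) <= (1 + n%:R * e) ^+ n * \det (1%:M + E + F).
Proof.
move=> b1 a01 ad sE sF hE hF pM hM e0 hd.
have b0 : 0 < b by apply: lt_le_trans b1; rewrite ltr01.
set A := diag_mx a in hE; set B := diag_mx _ in hF.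
set M := 1%:M + E + F in pM hM *.
have sA : A^T = A by exact: tr_diag_mx.
have sB : B^T = B by exact: tr_diag_mx.
have uM := posdef_unit pM; have [sM _] := pM.
pose Z := invmx M *m (F *m E).
have eM : (1%:M + F) *m (1%:M + E) = M *m (1%:M + Z).
  rewrite [RHS]mulmxDr mulmx1 /Z mulKVmx // mulmxDl mul1mx mulmxDr mulmx1.
  by rewrite /M addrA.
have -> : \det (1%:M + E) * \det (1%:M + F) = \det (1%:M + Z) * \det M.
  by rewrite mulrC -det_mulmx eM det_mulmx mulrC.
rewrite ler_wpM2r ?(ltW (posdef_det_gt0 pM)) //.
have Bd k : (const_mx 1 - a) 0 k = 1 - a 0 k by rewrite !mxE.
have Bk (y : 'cV[R]_n) k : (B *m y) k 0 = (1 - a 0 k) * y k 0.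
  by rewrite mul_diag_mx !mxE.
have B0 z : 0 <= qf B z.
  by rewrite -(pmulr_rge0 _ b0); exact: le_trans (hF z).
have zB i j : `|Z i j| <= e.
  pose u := invmx M *m delta_mx i 0 : 'cV[R]_n; pose w := E *m delta_mx j 0 : 'cV[R]_n.
  have -> : Z i j = bf F u w.
    rewrite -(bf_delta Z) /Z /bf /u /w trmx_mul trmx_inv sM.
    by rewrite !mulmxA.
  have u_i : qf M u = u i 0.
    rewrite /bf -mulmxA /u mulKVmx // -/u.
    by rewrite -[u^T *m _]trmxK trmx_mul trmxK trmx_delta -rowE !mxE.
  have u0 : qf 1%:M u <= b * u i 0 by rewrite -u_i.
  have ub : u i 0 <= b.
    apply: sqr_le_mull_le (ltW b0) _; apply: le_trans u0.
    rewrite bf1 (bigD1 i) //= -expr2 lerDl sumr_ge0 // => k _.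
    by rewrite -expr2 sqr_ge0.
  have Bu : qf B u <= b ^+ 2.
    apply: (@le_trans _ _ (qf 1%:M u)).
      rewrite diag_qf bf1; apply: ler_sum => k _; rewrite -expr2 ler_piMl ?sqr_ge0 //.
      by rewrite Bd; case/andP: (a01 k) => *; lra.
    by apply: le_trans u0 _; rewrite expr2 ler_wpM2l // ltW.
  have Bw : qf B w <= b ^+ 2 * d.
    have d0 : 0 <= d.
      apply: le_trans (ad i); case/andP: (a01 i) => ? ?; apply: mulr_ge0 => //; lra.
    apply: sqr_le_mull_le; first by rewrite mulr_ge0 // sqr_ge0.
    have eBw : qf B w = bf E (B *m w) (delta_mx j 0).
      by rewrite [RHS]/bf trmx_mul sB -!mulmxA /bf -!mulmxA.
    rewrite {1}eBw; apply: le_trans (form_CS _ _ b0 sE sA hE) _.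
    rewrite -mulrA ler_wpM2l ?sqr_ge0 //.
    rewrite (diag_qf_delta a j) -[leRHS]mulr1.
    have hA : qf A (B *m w) <= d * qf B w.
      rewrite !diag_qf mulr_sumr; apply: ler_sum => k _.
      rewrite !Bk Bd.
      have -> : a 0 k * ((1 - a 0 k) * w k 0 * ((1 - a 0 k) * w k 0))
        = (a 0 k * (1 - a 0 k)) * ((1 - a 0 k) * w k 0 ^+ 2) by ring.
      rewrite -expr2 ler_wpM2r // mulr_ge0 ?sqr_ge0 //.
      by case/andP: (a01 k) => *; lra.
    case/andP: (a01 j) => ? ?; apply: ler_pM => //.
    by rewrite diag_qf; apply: sumr_ge0 => k _; rewrite mulr_ge0 -?expr2 ?sqr_ge0 //; case/andP: (a01 k).
  have h : (bf F u w) ^+ 2 <= e ^+ 2.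
    apply: le_trans (form_CS _ _ b0 sF sB hF) _; apply: le_trans hd.
    have -> : b ^+ 6 * d = b ^+ 2 * (b ^+ 2 * (b ^+ 2 * d)) by ring.
    by rewrite ler_wpM2l ?sqr_ge0 //; apply: ler_pM.
  by rewrite -(ler_pXn2r (n := 2)) ?nnegrE // real_normK ?num_real.
apply: le_trans (ler_norm _) _; apply: le_trans (det_le_prod_rows _) _.
rewrite -[X in _ ^+ X]card_ord -prodr_const; apply: ler_prod => i _.
rewrite sumr_ge0 //=.
apply: (@le_trans _ _ (\sum_j ((i == j)%:R + e))).
  apply: ler_sum => j _; rewrite !mxE; apply: le_trans (ler_normD _ _) _.
  apply: lerD; last by have := zB i j; rewrite /Z !mxE.
  by rewrite ger0_norm ?ler0n.
rewrite big_split /= sumr_const card_ord mulr_natl lerD2r.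
by rewrite (bigD1 i) //= eqxx big1 ?addr0 // => j ji; rewrite eq_sym (negPf ji).
Qed.

(** [a] is the share of the first form in the sum along an eigenvector, so [l = a / (1 - a)], and an
    extreme [l] pushes [a] towards 0 or 1. *)
Lemma eigen_gap_bound (l d : R) : 0 <= l -> (l <= d \/ 1 <= d * l) ->
  forall a, 0 <= a <= 1 -> a = l * (1 - a) -> a * (1 - a) <= d.
Proof.
move=> l0 hl a /andP[a0 a1] ea.
have a1' : 0 <= 1 - a by lra.
case: hl => h.
  apply: (@le_trans _ _ (l * (1 - a))).
    by rewrite {1}ea -mulrA ler_wpM2l // ler_piMl //; lra.
  apply: le_trans h; rewrite ler_piMr //; lra.
have d0 : 0 <= d by rewrite leNgt; apply/negP => dn; nra.
have : 1 - a <= d * a by rewrite ea mulrA; nra.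
nra.
Qed.

(** Diagonalising [A] in a basis where [A + B] is the identity reduces this to [cross_frame] with
    [E] and [F] the differences [A' - A] and [B' - B]. *)
Lemma cross_det n (A B A' B' : 'M[R]_n) (b d e : R) :
  posdef A -> posdef B -> posdef A' -> posdef B' -> 1 <= b ->
  (forall x, qf A' x <= b * qf A x) -> (forall x, qf A x <= b * qf A' x) ->
  (forall x, qf B' x <= b * qf B x) -> (forall x, qf B x <= b * qf B' x) ->
  (forall (x : 'cV[R]_n) l, x != 0 -> A *m x = l *: (B *m x) -> l <= d \/ 1 <= d * l) ->
  0 <= e -> b ^+ 6 * d <= e ^+ 2 ->
  \det (A + B') * \det (A' + B)
    <= (1 + n%:R * e) ^+ n * (\det (A + B) * \det (A' + B')).
Proof.
move=> pA pB pA' pB' b1 hA1 hA2 hB1 hB2 gap e0 hd.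
have b0 : 0 < b by apply: lt_le_trans b1; rewrite ltr01.
have pM := posdefD pA pB.
have [V [a [hM hA]]] := simdiag (proj1 pA) pM.
have uV : V \in unitmx by have [] := mulmx1_unit hM.
have hB : V^T *m B *m V = diag_mx (const_mx 1 - a).
  have -> : V^T *m B *m V = 1%:M - diag_mx a.
    by rewrite -hM -hA mulmxDr mulmxDl [in RHS]addrC addKr.
  by rewrite linearB /=; congr (_ - _); apply/matrixP => i j; rewrite !mxE.
have dl i : (delta_mx i 0 : 'cV[R]_n) != 0.
  by apply/eqP => /matrixP/(_ i 0)/eqP; rewrite !mxE !eqxx oner_eq0.
have a0 i : 0 < a 0 i.
  by rewrite -diag_qf_delta -hA; apply: (proj2 (posdef_conj_unit uV pA)).
have a1 i : 0 < 1 - a 0 i.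
  have := proj2 (posdef_conj_unit uV pB) _ (dl i).
  by rewrite hB diag_qf_delta !mxE.
have ad k : a 0 k * (1 - a 0 k) <= d.
  pose v := V *m delta_mx k 0 : 'cV[R]_n.
  have vn0 : v != 0.
    by apply: contra_neq (dl k) => h; rewrite -(mulKmx uV (delta_mx k 0)) -/v h mulmx0.
  have eA : V^T *m (A *m v) = a 0 k *: delta_mx k 0.
    rewrite /v !mulmxA hA; apply/matrixP => i j; rewrite ord1 mul_diag_mx !mxE.
    by have [->|] := eqVneq i k; rewrite ?mulr0 // eqxx.
  have eB : V^T *m (B *m v) = (1 - a 0 k) *: delta_mx k 0.
    rewrite /v !mulmxA hB; apply/matrixP => i j; rewrite ord1 mul_diag_mx !mxE.
    by have [->|] := eqVneq i k; rewrite ?mulr0 // eqxx.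
  pose l := a 0 k / (1 - a 0 k).
  have l0 : 0 <= l by rewrite divr_ge0 // ltW.
  apply: (@eigen_gap_bound l).
  - exact: l0.
  - apply: (gap v) => //; have uVt : V^T \in unitmx by rewrite unitmx_tr.
    apply: (can_inj (mulKmx uVt)); rewrite -scalemxAr eA eB scalerA /l divfK //.
    exact: lt0r_neq0.
  - by have := a0 k; have := a1 k => *; apply/andP; split; lra.
  - by rewrite /l divfK // lt0r_neq0.
have dV : 0 < \det V ^+ 2 by rewrite exprn_even_gt0 //= -unitfE -unitmxE.
have cj (S : 'M[R]_n) : \det (V^T *m S *m V) = \det S * \det V ^+ 2.
  by rewrite !det_mulmx det_tr; ring.
have dV2 : 0 < \det V ^+ 2 * \det V ^+ 2 by rewrite mulr_gt0.
rewrite -(ler_pM2r dV2).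
pose E := V^T *m (A' - A) *m V; pose F := V^T *m (B' - B) *m V.
have eE : V^T *m (A' + B) *m V = 1%:M + E.
  rewrite /E -hM -mulmxDl -mulmxDr; congr (_ *m _ *m _).
  by apply/matrixP => i j; rewrite !mxE; ring.
have eF : V^T *m (A + B') *m V = 1%:M + F.
  rewrite /F -hM -mulmxDl -mulmxDr; congr (_ *m _ *m _).
  by apply/matrixP => i j; rewrite !mxE; ring.
have eEF : V^T *m (A' + B') *m V = 1%:M + E + F.
  rewrite -eE /F -mulmxDl -mulmxDr; congr (_ *m _ *m _).
  by apply/matrixP => i j; rewrite !mxE; ring.
have -> : \det (A + B') * \det (A' + B) * (\det V ^+ 2 * \det V ^+ 2)
   = \det (1%:M + E) * \det (1%:M + F) by rewrite -eE -eF !cj; ring.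
have -> : (1 + n%:R * e) ^+ n * (\det (A + B) * \det (A' + B')) *
     (\det V ^+ 2 * \det V ^+ 2)
   = (1 + n%:R * e) ^+ n * \det (1%:M + E + F).
  by rewrite -eEF cj; have := cj (A + B); rewrite hM det1 => h1;
     rewrite -[in RHS](mulr1 (\det _ * _)) h1; ring.
have dif (S T : 'M[R]_n) x : qf (S - T) x = qf S x - qf T x by rewrite bfSD bfSN.
apply: (@cross_frame n a E F b d e) => //.
- by move=> k; have := a0 k; have := a1 k => *; apply/andP; split; lra.
- by rewrite /E !trmx_mul trmxK linearB /= (proj1 pA) (proj1 pA') mulmxA.
- by rewrite /F !trmx_mul trmxK linearB /= (proj1 pB) (proj1 pB') mulmxA.
- move=> z; rewrite -hA !bf_conj dif ler_norml.
  have := hA1 (V *m z); have := posdef_ge0 (V *m z) pA; have := posdef_ge0 (V *m z) pA'.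
  by move=> *; apply/andP; split; nra.
- move=> z; rewrite -hB !bf_conj dif ler_norml.
  have := hB1 (V *m z); have := posdef_ge0 (V *m z) pB; have := posdef_ge0 (V *m z) pB'.
  by move=> *; apply/andP; split; nra.
- by rewrite -eEF; apply: posdef_conj_unit => //; exact: posdefD.
- move=> z; rewrite -eEF -hM !bf_conj !bfSD mulrDr.
  by apply: lerD.
Qed.

End Cross.

(** * Quasi-geodesics of forms *)

Section Sequences.
Variable R : realType.
Local Notation qf S x := (bf S x x).

Definition comparable_forms n (b : R) (S T : 'M[R]_n) :=
  forall x, qf S x <= b * qf T x /\ qf T x <= b * qf S x.

(** For [d >= 1] nothing is required, which is how a large constant [c] in [quasigeo] excuses short
    distances. *)
Definition eigen_gap n (d : R) (S T : 'M[R]_n) :=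
  forall (x : 'cV[R]_n) l, x != 0 -> S *m x = l *: (T *m x) -> l <= d \/ 1 <= d * l.

(** The gap parameter is a square so that [b ^+ 6] times it is again a square, as [cross_det]
    asks. *)
Definition quasigeo n (b c q : R) (T : nat) (S : nat -> 'M[R]_n) :=
  [/\ forall i, (i <= T)%N -> posdef (S i),
      forall i, (i < T)%N -> comparable_forms b (S i) (S i.+1) &
      forall i j, (i <= j <= T)%N -> eigen_gap ((c * q ^+ (j - i)) ^+ 2) (S i) (S j)].

(** * Near-additivity of log det along a quasi-geodesic *)

Section NearAdditivity.
Variables (n : nat) (b c q : R) (T : nat) (S : nat -> 'M[R]_n).
Hypotheses (b1 : 1 <= b) (c1 : 1 <= c) (q0 : 0 < q) (q1 : q < 1).
Hypothesis qS : quasigeo b c q T S.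

Let f i j := \det (S i + S j).
(** The exponent in [(1 + n e)^n <= expR (n * n * e)] for [e = b ^+ 3 * c], the decaying factor left
    out. *)
Let C := n%:R * (n%:R * (b ^+ 3 * c)).

Let f_gt0 i j : (i <= T)%N -> (j <= T)%N -> 0 < f i j.
Proof.
by move=> iT jT; apply: posdef_det_gt0; case: qS => p _ _; apply: posdefD; apply: p.
Qed.

Let C0 : 0 <= C.
Proof.
have b0 : 0 <= b by apply: le_trans b1.
have c0 : 0 <= c by apply: le_trans c1.
by rewrite /C !mulr_ge0 ?ler0n ?exprn_ge0.
Qed.

Let cross_step i j : (i.+1 <= j < T)%N ->
  f i.+1 j.+1 * f i j <= expR (C * q ^+ (j - i.+1)) * (f i.+1 j * f i j.+1).
Proof.
case/andP=> ij jT; case: qS => pS st gap.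
pose e := b ^+ 3 * (c * q ^+ (j - i.+1)).
have e0 : 0 <= e.
  by rewrite /e !mulr_ge0 ?exprn_ge0 ?(ltW q0) ?(le_trans ler01 b1) ?(le_trans ler01 c1).
have iT : (i < T)%N by clear -ij jT; lia.
have h := @cross_det R n (S i.+1) (S j) (S i) (S j.+1) b ((c * q ^+ (j - i.+1)) ^+ 2) e.
apply: le_trans (h _ _ _ _ b1 _ _ _ _ _ e0 _) _.
- by apply: pS; clear -ij jT; lia.
- by apply: pS; clear -ij jT; lia.
- by apply: pS; clear -ij jT; lia.
- by apply: pS; clear -ij jT; lia.
- by move=> x; case: (st i iT x).
- by move=> x; case: (st i iT x).
- by move=> x; case: (st j jT x).
- by move=> x; case: (st j jT x).
- by apply: gap; clear -ij jT; lia.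
- by rewrite /e le_eqVlt; apply/orP; left; apply/eqP; ring.
rewrite ler_wpM2r //.
  by rewrite mulr_ge0 // ltW // f_gt0 //; clear -ij jT; lia.
apply: (@le_trans _ _ (expR (n%:R * e) ^+ n)).
  apply: lerXn2r; rewrite ?nnegrE ?expR_ge0 ?expR_ge1Dx //.
  by rewrite addr_ge0 // mulr_ge0.
rewrite -expRM_natl ler_expR /C /e.
by rewrite le_eqVlt; apply/orP; left; apply/eqP; ring.
Qed.

Let q1n : 1 - q != 0.
Proof. by rewrite subr_eq0 gt_eqF. Qed.

Let geom k : q ^+ k.+1 / (1 - q) + q ^+ k = q ^+ k / (1 - q).
Proof. by rewrite exprS; field. Qed.

(** Telescopes [cross_step] in the first index; the errors form a geometric series governed by the
    index closest to [j]. *)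
Let cross_row a k j (i := (a + k)%N) : (i <= j)%N -> (j < T)%N ->
  f i j.+1 * f a j <= expR (C * (q ^+ (j - i) / (1 - q))) * (f i j * f a j.+1).
Proof.
rewrite /i {i}; have E0 i : 0 <= C * (q ^+ i / (1 - q)).
  by rewrite mulr_ge0 // divr_ge0 ?exprn_ge0 ?(ltW q0) // subr_ge0 ltW.
elim: k => [|k IH] ij jT.
  rewrite addn0 in ij *; rewrite mulrC -[leLHS]mul1r ler_wpM2r ?mulr_ge0 ?(ltW (f_gt0 _ _)) //; try lia.
  by rewrite -[leLHS]expR0 ler_expR.
have ai := leq_addr k a; rewrite addnS in ij *.
move: (a + k)%N ai IH ij => i ai IH ij.
have h1 := @cross_step i j; have h2 := IH (ltnW ij) jT.
have {}h1 : f i.+1 j.+1 * f i j <= expR (C * q ^+ (j - i.+1)) * (f i.+1 j * f i j.+1).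
  by apply: h1; rewrite ij.
have fij : 0 < f i j by apply: f_gt0; clear -ij jT ai; lia.
have fij1 : 0 < f i j.+1 by apply: f_gt0; clear -ij jT ai; lia.
have e : (j - i = (j - i.+1).+1)%N by clear -ij; lia.
have -> : expR (C * (q ^+ (j - i.+1) / (1 - q)))
   = expR (C * (q ^+ (j - i) / (1 - q))) * expR (C * q ^+ (j - i.+1)).
  by rewrite -expRD e -mulrDr geom.
move: h1 h2; set E1 := expR _; set E2 := expR _ => h1 h2.
rewrite -(ler_pM2r (mulr_gt0 fij fij1)).
have -> : f i.+1 j.+1 * f a j * (f i j * f i j.+1)
  = (f i.+1 j.+1 * f i j) * (f i j.+1 * f a j) by ring.
have -> : E2 * E1 * (f i.+1 j * f a j.+1) * (f i j * f i j.+1)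
  = (E1 * (f i.+1 j * f i j.+1)) * (E2 * (f i j * f a j.+1)) by ring.
by apply: ler_pM => //; rewrite mulr_ge0 // ltW // f_gt0 //; clear -ij jT ai; lia.
Qed.

(** Telescopes [cross_row] in the second index, starting at [s]. Keeping [1 - q ^+ k] instead of the
    bound 1 makes the exponents add up exactly in the induction. *)
Let cross_total a s k (N := (s + k)%N) : (a <= s)%N -> (N <= T)%N ->
  f s N * f a s <= expR (C / (1 - q) ^+ 2 * (1 - q ^+ k)) * (f s s * f a N).
Proof.
rewrite /N {N} => as_; elim: k => [|k IH] NT.
  by rewrite addn0 expr0 subrr mulr0 expR0 mul1r mulrC.
rewrite addnS in NT *; have h2 := IH (ltnW NT).
have h1 : f s (s + k).+1 * f a (s + k)%N <=
    expR (C * (q ^+ k / (1 - q))) * (f s (s + k)%N * f a (s + k).+1).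
  have := @cross_row a (s - a)%N (s + k)%N; rewrite /= subnKC // addKn; apply=> //.
  exact: leq_addr.
have sN := leq_addr k s; move: (s + k)%N sN NT {IH} h1 h2 => N sN NT h1 h2.
have g1 : 0 < f a N by apply: f_gt0; clear -as_ sN NT; lia.
have g2 : 0 < f s N by apply: f_gt0; clear -as_ sN NT; lia.
have -> : expR (C / (1 - q) ^+ 2 * (1 - q ^+ k.+1))
  = expR (C * (q ^+ k / (1 - q))) * expR (C / (1 - q) ^+ 2 * (1 - q ^+ k)).
  by rewrite -expRD [q ^+ k.+1]exprS; move: C => C'; congr expR; field.
move: h1 h2; set E1 := expR _; set E2 := expR _ => h1 h2.
rewrite -(ler_pM2r (mulr_gt0 g1 g2)).
have -> : f s N.+1 * f a s * (f a N * f s N)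
  = (f s N.+1 * f a N) * (f s N * f a s) by ring.
have -> : E1 * E2 * (f s s * f a N.+1) * (f a N * f s N)
  = (E1 * (f s N * f a N.+1)) * (E2 * (f s s * f a N)) by ring.
by apply: ler_pM => //; rewrite mulr_ge0 // ltW // f_gt0 //; clear -as_ sN NT; lia.
Qed.

(** [cross_total] bounds the loss in [det_defect] for the middle form [S s] and the two ends;
    [2 ^+ n] arises from [\det (S s + S s)]. *)
Lemma quasigeo_convex s v : (s <= T)%N ->
  qf (S s) v <= 2 ^+ n * expR (C / (1 - q) ^+ 2) * (qf (S 0%N) v + qf (S T) v).
Proof.
move=> sT; case: qS => pS _ _.
have p0 := pS _ (leq0n T); have ps := pS _ sT; have pT := pS _ (leqnn T).
have h1 := det_defect v ps p0 pT.
have h2 : f s T * f 0 s <= expR (C / (1 - q) ^+ 2) * (f s s * f 0 T).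
  have := @cross_total 0 s (T - s); rewrite /= subnKC // => /(_ isT (leqnn T)) h.
  apply: le_trans h _.
  rewrite ler_wpM2r ?mulr_ge0 ?(ltW (f_gt0 _ _)) // ler_expR ler_piMr //.
    by rewrite divr_ge0 // sqr_ge0.
  by rewrite gerBl exprn_ge0 // ltW.
have fss : f s s = 2 ^+ n * \det (S s) by rewrite /f -mulr2n -scaler_nat detZ.
have d1 : 0 < \det (S 0 + S T) * \det (S s).
  by rewrite mulr_gt0 ?posdef_det_gt0 //; exact: posdefD.
rewrite -(ler_pM2l d1); apply: le_trans h1 _.
have -> : \det (S 0 + S T) * \det (S s) *
     (2 ^+ n * expR (C / (1 - q) ^+ 2) * (qf (S 0) v + qf (S T) v))
  = expR (C / (1 - q) ^+ 2) * (f s s * f 0 T) * (qf (S 0) v + qf (S T) v).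
  by rewrite fss /f; ring.
apply: ler_wpM2r; first by rewrite addr_ge0 // posdef_ge0.
by rewrite mulrC [S s + S 0]addrC.
Qed.

End NearAdditivity.

Lemma comparable_formsC n (b : R) (S T : 'M[R]_n) :
  comparable_forms b S T -> comparable_forms b T S.
Proof. by move=> h x; case: (h x). Qed.

(* Rescaling the forms by a weight peaked at [s] keeps the eigenvalue gap, up to
   halving its rate; this upgrades quasi-convexity to exponential contraction. *)
Lemma quasigeo_contraction n (b c q : R) : 1 <= b -> 1 <= c -> 0 < q -> q < 1 ->
  exists2 K, 1 <= K & forall T (S : nat -> 'M[R]_n), quasigeo b c (q ^+ 2) T S ->
  forall s v, (s <= T)%N ->
  qf (S s) v <= K * (q ^+ (2 * s) * qf (S 0%N) v + q ^+ (2 * (T - s)) * qf (S T) v).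
Proof.
(* Consecutive weights differ by a factor [q ^+ 2], which the edge constant has to absorb. *)
move=> b1 c1 q0 q1; pose b' := b / q ^+ 2.
have q2 : 0 < q ^+ 2 by rewrite exprn_gt0.
have b'1 : 1 <= b'.
  rewrite /b' ler_pdivlMr // mul1r; apply: le_trans b1.
  by rewrite expr_le1 // ltW.
pose K := 2 ^+ n * expR (n%:R * (n%:R * (b' ^+ 3 * c)) / (1 - q) ^+ 2).
exists K.
  rewrite /K -[leLHS]mul1r; apply: ler_pM; rewrite ?ler01 //.
    by apply: exprn_ege1; rewrite ler1n.
  have b0 : 0 <= b' := le_trans ler01 b'1; have c0 : 0 <= c := le_trans ler01 c1.
  rewrite -[leLHS]expR0 ler_expR divr_ge0 ?sqr_ge0 //.
  by rewrite mulr_ge0 ?ler0n // mulr_ge0 ?ler0n // mulr_ge0 // exprn_ge0.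
move=> T S [pS st gap] s v sT.
(* The distance from [i] to [s]: one of the two truncated differences is 0. *)
pose w i : nat := ((i - s) + (s - i))%N.
pose S' i := q ^+ (2 * w i) *: S i.
have w0 i : 0 < q ^+ (2 * w i) by rewrite exprn_gt0.
have qle i j : (i <= j)%N -> q ^+ j <= q ^+ i.
  by move=> ij; apply: ler_wiXn2l => //; rewrite ltW.
have qS' : quasigeo b' c q T S'.
  split.
  - by move=> i iT; apply: posdefZ => //; exact: pS.
  - move=> i iT x; rewrite !bfSZ.
    have [h1 h2] := st i iT x.
    have pi := posdef_ge0 x (pS i (ltnW iT)); have pi1 := posdef_ge0 x (pS i.+1 iT).
    have k1 : q ^+ (2 * w i) <= q ^+ (2 * w i.+1) / q ^+ 2.
      by rewrite ler_pdivlMr // -exprD; apply: qle; rewrite /w; clear; lia.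
    have k2 : q ^+ (2 * w i.+1) <= q ^+ (2 * w i) / q ^+ 2.
      by rewrite ler_pdivlMr // -exprD; apply: qle; rewrite /w; clear; lia.
    rewrite /b'; split.
      have -> : b / q ^+ 2 * (q ^+ (2 * w i.+1) * qf (S i.+1) x)
        = q ^+ (2 * w i.+1) / q ^+ 2 * (b * qf (S i.+1) x) by ring.
      by apply: ler_pM => //; exact: ltW.
    have -> : b / q ^+ 2 * (q ^+ (2 * w i) * qf (S i) x)
      = q ^+ (2 * w i) / q ^+ 2 * (b * qf (S i) x) by ring.
    by apply: ler_pM => //; exact: ltW.
  - move=> i j ij x l x0 e; set m := (j - i)%N.
    have pi : posdef (S i) by apply: pS; lia.
    have pj : posdef (S j) by apply: pS; lia.
    set u := q ^+ (2 * w i); set u' := q ^+ (2 * w j).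
    have e' : S i *m x = (l * (u' / u)) *: (S j *m x).
      move: e; rewrite /S' -!scalemxAl -/u -/u' scalerA => /(congr1 (fun z => u^-1 *: z)).
      rewrite !scalerA mulVf ?lt0r_neq0 ?w0 // scale1r => ->; congr (_ *: _); ring.
    have l0 : 0 <= l * (u' / u).
      have e2 : qf (S i) x = l * (u' / u) * qf (S j) x.
        by rewrite /bf -!mulmxA e' -scalemxAr mxE.
      have h1 := proj2 pi x x0; have h2 := proj2 pj x x0.
      by rewrite -(pmulr_lge0 _ h2) -e2 ltW.
    have uu : q ^+ (2 * m) * u' <= u.
      by rewrite /u /u' -exprD; apply: qle; rewrite /w /m; lia.
    have uu' : q ^+ (2 * m) * u <= u'.
      by rewrite /u /u' -exprD; apply: qle; rewrite /w /m; lia.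
    have qm : 0 < q ^+ (2 * m) by rewrite exprn_gt0.
    (* The weights change an eigenvalue by at most a factor [q ^+ (2 * m)] either way. Half of the
       window pays for this, and [(c * q ^+ m) ^+ 2] remains. *)
    have dE : (c * (q ^+ 2) ^+ m) ^+ 2 = (c * q ^+ m) ^+ 2 * q ^+ (2 * m).
      have e2 : (q ^+ 2) ^+ m = (q ^+ m) ^+ 2 by rewrite exprAC.
      by rewrite exprM e2; ring.
    have d0 : 0 <= (c * q ^+ m) ^+ 2 by rewrite sqr_ge0.
    have u0 : 0 < u := w0 i. have u'0 : 0 < u' := w0 j.
    have := gap i j ij x _ x0 e'; rewrite -/m dE; set D := (c * q ^+ m) ^+ 2.
    have ll : l = l * (u' / u) * (u / u') by field; rewrite !lt0r_neq0.
    have L0 : 0 <= l by rewrite ll; apply: mulr_ge0 => //; rewrite divr_ge0 ?ltW.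
    case=> h; [left|right].
      have {}h : l * u' <= D * q ^+ (2 * m) * u by rewrite -ler_pdivrMr // -mulrA.
      by rewrite -(ler_pM2r u'0) (le_trans h) // -mulrA ler_wpM2l.
    move: h; have -> : D * q ^+ (2 * m) * (l * (u' / u)) = D * l * (q ^+ (2 * m) * u' / u) by ring.
    move=> h; apply: le_trans h _; rewrite ler_piMr ?(mulr_ge0 d0 L0) //.
    by rewrite ler_pdivrMr // mul1r.
have := @quasigeo_convex n b' c q T S' b'1 c1 q0 q1 qS' s v sT.
rewrite !bfSZ /w subnn addn0 muln0 expr0 mul1r sub0n subn0 add0n.
have -> : (s - T = 0)%N by lia.
by rewrite addn0.
Qed.

End Sequences.

(** * Families of forms with bounded pairs *)

Section Duality.
Variable R : realType.
Local Notation qf S x := (bf S x x).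

Lemma comparable_forms_inv n (b : R) (S T : 'M[R]_n) : 0 <= b ->
  posdef S -> posdef T -> comparable_forms b S T ->
  comparable_forms b (invmx S) (invmx T).
Proof.
move=> b0; suff half (A B : 'M[R]_n) : posdef A -> posdef B -> comparable_forms b A B ->
    forall u, qf (invmx B) u <= b * qf (invmx A) u.
  move=> pS pT h u; split; apply: half => //; exact: comparable_formsC.
move=> pA pB h u; set w := invmx B *m u.
have uB := posdef_unit pB; have [sB _] := pB.
have e1 : qf (invmx B) u = (u^T *m w) 0 0 by rewrite /bf /w mulmxA.
have e2 : qf (invmx B) u = qf B w.
  rewrite e1 /bf /w trmx_mul trmx_inv sB mulmxKV // mulmxA //.
have := posdef_CS_dual u^T w pA; rewrite trmxK -e1.
set t := qf (invmx B) u in e1 e2 * => hCS.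
have t0 : 0 <= t by rewrite e2 posdef_ge0.
have a0 : 0 <= qf (invmx A) u by apply: posdef_ge0; exact: posdef_inv.
apply: sqr_le_mull_le; first exact: mulr_ge0.
apply: le_trans hCS _; rewrite mulrAC [leRHS]mulrC.
by rewrite ler_wpM2l // e2 mulrC; have [] := h w; rewrite mulrC.
Qed.

(** [y = invmx T *m x] is an eigenvector of [S] relative to [T] with eigenvalue [l^-1], and the
    window is symmetric under inversion. *)
Lemma eigen_gap_inv n d (S T : 'M[R]_n) : posdef S -> posdef T ->
  eigen_gap d S T -> eigen_gap d (invmx S) (invmx T).
Proof.
move=> pS pT g x l x0 e.
have uS := posdef_unit pS; have uT := posdef_unit pT.
set y := invmx T *m x.
have y0 : y != 0.
  by apply: contra_neq x0 => h; rewrite -(mulKVmx uT x) -/y h mulmx0.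
have Ty : T *m y = l *: (S *m y).
  by rewrite scalemxAr -e mulKVmx // /y mulKVmx.
have qe : qf T y = l * qf S y by rewrite /bf -!mulmxA Ty -scalemxAr mxE.
have qS := proj2 pS y y0; have qT := proj2 pT y y0.
have l0 : 0 < l by rewrite -(pmulr_lgt0 _ qS) -qe.
have : S *m y = l^-1 *: (T *m y) by rewrite Ty scalerA mulVf ?scale1r // lt0r_neq0.
move/(g y _ y0); case=> h; [right|left].
  by move: h; rewrite -[l^-1]mul1r ler_pdivrMr.
by move: h; rewrite ler_pdivlMr // mul1r.
Qed.

Lemma quasigeo_inv n (b c q : R) T (S : nat -> 'M[R]_n) : 1 <= b ->
  quasigeo b c q T S -> quasigeo b c q T (fun i => invmx (S i)).
Proof.
move=> b1 [pS st gap]; split.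
- by move=> i iT; apply: posdef_inv; exact: pS.
- move=> i iT; apply: comparable_forms_inv; [exact: le_trans b1| | |exact: st];
    by apply: pS; lia.
- by move=> i j ij; apply: eigen_gap_inv; [apply: pS; lia|apply: pS; lia|exact: gap].
Qed.

Lemma comparable_forms_mono n (b b' : R) (S T : 'M[R]_n) : posdef S -> posdef T ->
  b <= b' -> comparable_forms b S T -> comparable_forms b' S T.
Proof.
move=> pS pT bb h x; have [h1 h2] := h x.
by split; [apply: le_trans h1 _|apply: le_trans h2 _]; rewrite ler_wpM2r // posdef_ge0.
Qed.

Lemma ex_exp4 (x : R) : exists k, x <= 4 ^+ k.
Proof.
exists (Num.Def.archi_bound x).
have [x0|x0] := lerP 0 x; last by apply: le_trans (ltW x0) _; exact: exprn_ge0.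
apply: le_trans (ltW (archi_boundP x0)) _.
rewrite -natrX ler_nat; apply: leq_trans (ltnW (ltn_expl _ (isT : 1 < 4)%N)) _ => //.
Qed.

Lemma exp4_bracket (l : R) : 0 < l -> l <= 1 ->
  exists k, (4 ^+ k)^-1 <= l /\ l <= 4 * (4 ^+ k)^-1.
Proof.
move=> l0 l1; have [k hk] := ex_exp4 l^-1.
have {}hk : (4 ^+ k)^-1 <= l.
  by rewrite -[leRHS]invrK lef_pV2 // ?posrE ?exprn_gt0 ?invr_gt0.
elim: k hk => [|k IH] hk.
  by exists 0%N; split => //; rewrite expr0 invr1; lra.
have [h|h] := lerP (4 ^+ k)^-1 l; first exact: IH.
exists k.+1; split=> //; apply: le_trans (ltW h) _.
by rewrite exprS invfM mulVKf ?pnatr_eq0.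
Qed.

Lemma ex_exp_le (q x : R) : 0 < q -> 4 * q ^+ 24 <= 1 -> 0 < x ->
  exists D, q ^+ (2 * D) <= x.
Proof.
move=> q0 q24 x0; have [k hk] := ex_exp4 x^-1; exists (12 * k)%N.
rewrite mulnA exprM; apply: (@le_trans _ _ ((4 ^+ k)^-1)).
  rewrite -exprVn; apply: lerXn2r; rewrite ?nnegrE ?invr_ge0 //.
    by rewrite exprn_ge0 // ltW.
  by rewrite -[leRHS]mul1r ler_pdivlMr // mulrC.
by rewrite -[leRHS]invrK lef_pV2 ?posrE ?exprn_gt0 ?invr_gt0.
Qed.

Lemma ex_min_nat (P : nat -> Prop) : (exists k, P k) ->
  exists k, P k /\ forall j, P j -> (k <= j)%N.
Proof.
move=> [k0 Pk0]; have ex : exists k, `[< P k >] by exists k0; apply/asboolP.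
case: (ex_minnP ex) => k /asboolP Pk h; exists k; split=> // j Pj.
by apply: h; apply/asboolP.
Qed.

End Duality.

(** * The contradiction for an abstract family of forms *)

Section Core.
Variables (R : realType) (d : nat).
Local Notation qf S x := (bf S x x).
Variables (fam : 'M[R]_d -> Prop) (good : 'cV[R]_d -> 'rV[R]_d -> Prop) (r0 : R).
Hypothesis fam_posdef : forall S, fam S -> posdef S.
Hypothesis goodZ : forall x f s t, good x f -> good (s *: x) (t *: f).
Hypothesis good_form : forall S x, fam S -> good x (x^T *m S).
Hypothesis r0_ge1 : 1 <= r0.
Hypothesis fam_near : forall x f, good x f -> f *m x = 1%:M ->
  exists S, [/\ fam S, qf S x <= r0 & qf (invmx S) f^T <= r0].

(** [s = true] selects the dual form, so that one statement covers vectors and covectors. *)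
Definition qfs (s : bool) (S : 'M[R]_d) y := qf (if s then invmx S else S) y.

Lemma qfs_ge0 s S y : fam S -> 0 <= qfs s S y.
Proof.
by move=> /fam_posdef pS; apply: posdef_ge0; case: s => //; exact: posdef_inv.
Qed.

Lemma qfs_dual S (f : 'rV[R]_d) x : fam S ->
  ((f *m x) 0 0) ^+ 2 <= qfs true S f^T * qfs false S x.
Proof. by move=> /fam_posdef; exact: posdef_CS_dual. Qed.

(** * Distances in the graph of comparable forms *)

Section Graph.
Variable b : R.
Hypothesis b1 : 1 <= b.
Hypothesis fam_unique : forall S T x f, fam S -> fam T -> good x f -> f *m x = 1%:M ->
  qf S x <= 4 * r0 -> qf (invmx S) f^T <= 4 * r0 ->
  qf T x <= 4 * r0 -> qf (invmx T) f^T <= 4 * r0 -> comparable_forms b S T.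

Definition path_on k (g : nat -> 'M[R]_d) :=
  (forall i, (i <= k)%N -> fam (g i)) /\
  (forall i, (i < k)%N -> comparable_forms b (g i) (g i.+1)).

Definition chain k S T := exists g, [/\ path_on k g, g 0%N = S & g k = T].

Lemma chain_sym k S T : chain k S T -> chain k T S.
Proof.
case=> g [[h1 h2] e0 ek]; exists (fun i => g (k - i)%N); split.
- split=> [i ik|i ik]; first by apply: h1; lia.
  apply: comparable_formsC; have -> : (k - i = (k - i.+1).+1)%N by lia.
  by apply: h2; lia.
- by rewrite subn0.
- by rewrite subnn.
Qed.

Lemma chain_cat k l S T U : chain k S T -> chain l T U -> chain (k + l) S U.
Proof.
case=> g [[g1 g2] g0 gk] [h [[h1 h2] h0 hl]].
exists (fun i => if (i <= k)%N then g i else h (i - k)%N); split.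
- split=> [i ik|i ik].
    by case: leqP => ki; [apply: g1|apply: h1; lia].
  case: (ltngtP i k) => ki.
  + exact: g2.
  + have -> : (i.+1 - k = (i - k).+1)%N by lia.
    by apply: h2; lia.
  + by rewrite ki subSn // subnn gk -h0; apply: h2; lia.
- by rewrite leq0n.
- case: leqP => hk; last by rewrite addKn.
  have l0 : l = 0%N by lia.
  by rewrite l0 addn0 gk -hl l0 h0.
Qed.

Lemma chain_edge S T : fam S -> fam T -> comparable_forms b S T -> chain 1 S T.
Proof.
move=> fS fT h; exists (fun i => if i is 0 then S else T); split=> //.
by split=> [[|i]|[|i]].
Qed.

Lemma path_chain k g i j : path_on k g -> (i <= j <= k)%N -> chain (j - i) (g i) (g j).
Proof.
move=> [h1 h2] /andP[ij jk]; exists (fun m => g (i + m)%N); split.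
- split=> m hm; first by apply: h1; lia.
  by rewrite addnS; apply: h2; lia.
- by rewrite addn0.
- by rewrite subnKC.
Qed.

(** On an eigenvector [A] and [B] induce proportional functionals, so the good pairs
    [(2^i e, 2^-i f)] lead from one bounded for [B] at [i = 0] to one bounded for [A] at [i = k].
    Passing from [i] to [i + 1] multiplies the value on the vector by 4, whence the level [4 * r0]
    in [fam_unique]. The length is [k] plus one edge at each end. *)
Lemma eigen_chain_le1 A B (x : 'cV[R]_d) l k : fam A -> fam B -> x != 0 ->
  A *m x = l *: (B *m x) -> (4 ^+ k)^-1 <= l -> l <= 4 * (4 ^+ k)^-1 ->
  chain k.+2 B A.
Proof.
move=> fA fB x0 Ax lk1 lk2; have r1 := r0_ge1.
have pA := fam_posdef fA; have pB := fam_posdef fB.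
have uA := posdef_unit pA; have uB := posdef_unit pB.
have qB0 : 0 < qf B x by apply: (proj2 pB).
pose c := (Num.sqrt (qf B x))^-1; pose e := c *: x; pose f := e^T *m B.
have Ae : A *m e = l *: (B *m e) by rewrite /e -!scalemxAr Ax scalerA mulrC -scalerA.
have qBe : qf B e = 1.
  rewrite bfZl bfZr mulrA -expr2 exprVn sqr_sqrtr ?mulVf ?lt0r_neq0 //; exact: ltW.
have k0 i : 0 < (4 : R) ^+ i by rewrite exprn_gt0.
have t0 i : 0 < (2 : R) ^+ i by rewrite exprn_gt0.
have l0 : 0 < l by apply: lt_le_trans lk1; rewrite invr_gt0.
have fT : f^T = B *m e by rewrite /f trmx_mul trmxK (proj1 pB).
have qBf : qf (invmx B) f^T = 1.
  by rewrite fT bfM /bf trmx_mul (proj1 pB) -!mulmxA mulKmx // mulmxA.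
have qAe : qf A e = l by rewrite /bf -mulmxA Ae -scalemxAr mulmxA mxE -/(qf B e) qBe mulr1.
have qAf : qf (invmx A) f^T = l^-1.
  have -> : f^T = l^-1 *: (A *m e) by rewrite Ae scalerA mulVf ?scale1r ?lt0r_neq0.
  rewrite bfZl bfZr bfM /bf trmx_mul (proj1 pA) -!mulmxA mulKmx // mulmxA -/(qf A e) qAe.
  by field; rewrite lt0r_neq0.
pose xi i := 2 ^+ i *: e; pose fi i := (2 ^+ i)^-1 *: f.
have gi i : good (xi i) (fi i) by apply: goodZ; exact: good_form.
have fxi i : fi i *m xi i = 1%:M.
  rewrite -scalemxAl -scalemxAr scalerA mulVf ?lt0r_neq0 // scale1r.
  by apply/matrixP => ? ?; rewrite !ord1 -/(qf B e) qBe !mxE.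
have e24 i : ((2 : R) ^+ i) * 2 ^+ i = 4 ^+ i by rewrite -exprMn; congr (_ ^+ _); ring.
have qxi S i : qf S (xi i) = 4 ^+ i * qf S e by rewrite bfZl bfZr mulrA e24.
have qfi S i : qf S (fi i)^T = (4 ^+ i)^-1 * qf S f^T.
  by rewrite linearZ /= bfZl bfZr mulrA -invfM e24.
have fam_i i : exists S, [/\ fam S, qf S (xi i) <= r0, qf (invmx S) (fi i)^T <= r0
   & chain i.+1 B S].
  elim: i => [|i [S [fS h1 h2 ch]]].
    have [S [fS h1 h2]] := fam_near (gi 0%N) (fxi 0%N); exists S; split=> //.
    apply: chain_edge => //; apply: (fam_unique fB fS (gi 0%N) (fxi 0%N)).
    - by rewrite qxi qBe expr0; lra.
    - by rewrite qfi qBf expr0 invr1; lra.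
    - lra.
    - lra.
  have [T [fT' h3 h4]] := fam_near (gi i.+1) (fxi i.+1); exists T; split=> //.
  rewrite -addn1; apply: chain_cat ch _; apply: chain_edge => //.
  have s0 : 0 <= qf (invmx S) f^T by apply/posdef_ge0/posdef_inv/fam_posdef.
  apply: (fam_unique fS fT' (gi i.+1) (fxi i.+1)).
  - by move: h1; rewrite !qxi exprS -mulrA; lra.
  - move: h2; rewrite !qfi exprS invfM -mulrA => h2; lra.
  - lra.
  - lra.
have [S [fS h1 h2 ch]] := fam_i k.
rewrite -addn1; apply: chain_cat ch _; apply: chain_edge => //.
apply: (fam_unique fS fA (gi k) (fxi k)); try lra.
  by rewrite qxi qAe; move: lk2; rewrite -ler_pdivrMr ?invr_gt0 // invrK; lra.
rewrite qfi qAf -invfM; suff: (4 ^+ k * l)^-1 <= 1 by lra.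
rewrite invf_le1 ?mulr_gt0 //; move: lk1; rewrite -[X in X <= _]mul1r ler_pdivrMr //.
by rewrite mulrC.
Qed.

Lemma eigen_chain A B (x : 'cV[R]_d) l : fam A -> fam B -> x != 0 -> A *m x = l *: (B *m x) ->
  exists k, chain k.+2 A B /\
    ((l <= 1 /\ l <= 4 * (4 ^+ k)^-1) \/ (1 <= l /\ l^-1 <= 4 * (4 ^+ k)^-1)).
Proof.
move=> fA fB x0 Ax.
have pA := fam_posdef fA; have pB := fam_posdef fB.
have qA := proj2 pA x x0; have qB := proj2 pB x x0.
have e : qf A x = l * qf B x by rewrite /bf -!mulmxA Ax -scalemxAr mxE.
have l0 : 0 < l by rewrite -(pmulr_lgt0 _ qB) -e.
have [l1|l1] := lerP l 1.
  have [k [h1 h2]] := exp4_bracket l0 l1; exists k; split; last by left.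
  by apply: chain_sym; apply: eigen_chain_le1 Ax h1 h2.
have li0 : 0 < l^-1 by rewrite invr_gt0.
have li1 : l^-1 <= 1 by rewrite invf_le1 // ltW.
have [k [h1 h2]] := exp4_bracket li0 li1; exists k; split; last by right; split; first exact: ltW.
apply: eigen_chain_le1 h1 h2 => //; first exact: x0.
by rewrite Ax scalerA mulVf ?scale1r // lt0r_neq0.
Qed.

Lemma fam_connected S T : (0 < d)%N -> fam S -> fam T -> exists k, chain k S T.
Proof.
move=> d0 fS fT; have pS := fam_posdef fS; have pT := fam_posdef fT.
have [x [l [x0 e]]] : exists (x : 'cV[R]_d) l, x != 0 /\ S *m x = l *: (T *m x).
  by case: (d) d0 S T pS pT {fS fT} => // m _ S T pS pT; apply: pencil_eigenvector => //; case: pS.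
by have [k [ch _]] := eigen_chain fS fT x0 e; exists k.+2.
Qed.

(** * Quasi-geodesics and contraction in the graph *)

Section Rates.
Variable q : R.
Hypotheses (q0 : 0 < q) (q1 : q < 1) (q12 : 1 <= 4 * q ^+ 12) (q24 : 4 * q ^+ 24 <= 1).

(** If an eigenvalue or its inverse is at most [4 * 4^-k], through a chain of length [k + 2], then
    [m = j - i] satisfies [4 m <= 12 k + 24]. With [1 <= 4 * q ^+ 12] and [4 * q ^+ 24 <= 1] that
    bound is at most [q ^+ (4 * m) / q ^+ 48], the square of [(q ^+ 2) ^+ m / q ^+ 24]. *)
Lemma path_quasigeo T g : path_on T g ->
  (forall i j l, (i <= j <= T)%N -> chain l (g i) (g j) -> (j - i <= 3 * l)%N) ->
  quasigeo b ((q ^+ 24)^-1) (q ^+ 2) T g.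
Proof.
move=> [h1 h2] h3; split=> // [i iT|i j ij x l x0 e]; first by apply/fam_posdef/h1.
have fi : fam (g i) by apply: h1; lia.
have fj : fam (g j) by apply: h1; lia.
have [k [ch hl]] := eigen_chain fi fj x0 e.
have := h3 i j _ ij ch; set m := (j - i)%N => hm.
have hmk : (4 * m <= 12 * k + 24)%N by clear -hm; lia.
set D := (_ ^+ 2).
have hD : 4 * (4 ^+ k)^-1 <= D.
  have q48 : 0 < q ^+ 48 by rewrite exprn_gt0.
  have -> : D = q ^+ (4 * m) / q ^+ 48.
    rewrite /D exprMn exprVn -!exprM mulrC.
    by rewrite mulnAC.
  rewrite ler_pdivlMr // .
  apply: (@le_trans _ _ (q ^+ (12 * k) * q ^+ 24)).
    have -> : (4 : R) * (4 ^+ k)^-1 * q ^+ 48 = (4 ^+ k)^-1 * (4 * q ^+ 24) * q ^+ 24.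
      by rewrite -[48%N]/(24 + 24)%N exprD; ring.
    apply: ler_wpM2r; first by rewrite exprn_ge0 // ltW.
    apply: (@le_trans _ _ (4 ^+ k)^-1).
      by rewrite ler_piMr // invr_ge0 exprn_ge0.
    rewrite exprM -exprVn; apply: lerXn2r; rewrite ?nnegrE ?invr_ge0 ?exprn_ge0 ?(ltW q0) //.
    by rewrite -[X in X <= _]mul1r ler_pdivrMr // mulrC.
  by rewrite -exprD; apply: ler_wiXn2l; [exact: ltW|exact: ltW|].
case: hl => [[_ h]|[l1 h]]; [left|right]; first exact: le_trans hD.
have l0 : 0 < l by lra.
by rewrite -ler_pdivrMr // div1r; apply: le_trans hD.
Qed.

Definition geodesic L g := path_on L g /\
  forall i j l, (i <= j <= L)%N -> chain l (g i) (g j) -> (j - i <= l)%N.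

Lemma ex_geodesic S T : (exists k, chain k S T) ->
  exists L g, [/\ geodesic L g, g 0%N = S & g L = T].
Proof.
move=> /ex_min_nat [L [[g [pg g0 gL]] hmin]]; exists L, g; split=> //; split=> //.
move=> i j l ij ch.
have c1 : chain i S (g i) by have := path_chain (i := 0) (j := i) pg; rewrite subn0 g0; apply; lia.
have c2 : chain (L - j) (g j) T by have := path_chain (i := j) (j := L) pg; rewrite gL; apply; lia.
have := hmin _ (chain_cat c1 (chain_cat ch c2)); lia.
Qed.

Definition joined (a : nat) (h g : nat -> 'M[R]_d) i :=
  if (i <= a)%N then h (a - i)%N else g (i - a)%N.

(* Concatenating at a nearest point gives a quasi-geodesic, in any metric space. *)
Lemma joined_quasigeo a h L g : geodesic a h -> geodesic L g -> h 0%N = g 0%N ->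
  (forall i l, (i <= L)%N -> chain l (g i) (h a) -> (a <= l)%N) ->
  quasigeo b ((q ^+ 24)^-1) (q ^+ 2) (a + L) (joined a h g).
Proof.
move=> [[h1 h2] h3] [[g1 g2] g3] hg near; apply: path_quasigeo.
  split=> i iT; rewrite /joined.
    by case: leqP => ia; [apply: h1; lia|apply: g1; lia].
  case: (ltngtP i a) => ia.
  + apply: comparable_formsC; have -> : (a - i = (a - i.+1).+1)%N by lia.
    by apply: h2; lia.
  + have -> : (i.+1 - a = (i - a).+1)%N by lia.
    by apply: g2; lia.
  + by rewrite ia subnn subSn // subnn hg; apply: g2; lia.
move=> i j l ij; rewrite /joined; case: (leqP i a) => ia; case: (leqP j a) => ja.
- move=> /chain_sym ch; have hij : (a - j <= a - i <= a)%N by lia.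
  by have := h3 _ _ _ hij ch; lia.
- move=> ch; set x := (a - i)%N in ch; set y := (j - a)%N in ch.
  have c1 : chain x (g 0%N) (h x).
    have := path_chain (k := a) (i := 0) (j := x) (conj h1 h2); rewrite subn0 hg; apply; lia.
  have c2 : chain (a - x) (h x) (h a).
    by apply: (path_chain (conj h1 h2)); lia.
  (* Minimality of [a] gives [a <= l + (a - x)], so [x <= l]. As [g] is geodesic, [y <= x + l],
     hence [j - i = x + y <= 3 * l]: the factor 3 of [path_quasigeo]. *)
  have e1 : (x <= l)%N.
    have yL : (y <= L)%N by lia.
    by have := near y _ yL (chain_cat (chain_sym ch) c2); rewrite /y /x; lia.
  have hy : (0 <= y <= L)%N by lia.
  by have := g3 _ _ _ hy (chain_cat c1 ch); lia.
- lia.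
- move=> ch; have hij : (i - a <= j - a <= L)%N by lia.
  by have := g3 _ _ _ hij ch; lia.
Qed.

Variables K : R.
Hypothesis K1 : 1 <= K.
Hypothesis contr : forall T (S : nat -> 'M[R]_d),
  quasigeo b ((q ^+ 24)^-1) (q ^+ 2) T S -> forall s i v, (i <= T)%N ->
  qfs s (S i) v <= K * (q ^+ (2 * i) * qfs s (S 0%N) v
                        + q ^+ (2 * (T - i)) * qfs s (S T) v).
Hypothesis d0 : (0 < d)%N.


Let qle1 i : q ^+ i <= 1.
Proof. by rewrite exprn_ile1 // ltW. Qed.

Lemma geodesic_rev L t (g : nat -> 'M[R]_d) : geodesic L g -> (t <= L)%N ->
  geodesic t (fun i => g (t - i)%N).
Proof.
move=> [[h1 h2] h3] tL; split; first split.
- by move=> i it; apply: h1; lia.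
- move=> i it; apply: comparable_formsC; have -> : (t - i = (t - i.+1).+1)%N by lia.
  by apply: h2; lia.
- move=> i j l ij /chain_sym ch; have hij : (t - j <= t - i <= L)%N by lia.
  by have := h3 _ _ _ hij ch; lia.
Qed.

Lemma geodesic_shift L t (g : nat -> 'M[R]_d) : geodesic L g -> (t <= L)%N ->
  geodesic (L - t) (fun i => g (t + i)%N).
Proof.
move=> [[h1 h2] h3] tL; split; first split.
- by move=> i it; apply: h1; lia.
- by move=> i it; rewrite addnS; apply: h2; lia.
- move=> i j l ij ch; have hij : (t + i <= t + j <= L)%N by lia.
  by have := h3 _ _ _ hij ch; lia.
Qed.

Lemma path_growth L g s v t : path_on L g -> (t <= L)%N ->
  qfs s (g 0%N) v <= b ^+ t * qfs s (g t) v.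
Proof.
have b0 : 0 <= b by apply: le_trans b1.
move=> [h1 h2]; elim: t => [|t IH] tL; first by rewrite expr0 mul1r.
apply: le_trans (IH (ltnW tL)) _; rewrite exprSr -mulrA ler_wpM2l ?exprn_ge0 //.
have pt := fam_posdef (h1 t (ltnW tL)); have pt1 := fam_posdef (h1 t.+1 tL).
case: s {IH}; last by have [] := h2 t tL v.
by have [] := comparable_forms_inv b0 pt pt1 (h2 t tL) v.
Qed.

Lemma joined_start a h (g : nat -> 'M[R]_d) : joined a h g 0%N = h a.
Proof. by rewrite /joined leq0n subn0. Qed.

Lemma joined_add a h (g : nat -> 'M[R]_d) i : h 0%N = g 0%N -> joined a h g (a + i) = g i.
Proof.
move=> hg; rewrite /joined; case: leqP => ai; last by rewrite addKn.
have -> : i = 0%N by lia.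
by rewrite addn0 subnn.
Qed.

(** On a geodesic [g] from [N] to [M], let [g t] be nearest to [M']. If [t >= D], then [g D] lies on
    the geodesic to [M] and on a quasi-geodesic to [M'], [D] steps from [N] on both, and contraction
    applies twice. If [t < D], then [g t] lies on a quasi-geodesic from [M'] to [M] and is bounded
    by their sum, while [N] is fewer than [D] edges away; this contradicts the lower bound at
    [v0]. *)
Lemma common_contraction N M M' D s0 v0 : fam N -> fam M -> fam M' ->
  K * (qfs s0 M v0 + qfs s0 M' v0) * b ^+ D < qfs s0 N v0 ->
  exists Q, fam Q /\ forall s y,
    qfs s Q y <= K * (q ^+ (2 * D) * qfs s N y + qfs s M y) /\
    qfs s Q y <= K * (q ^+ (2 * D) * qfs s N y + qfs s M' y).
Proof.
move=> fN fM fM' big.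
have K0 : 0 <= K by apply: le_trans K1.
have conn S T : fam S -> fam T -> exists k, chain k S T.
  by move=> fS fT; apply: (fam_connected d0 fS fT).
have [L [g [gg g0 gL]]] := ex_geodesic (conn _ _ fN fM).
have [pg _] := gg; have fg i : (i <= L)%N -> fam (g i) by case: pg => h _; apply: h.
have [a [[t [tL ct]] amin]] : exists a, (exists t, (t <= L)%N /\ chain a (g t) M')
    /\ forall j, (exists t, (t <= L)%N /\ chain j (g t) M') -> (a <= j)%N.
  apply: ex_min_nat; have [k ck] := conn _ _ fN fM'.
  by exists k, 0%N; rewrite g0.
have [a' [h [gh h0 ha']]] := ex_geodesic (ex_intro _ a ct).
have aa : a' = a.
  have le1 : (a <= a')%N.
    apply: amin; exists t; split=> //; exists h; split=> //; by case: gh.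
  have hh : (0 <= a' <= a')%N by rewrite leqnn.
  have := proj2 gh _ _ a hh; rewrite h0 ha' => /(_ ct) le2.
  by apply/eqP; rewrite eqn_leq le1 andbT -(subn0 a').
rewrite {}aa in gh ha'.
have nearR i l : (i <= L - t)%N -> chain l (g (t + i)%N) (h a) -> (a <= l)%N.
  by rewrite ha' => iL c; apply: amin; exists (t + i)%N; split=> //; clear -iL tL; lia.
have nearL i l : (i <= t)%N -> chain l (g (t - i)%N) (h a) -> (a <= l)%N.
  by rewrite ha' => iL c; apply: amin; exists (t - i)%N; split=> //; clear -iL tL; lia.
have qm i s S y : fam S -> q ^+ i * qfs s S y <= qfs s S y.
  by move=> fS; rewrite ler_piMl ?qle1 ?qfs_ge0.
have [tD|Dt] := ltnP t D.
  pose gr i := g (t + i)%N.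
  have hg : h 0%N = gr 0%N by rewrite h0 /gr addn0.
  have Q := joined_quasigeo gh (geodesic_shift gg tL) hg nearR.
  have := contr Q s0 v0 (leq_addr (L - t) a).
  have := joined_add a 0 hg; rewrite addn0 => ->.
  rewrite joined_start (joined_add _ _ hg) /gr addn0 ha' subnKC // gL addKn => c1.
  have c2 := path_growth s0 v0 pg tL; rewrite g0 in c2.
  have c3 : b ^+ t <= b ^+ D by apply: ler_weXn2l => //; exact: ltnW.
  have b0 : 0 <= b by apply: le_trans b1.
  exfalso; move: big; apply/negP; rewrite -leNgt; apply: le_trans c2 _.
  rewrite [leRHS]mulrC; apply: ler_pM => //; first by rewrite exprn_ge0.
    by apply: qfs_ge0; exact: fg.
  apply: le_trans c1 _; rewrite ler_wpM2l // addrC.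
  by apply: lerD; apply: qm.
have DL : (D <= L)%N := leq_trans Dt tL.
exists (g D); split; first exact: fg.
move=> s y; split.
  have Q : quasigeo b ((q ^+ 24)^-1) (q ^+ 2) L g.
    apply: (path_quasigeo pg).
    by move=> i j l ij ch; have := proj2 gg _ _ _ ij ch; clear; lia.
  apply: le_trans (contr Q s y DL) _; rewrite ler_wpM2l // g0 gL lerD2l; exact: qm.
pose gr i := g (t - i)%N.
have hg : h 0%N = gr 0%N by rewrite h0 /gr subn0.
have Q := joined_quasigeo gh (geodesic_rev gg tL) hg nearL.
have iT : (a + (t - D) <= a + t)%N by rewrite leq_add2l leq_subr.
have := contr Q s y iT; rewrite joined_start !(joined_add _ _ hg) ha' /gr subnn g0.
have -> : (t - (t - D) = D)%N by rewrite subKn.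
have -> : (a + t - (a + (t - D)) = D)%N by rewrite subnDl subKn.
move=> c; apply: le_trans c _; rewrite ler_wpM2l // addrC lerD2l; exact: qm.
Qed.


End Rates.
End Graph.
Hypothesis fam_unique : forall r, exists b, forall S T x f,
  fam S -> fam T -> good x f -> f *m x = 1%:M ->
  qf S x <= r -> qf (invmx S) f^T <= r ->
  qf T x <= r -> qf (invmx T) f^T <= r -> comparable_forms b S T.

Lemma qf_D_le (S : 'M[R]_d) x y : posdef S -> qf S (x + y) <= 2 * qf S x + 2 * qf S y.
Proof.
move=> pS; have := posdef_ge0 (x - y) pS.
rewrite -[x - y]/(x + - y) -(scaleN1r y) !(bfDl, bfDr, bfZl, bfZr) => h; lra.
Qed.

(** Constants are chosen backwards from the contradiction: depth [Db] and level [ee] for [Q2], then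
    depth [Da] and level [e] for [Q1], and last the scale [t] of the pairs. All depths are measured
    from one base form [N]. *)
Theorem no_form_family (e1 e2 e3 : 'cV[R]_d) (f1 f2 f3 : 'rV[R]_d) :
  (forall u, good e1 (f3 + u *: (f1 + f2))) ->
  (forall u, good e2 (f3 + u *: (f1 + f2))) ->
  (forall u, good e2 (f1 + u *: f2)) ->
  f1 *m e1 = 1%:M -> f2 *m e2 = 1%:M -> f3 *m e3 = 1%:M ->
  f1 *m e2 = 0 -> f1 *m e3 = 0 -> f2 *m e1 = 0 -> f2 *m e3 = 0 ->
  f3 *m e1 = 0 -> f3 *m e2 = 0 -> False.
Proof.
move=> g1 g2 g3 f11 f22 f33 f12 f13 f21 f23 f31 f32.
have r1 := r0_ge1.
have d0 : (0 < d)%N.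
  rewrite lt0n; apply/negP => /eqP dz.
  have : (f1 *m e1) 0 0 = 0 by rewrite mxE; move: e1 f1 {g1 g2 g3 f11 f12 f13 f21 f31}; rewrite dz => ? ?; rewrite big_ord0.
  by rewrite f11 mxE => /eqP; rewrite oner_eq0.
have [b0 hb0] := fam_unique (4 * r0).
pose b := Num.max 1 b0.
have b1 : 1 <= b by rewrite le_max lexx.
have hb S T x f : fam S -> fam T -> good x f -> f *m x = 1%:M ->
  qf S x <= 4 * r0 -> qf (invmx S) f^T <= 4 * r0 ->
  qf T x <= 4 * r0 -> qf (invmx T) f^T <= 4 * r0 -> comparable_forms b S T.
  move=> fS fT h h1 h2 h3 h4 h5; apply: (@comparable_forms_mono _ _ b0);
    [exact: fam_posdef|exact: fam_posdef| |exact: hb0 h1 h2 h3 h4 h5].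
  by rewrite le_max lexx orbT.
(* Any [q] in the unit interval with [q ^+ 24 <= 1/4 <= q ^+ 12] would do. *)
pose q : R := 9 / 10.
have q0 : 0 < q by rewrite /q; lra.
have q1 : q < 1 by rewrite /q; lra.
have q4 : 13 / 20 <= q ^+ 4 <= 66 / 100 by rewrite /q; apply/andP; split; lra.
have q12 : 1 <= 4 * q ^+ 12.
  case/andP: q4 => q4 _; rewrite -[12%N]/(4 * 3)%N exprM.
  have : (13 / 20) ^+ 3 <= (q ^+ 4) ^+ 3.
    by apply: lerXn2r => //; rewrite nnegrE; first [apply: exprn_ge0; exact: ltW | lra].
  lra.
have q24 : 4 * q ^+ 24 <= 1.
  case/andP: q4 => _ q4; rewrite -[24%N]/(4 * 6)%N exprM.
  have : (q ^+ 4) ^+ 6 <= (66 / 100) ^+ 6.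
    by apply: lerXn2r => //; rewrite nnegrE; first [apply: exprn_ge0; exact: ltW | lra].
  lra.
have c1 : 1 <= (q ^+ 24)^-1.
  by rewrite invf_ge1 ?exprn_gt0 // exprn_ile1 // ltW.
have [K K1 hK] := quasigeo_contraction d b1 c1 q0 q1.
have contr T (S : nat -> 'M[R]_d) : quasigeo b ((q ^+ 24)^-1) (q ^+ 2) T S ->
   forall s i v, (i <= T)%N ->
   qfs s (S i) v <= K * (q ^+ (2 * i) * qfs s (S 0%N) v
                        + q ^+ (2 * (T - i)) * qfs s (S T) v).
  move=> Q [] i v iT; last exact: hK.
  exact: (hK _ _ (quasigeo_inv b1 Q)).
have CC := common_contraction b1 hb q0 q1 q12 q24 K1 contr d0.
have K0 : 0 < K by lra.
have ex_q := ex_exp_le q0 q24.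
have [N [fN _ _]] : exists S, [/\ fam S, qf S e2 <= r0 & qf (invmx S) (f1 + 1 *: f2)^T <= r0].
  apply: fam_near; first exact: g3.
  by rewrite mulmxDl scale1r f12 f22 add0r.
have pN := fam_posdef fN; have pNi := posdef_inv pN.
(* One bound for all values of [N] that occur and, by duality, for the inverses of those that must
   stay away from 0. *)
pose c0 := 1 + qfs false N e1 + qfs false N e2 + qfs false N e3
  + 2 * qfs true N f1^T + 2 * qfs true N f2^T + 2 * qfs true N f3^T
  + 2 * qfs true N (f1 + f2)^T.
have n1 := qfs_ge0 false e1 fN; have n2 := qfs_ge0 false e2 fN.
have n3 := qfs_ge0 false e3 fN; have m1 := qfs_ge0 true f1^T fN.
have m2 := qfs_ge0 true f2^T fN; have m3 := qfs_ge0 true f3^T fN.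
have m12 := qfs_ge0 true (f1 + f2)^T fN.
have c00 : 0 < c0 by rewrite /c0; lra.
have lowN s y x : (1 : R) <= x * qfs s N y -> x <= c0 -> c0^-1 <= qfs s N y.
  move=> h1 h2; rewrite -div1r ler_pdivrMr //; apply: le_trans h1 _.
  by rewrite mulrC ler_wpM2l ?qfs_ge0.
have [Db hDb] : exists D, q ^+ (2 * D) <= (4 * K * c0)^-1.
  by apply: ex_q; rewrite invr_gt0 !mulr_gt0.
(* The first bound keeps the contribution of [Q1] and [M3] to [Q2] below 1/4; the second meets the
   hypothesis of [common_contraction] at depth [Db]. The two bounds in [e] play the same roles for
   [Q1]. *)
pose ee := Num.min (4 * K)^-1 (4 * K * b ^+ Db * c0)^-1.
have bD D : 0 < b ^+ D by rewrite exprn_gt0 //; lra.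
have ee0 : 0 < ee by rewrite /ee lt_min !invr_gt0 !mulr_gt0 // mulr_gt0.
have ee1 : K * ee <= 1 / 4.
  have : ee <= (4 * K)^-1 by rewrite /ee ge_min lexx.
  by rewrite -[X in _ <= X]div1r ler_pdivlMr ?mulr_gt0 //; lra.
have ee2 : K * (ee + ee) * b ^+ Db < c0^-1.
  have : ee <= (4 * K * b ^+ Db * c0)^-1 by rewrite /ee ge_min lexx orbT.
  rewrite -[X in _ <= X]div1r ler_pdivlMr ?mulr_gt0 // => h.
  rewrite -div1r ltr_pdivlMr //; lra.
have [Da hDa] : exists D, q ^+ (2 * D) <= ee / (2 * K * c0).
  by apply: ex_q; rewrite divr_gt0 // !mulr_gt0.
pose e := Num.min (ee / (2 * K)) (4 * K * b ^+ Da * c0)^-1.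
have e0 : 0 < e by rewrite /e lt_min divr_gt0 ?invr_gt0 ?mulr_gt0.
have ea : K * e <= ee / 2.
  have : e <= ee / (2 * K) by rewrite /e ge_min lexx.
  by rewrite ler_pdivlMr ?mulr_gt0 //; lra.
have ec : e <= ee by nra.
have eb : K * (e + e) * b ^+ Da < c0^-1.
  have : e <= (4 * K * b ^+ Da * c0)^-1 by rewrite /e ge_min lexx orbT.
  rewrite -[X in _ <= X]div1r ler_pdivlMr ?mulr_gt0 // => h.
  rewrite -div1r ltr_pdivlMr //; lra.
(* A pair of value [t ^+ 2], divided by [t] on both sides, has value 1; undoing the scaling turns
   the bounds [r0] into [t ^+ 2 * r0]. *)
pose t := Num.min 1 (e / r0).
have t0 : 0 < t by rewrite /t lt_min ltr01 divr_gt0 //; lra.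
have t1 : t <= 1 by rewrite /t ge_min lexx.
have tr : t ^+ 2 * r0 <= e.
  have : t <= e / r0 by rewrite /t ge_min lexx orbT.
  rewrite ler_pdivlMr; last lra.
  move=> h; apply: le_trans h; rewrite expr2 -mulrA ler_piMl // mulr_ge0 //; lra.
(* [M1] and [M2] both shrink [phi], so a common [Q1] shrinks [e1] and [e2]; [Q1] and [M3] both shrink
   [e2], so a common [Q2] shrinks [e1] and [psi], against [psi *m e1 = 1]. *)
pose phi := f3 + t ^+ 2 *: (f1 + f2); pose psi := f1 + t ^+ 2 *: f2.
have near x f : good x f -> f *m x = (t ^+ 2)%:M -> exists M, [/\ fam M,
    qfs false M x <= e & qfs true M f^T <= e].
  move=> gx fx; have [M [fM h1 h2]] : exists S, [/\ fam S, qf S (t^-1 *: x) <= r0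
      & qf (invmx S) (t^-1 *: f)^T <= r0].
    apply: fam_near; first exact: goodZ.
    rewrite -scalemxAl -scalemxAr fx scalerA scale_scalar_mx; congr (_%:M).
    by field; rewrite lt0r_neq0.
  have sc S z : qf S (t^-1 *: z) <= r0 -> qf S z <= e.
    rewrite bfZl bfZr mulrA -invfM => h; apply: le_trans tr.
    by rewrite expr2 mulrC -ler_pdivrMr ?mulr_gt0 // mulrC.
  by exists M; split=> //; apply: sc => //; move: h2; rewrite linearZ.
have sz0 : (t ^+ 2) *: (0 : 'M[R]_1) = 0 by rewrite scaler0.
have st1 : (t ^+ 2) *: (1%:M : 'M[R]_1) = (t ^+ 2)%:M by rewrite scale_scalar_mx mulr1.
have [M1 [fM1 x1 y1]] : exists M, [/\ fam M, qfs false M e1 <= e & qfs true M phi^T <= e].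
  apply: near; first exact: g1.
  by rewrite /phi mulmxDl -scalemxAl mulmxDl f31 f11 f21 addr0 add0r.
have [M2 [fM2 x2 y2]] : exists M, [/\ fam M, qfs false M e2 <= e & qfs true M phi^T <= e].
  apply: near; first exact: g2.
  by rewrite /phi mulmxDl -scalemxAl mulmxDl f32 f12 f22 !add0r.
have [M3 [fM3 x3 y3]] : exists M, [/\ fam M, qfs false M e2 <= e & qfs true M psi^T <= e].
  apply: near; first exact: g3.
  by rewrite /psi mulmxDl -scalemxAl f12 f22 add0r.
(* Whatever [t] is, [phi] equals 1 on [e3]: the third coordinate keeps [phi] from being small for
   [N]. *)
have low_phi : c0^-1 <= qfs true N phi^T.
  apply: (lowN _ _ (qfs false N e3)); last by rewrite /c0; lra.
  rewrite mulrC; apply: le_trans (qfs_dual phi e3 fN).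
  by rewrite /phi mulmxDl -scalemxAl mulmxDl f33 f13 f23 addr0 scaler0 addr0 mxE eqxx expr1n.
have low_e2 : c0^-1 <= qfs false N e2.
  apply: (lowN _ _ (qfs true N f2^T)); last by rewrite /c0; lra.
  by apply: le_trans (qfs_dual f2 e2 fN); rewrite f22 mxE eqxx expr1n.
have t2 : 0 <= (t ^+ 2) ^+ 2 <= 1.
  by rewrite sqr_ge0 -exprM exprn_ile1 // ltW.
have up_psi : qfs true N psi^T <= c0.
  apply: (@le_trans _ _ (2 * qfs true N f1^T + 2 * qfs true N f2^T)); last by rewrite /c0; lra.
  rewrite /psi linearD /=; apply: le_trans (qf_D_le _ _ pNi) _.
  rewrite lerD2l ler_pM2l // linearZ /= bfZl bfZr mulrA -expr2.
  by case/andP: t2 => ? ?; rewrite ler_piMl.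
have [Q1 [fQ1 hQ1]] : exists Q, fam Q /\ forall s y,
    qfs s Q y <= K * (q ^+ (2 * Da) * qfs s N y + qfs s M1 y) /\
    qfs s Q y <= K * (q ^+ (2 * Da) * qfs s N y + qfs s M2 y).
  apply: (CC _ _ _ _ true phi^T fN fM1 fM2).
  apply: lt_le_trans low_phi; apply: le_lt_trans eb.
  by rewrite (ler_wpM2r (ltW (bD _))) // (ler_wpM2l (ltW K0)) // lerD.
have qa y : qfs false N y <= c0 -> K * (q ^+ (2 * Da) * qfs false N y) <= ee / 2.
  move=> hy; apply: (@le_trans _ _ (K * (ee / (2 * K * c0) * c0))).
    rewrite ler_wpM2l ?(ltW K0) //; apply: ler_pM => //.
      by rewrite exprn_ge0 // ltW.
    exact: qfs_ge0.
  by rewrite le_eqVlt; apply/orP; left; apply/eqP; field; rewrite !lt0r_neq0.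
have Q1e1 : qfs false Q1 e1 <= ee.
  have [h _] := hQ1 false e1; apply: le_trans h _; rewrite mulrDr.
  have h1 : K * (q ^+ (2 * Da) * qfs false N e1) <= ee / 2 by apply: qa; rewrite /c0; lra.
  have : K * qfs false M1 e1 <= K * e by rewrite ler_wpM2l // ltW.
  lra.
have Q1e2 : qfs false Q1 e2 <= ee.
  have [_ h] := hQ1 false e2; apply: le_trans h _; rewrite mulrDr.
  have h1 : K * (q ^+ (2 * Da) * qfs false N e2) <= ee / 2 by apply: qa; rewrite /c0; lra.
  have : K * qfs false M2 e2 <= K * e by rewrite ler_wpM2l // ltW.
  lra.
have [Q2 [fQ2 hQ2]] : exists Q, fam Q /\ forall s y,
    qfs s Q y <= K * (q ^+ (2 * Db) * qfs s N y + qfs s Q1 y) /\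
    qfs s Q y <= K * (q ^+ (2 * Db) * qfs s N y + qfs s M3 y).
  apply: (CC _ _ _ _ false e2 fN fQ1 fM3).
  apply: lt_le_trans low_e2; apply: le_lt_trans ee2.
  rewrite (ler_wpM2r (ltW (bD _))) // (ler_wpM2l (ltW K0)) // lerD //.
  exact: le_trans x3 ec.
have qb s y : qfs s N y <= c0 -> K * (q ^+ (2 * Db) * qfs s N y) <= 1 / 4.
  move=> hy; apply: (@le_trans _ _ (K * ((4 * K * c0)^-1 * c0))).
    rewrite ler_wpM2l ?(ltW K0) //; apply: ler_pM => //.
      by rewrite exprn_ge0 // ltW.
    exact: qfs_ge0.
  by rewrite le_eqVlt; apply/orP; left; apply/eqP; field; rewrite !lt0r_neq0.
have Q2e1 : qfs false Q2 e1 <= 1 / 2.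
  have [h _] := hQ2 false e1; apply: le_trans h _; rewrite mulrDr.
  have h1 : K * (q ^+ (2 * Db) * qfs false N e1) <= 1 / 4 by apply: qb; rewrite /c0; lra.
  have : K * qfs false Q1 e1 <= K * ee by rewrite ler_wpM2l // ltW.
  lra.
have Q2psi : qfs true Q2 psi^T <= 1 / 2.
  have [_ h] := hQ2 true psi^T; apply: le_trans h _; rewrite mulrDr.
  have h1 := qb _ _ up_psi.
  have : K * qfs true M3 psi^T <= K * ee.
    by rewrite ler_wpM2l ?(ltW K0) // (le_trans y3).
  lra.
have := qfs_dual psi e1 fQ2.
rewrite /psi mulmxDl -scalemxAl f11 f21 scaler0 addr0 mxE eqxx expr1n -/psi.
have := qfs_ge0 true psi^T fQ2; have := qfs_ge0 false e1 fQ2.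
move: Q2psi Q2e1; set A := qfs true _ _; set B := qfs false _ _ => hA hB B0 A0.
have : A * B <= 1 / 2 * (1 / 2) by apply: ler_pM.
lra.
Qed.


End Core.

(** * Compactness of sets of matrices *)

Local Open Scope classical_set_scope.
Local Open Scope ring_scope.

Section MatrixTopology.
Variable R : realType.

Lemma compact_entries_le m n (C : set 'M[R]_(m, n)) : compact C ->
  exists r, forall g, C g -> forall i j, `|g i j| <= r.
Proof.
move=> cC.
have h i j : exists r, forall g, C g -> `|g i j| <= r.
  have : compact [set (fun M : 'M[R]_(m, n) => M i j) g | g in C].
    apply: continuous_compact => //; apply: continuous_subspaceT => g.
    exact: coord_continuous.
  move/compact_bounded => [r [_ hr]]; exists (r + 1) => g Cg.
  by apply: (hr (r + 1)); [rewrite ltrDl | exists g].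
pose r i j := projT1 (cid (h i j)).
exists (\sum_i \sum_j `|r i j|) => g Cg i j.
apply: le_trans (projT2 (cid (h i j)) g Cg) _; apply: le_trans (ler_norm _) _.
rewrite (bigD1 i) //= (bigD1 j) //= -addrA lerDl addr_ge0 ?sumr_ge0 // => k _.
by apply: sumr_ge0.
Qed.

Lemma mx_continuous (T : topologicalType) m n (F : T -> 'M[R]_(m, n)) :
  (forall i j, continuous (fun t => F t i j)) -> continuous F.
Proof.
move=> hF t U [P hP PU].
have h i j : nbhs t [set w | P i j (F w i j)] by apply: hF; exact: hP.
have {}h i := @filter_forall _ _ _ (nbhs t) (nbhs_filter t) (h i).
have {}h := @filter_forall _ _ _ (nbhs t) (nbhs_filter t) h.
by apply: filterS h => w hw; apply: PU => i j; apply: hw.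
Qed.

Lemma vec_mx_continuous m n : continuous (@vec_mx R m n).
Proof.
apply: mx_continuous => i j.
have -> : (fun t : 'rV[R]_(m * n) => vec_mx t i j) = (fun t => t 0 (mxvec_index i j)).
  by apply/funext => t; rewrite mxE.
exact: coord_continuous.
Qed.

(** Transported along [vec_mx] from row vectors, where a product of segments is compact. *)
Lemma closed_entries_le_compact m n (r : R) (A : set 'M[R]_(m, n)) : closed A ->
  (forall g, A g -> forall i j, `|g i j| <= r) -> compact A.
Proof.
move=> cA bA.
have -> : A = vec_mx @` (vec_mx @^-1` A).
  apply/seteqP; split=> [g Ag|_ [v Av <-] //].
  by exists (mxvec g); rewrite /= mxvecK.
apply: continuous_compact.
  by apply: continuous_subspaceT => v; exact: vec_mx_continuous.
have cB := @rV_compact R (m * n) (fun=> `[- r, r]%classic) (fun=> @segment_compact R _ _).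
apply: (subclosed_compact _ cB).
  by apply: closed_comp => // v _; exact: vec_mx_continuous.
move=> v Av k; rewrite /= in_itv /= -ler_norml.
by case/mxvec_indexP: k => i j; have := bA _ Av i j; rewrite mxE.
Qed.

End MatrixTopology.

(** * Bounded frames over K *)

Section Bounds.
Variable R : realType.
Local Notation qf S x := (bf S x x).

Definition bd m n (r : R) (X : 'M[R]_(m, n)) := forall i j, `|X i j| <= r.

Lemma bd_mono m n r r' (X : 'M[R]_(m, n)) : r <= r' -> bd r X -> bd r' X.
Proof. by move=> rr h i j; apply: le_trans (h i j) rr. Qed.

Lemma bd_mul m n p a b (X : 'M[R]_(m, n)) (Y : 'M[R]_(n, p)) :
  bd a X -> bd b Y -> bd (n%:R * (a * b)) (X *m Y).
Proof.
move=> hX hY i j; rewrite mxE; apply: le_trans (ler_norm_sum _ _ _) _.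
rewrite -[X in X%:R * _]card_ord mulr_natl -sumr_const; apply: ler_sum => k _.
by rewrite normrM; apply: ler_pM.
Qed.

Lemma bd_add m n a b (X Y : 'M[R]_(m, n)) : bd a X -> bd b Y -> bd (a + b) (X + Y).
Proof.
by move=> hX hY i j; rewrite mxE; apply: le_trans (ler_normD _ _) _; apply: lerD.
Qed.

Lemma bd_opp m n a (X : 'M[R]_(m, n)) : bd a X -> bd a (- X).
Proof. by move=> h i j; rewrite mxE normrN. Qed.

Lemma bd_tr m n a (X : 'M[R]_(m, n)) : bd a X -> bd a X^T.
Proof. by move=> h i j; rewrite mxE. Qed.

Lemma bd_delta n (i : 'I_n) : bd 1 (delta_mx i 0 : 'cV[R]_n).
Proof. by move=> k l; rewrite mxE; case: andb; rewrite ?normr1 ?normr0 ?ler01. Qed.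

Lemma bd_sum (I : eqType) m n a (s : seq I) (X : I -> 'M[R]_(m, n)) :
  (forall i, i \in s -> bd a (X i)) -> bd ((size s)%:R * a) (\sum_(i <- s) X i).
Proof.
elim: s => [|i s IH] h; first by move=> k l; rewrite big_nil mxE normr0 mul0r.
rewrite big_cons /= -natr1 mulrDl mul1r addrC; apply: bd_add.
  by apply: h; rewrite mem_head.
by apply: IH => j js; apply: h; rewrite in_cons js orbT.
Qed.

Lemma ex_bd m n (X : 'M[R]_(m, n)) : exists r, bd r X.
Proof.
exists (\sum_i \sum_j `|X i j|) => i j.
rewrite (bigD1 i) //= (bigD1 j) //= -addrA lerDl addr_ge0 ?sumr_ge0 // => k _.
by apply: sumr_ge0.
Qed.

Lemma bd_sqnorm n a (x : 'cV[R]_n) : bd a x -> qf 1%:M x <= n%:R * a ^+ 2.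
Proof.
move=> h; rewrite bf1 -[X in X%:R * _]card_ord mulr_natl -sumr_const.
apply: ler_sum => i _; rewrite -expr2 -(real_normK (num_real (x i 0))).
by apply: lerXn2r; rewrite ?nnegrE //; apply: le_trans (h i 0).
Qed.

(** [1 + r] is used as a bound for the square root of [r]. *)
Lemma sqnorm_bd n r (x : 'cV[R]_n) : qf 1%:M x <= r -> bd (1 + r) x.
Proof.
move=> h i j; rewrite ord1.
have h1 : x i 0 ^+ 2 <= r.
  apply: le_trans h; rewrite bf1 (bigD1 i) //= -expr2 lerDl sumr_ge0 // => k _.
  by rewrite -expr2 sqr_ge0.
by rewrite ler_norml; apply/andP; split; nra.
Qed.

Lemma bd_sqnorm_mul m n a (X : 'M[R]_(m, n)) (x : 'cV[R]_n) : bd a X ->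
  qf 1%:M (X *m x) <= m%:R * n%:R * a ^+ 2 * qf 1%:M x.
Proof.
move=> h; rewrite [X in X <= _]bf1.
have -> : m%:R * n%:R * a ^+ 2 * qf 1%:M x = (n%:R * a ^+ 2 * qf 1%:M x) *+ m.
  by rewrite -mulr_natl; ring.
rewrite -[X in _ *+ X]card_ord -sumr_const.
apply: ler_sum => i _; rewrite -expr2.
have -> : (X *m x) i 0 = bf 1%:M (row i X)^T x.
  by rewrite bf1 mxE; apply: eq_bigr => k _; rewrite !mxE.
apply: le_trans (posdef_CS _ _ (@posdef1 R n)) _.
rewrite ler_wpM2r //; first by apply: posdef_ge0; exact: posdef1.
by apply: bd_sqnorm; apply: bd_tr => k l; rewrite mxE.
Qed.

Lemma kernel_vector N (s : seq 'rV[R]_N) : (size s < N)%N ->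
  exists y : 'cV[R]_N, y != 0 /\ forall r, r \in s -> r *m y = 0.
Proof.
move=> sN; pose M : 'M[R]_(N, size s) := \matrix_(i, j) s`_j 0 i.
have : kermx M != 0.
  rewrite -mxrank_eq0 mxrank_ker subn_eq0 -ltnNge.
  by apply: leq_ltn_trans sN; exact: rank_leq_col.
case/rowV0Pn => v /sub_kermxP vM v0; exists v^T; split.
  by rewrite -(inj_eq trmx_inj) trmxK trmx0.
move=> r rs; have := index_mem r s; rewrite rs => ri.
have /matrixP/(_ 0 (Ordinal ri)) := vM.
rewrite !mxE => e; apply/matrixP => i j; rewrite !ord1 !mxE -[RHS]e.
by apply: eq_bigr => k _; rewrite !mxE /= nth_index // mulrC.
Qed.

End Bounds.

(** * K-linear algebra through orthogonal real matrices *)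

Section KStructure.
Variables (R : realType) (N n p : nat) (js : seq 'M[R]_N) (co : 'I_N -> nat) (rp : nat -> 'I_N).
Local Notation qf S x := (bf S x x).
Local Notation As := (1%:M :: js).
Hypothesis J_skew : forall J, J \in js -> J^T = - J.
Hypothesis J_orth : forall J, J \in js -> J^T *m J = 1%:M.
Hypothesis J_mul : forall A B, A \in As -> B \in As ->
  exists C s, C \in As /\ A^T *m B = s *: C.
Hypothesis J_diag : forall J i j, J \in js -> co i != co j -> J i j = 0.
Hypothesis co_rp : forall k, (k < n)%N -> co (rp k) = k.
Hypothesis co_lt : forall i, (co i < n)%N.
Hypothesis gen : forall i, exists A s, A \in As /\
  (delta_mx i 0 : 'cV[R]_N) = s *: (A *m delta_mx (rp (co i)) 0).
Hypothesis N_eq : N = (size As * n)%N.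

(** Real coordinates are grouped by their K-coordinate [co], with representative [rp]. So [ev k] is
    a K-basis vector, and by [gen] the units carry it to the other real basis vectors of its group,
    up to scalars. *)
Let ev k : 'cV[R]_N := delta_mx (rp k) 0.

(** Summing over the units makes the rank-one map [u *m f] K-linear: it becomes [u] times the
    K-valued functional with real part [f]. *)
Definition transvection (u : 'cV[R]_N) (f : 'rV[R]_N) : 'M[R]_N :=
  1%:M + \sum_(A <- As) A *m (u *m f) *m A^T.

Lemma As_orth A : A \in As -> A^T *m A = 1%:M.
Proof. by rewrite in_cons => /orP[/eqP->|/J_orth //]; rewrite trmx1 mulmx1. Qed.

Lemma As_bd A : A \in As -> bd 1 A.
Proof.
move=> hA i j; have /matrixP/(_ j j) := As_orth hA.
rewrite !mxE eqxx (bigD1 i) //= !mxE => h.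
have h2 : 0 <= \sum_(k | k != i) A^T j k * A k j.
  by apply: sumr_ge0 => k _; rewrite mxE -expr2 sqr_ge0.
by rewrite ler_norml; apply/andP; split; nra.
Qed.

Lemma As_skew J (x : 'cV[R]_N) : J \in js -> x^T *m J *m x = 0.
Proof.
move=> hJ; apply/matrixP => i j; rewrite !ord1 !mxE.
have e : (x^T *m J *m x) 0 0 = - (x^T *m J *m x) 0 0.
  rewrite -{1}[x^T *m J *m x]trmxK [LHS]mxE !trmx_mul trmxK (J_skew hJ).
  by rewrite mulNmx mulmxN mulmxA mxE.
move: e; rewrite mxE => e; lra.
Qed.

Lemma As_skewC J (x y : 'cV[R]_N) : J \in js -> y^T *m J *m x = 0 -> x^T *m J *m y = 0.
Proof.
move=> hJ h; apply: trmx_inj; rewrite !trmx_mul trmxK (J_skew hJ) mulNmx mulmxN mulmxA h.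
by rewrite oppr0 trmx0.
Qed.

Lemma As_trP A : A \in As -> A^T \in As \/ (A \in js /\ A^T = - A).
Proof.
rewrite in_cons => /orP[/eqP->|hJ]; first by left; rewrite trmx1 mem_head.
by right; split=> //; exact: J_skew.
Qed.

Lemma trmx_ev k : (ev k)^T *m ev k = 1%:M.
Proof. by rewrite /ev trmx_delta mul_delta_mx; apply/matrixP => i j; rewrite !ord1 !mxE. Qed.

Lemma ev_J J k l : J \in js -> (k < n)%N -> (l < n)%N -> (ev k)^T *m J *m ev l = 0.
Proof.
move=> hJ kn ln; have [<-|kl] := eqVneq k l; first exact: As_skew.
apply/matrixP => i j; rewrite !ord1 -[LHS]/(bf J _ _) bf_delta mxE.
by apply: J_diag => //; rewrite !co_rp.
Qed.

Lemma ev_As A k l : A \in As -> (k < n)%N -> (l < n)%N -> k != l ->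
  (ev k)^T *m A *m ev l = 0.
Proof.
rewrite in_cons => /orP[/eqP->|hJ] kn ln kl; last exact: ev_J.
rewrite mulmx1 /ev trmx_delta mul_delta_mx_0 //.
by apply: contra kl => /eqP h; rewrite -(co_rp kn) -(co_rp ln) h.
Qed.

Definition supp k (x : 'cV[R]_N) := forall i, (k <= co i)%N -> x i 0 = 0.

Lemma suppD k x y : supp k x -> supp k y -> supp k (x + y).
Proof. by move=> hx hy i ki; rewrite mxE hx ?hy ?addr0. Qed.

Lemma suppZ k a x : supp k x -> supp k (a *: x).
Proof. by move=> hx i ki; rewrite mxE hx ?mulr0. Qed.

Lemma suppN k x : supp k x -> supp k (- x).
Proof. by rewrite -scaleN1r; exact: suppZ. Qed.

Lemma supp_ev k l : (l < n)%N -> (l < k)%N -> supp k (ev l).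
Proof.
move=> ln lk i ki; rewrite mxE; case: eqP => // e; move: ki.
by rewrite e co_rp // leqNgt lk.
Qed.

Lemma supp_As k A x : A \in As -> supp k x -> supp k (A *m x).
Proof.
rewrite in_cons => /orP[/eqP->|hJ]; first by rewrite mul1mx.
move=> hx i ki; rewrite mxE big1 // => j _; have [cij|cij] := eqVneq (co i) (co j).
  by rewrite (hx j) ?mulr0 // -cij.
by rewrite J_diag // mul0r.
Qed.

Lemma supp_orth k x l : (l < n)%N -> (k <= l)%N -> supp k x -> (ev l)^T *m x = 0.
Proof.
move=> ln kl hx; apply/matrixP => i j; rewrite !ord1 /ev trmx_delta -rowE !mxE.
by apply: hx; rewrite co_rp.
Qed.

Lemma supp_orthA k x l A : A \in As -> (l < n)%N -> (k <= l)%N -> supp k x ->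
  (ev l)^T *m A *m x = 0.
Proof. by move=> hA ln kl hx; rewrite -mulmxA (supp_orth ln kl) //; exact: supp_As. Qed.

Lemma supp_of_orth k x :
  (forall A l, A \in As -> (k <= l < n)%N -> (ev l)^T *m A^T *m x = 0) -> supp k x.
Proof.
move=> h i ki; have [A [s [hA e]]] := gen i.
have : (delta_mx i 0 : 'cV[R]_N)^T *m x = 0.
  by rewrite e linearZ /= trmx_mul -scalemxAl h ?scaler0 // ki co_lt.
by rewrite trmx_delta -rowE => /matrixP/(_ 0 0); rewrite !mxE.
Qed.

Lemma avg_mulr (u : 'cV[R]_N) (f : 'rV[R]_N) (x : 'cV[R]_N) :
  (forall J, J \in js -> f *m J *m x = 0) ->
  (\sum_(A <- As) A *m (u *m f) *m A^T) *m x = u *m (f *m x).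
Proof.
move=> h; rewrite mulmx_suml big_cons trmx1 mulmx1 mul1mx -mulmxA.
rewrite big_seq big1 ?addr0 // => J hJ.
by rewrite (J_skew hJ) mulmxN mulNmx -!mulmxA (mulmxA f) h // !mulmx0 oppr0.
Qed.

Lemma avg_mull (u : 'cV[R]_N) (f g : 'rV[R]_N) :
  (forall J, J \in js -> g *m J *m u = 0) ->
  g *m (\sum_(A <- As) A *m (u *m f) *m A^T) = (g *m u) *m f.
Proof.
move=> h; rewrite mulmx_sumr big_cons trmx1 mulmx1 mul1mx mulmxA.
rewrite big_seq big1 ?addr0 // => J hJ.
by rewrite !mulmxA h // !mul0mx.
Qed.

Definition korth (f : 'rV[R]_N) (u : 'cV[R]_N) := forall A, A \in As -> f *m A *m u = 0.

Lemma korthE f u : f *m u = 0 -> (forall J, J \in js -> f *m J *m u = 0) -> korth f u.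
Proof. by move=> h0 hJ A; rewrite in_cons => /orP[/eqP->|/hJ //]; rewrite mulmx1. Qed.

(** Every product of two terms contains the scalar [f *m (A^T *m B) *m u], and [A^T *m B] is a
    multiple of a unit. *)
Lemma avg_sq0 (u : 'cV[R]_N) (f : 'rV[R]_N) : korth f u ->
  (\sum_(A <- As) A *m (u *m f) *m A^T) *m (\sum_(A <- As) A *m (u *m f) *m A^T) = 0.
Proof.
move=> h; rewrite mulmx_suml big_seq big1 // => A hA.
rewrite mulmx_sumr big_seq big1 // => B hB.
have [C [s [hC e]]] := J_mul hA hB.
have -> : A *m (u *m f) *m A^T *m (B *m (u *m f) *m B^T)
  = A *m u *m (f *m (A^T *m B) *m u) *m f *m B^T by rewrite !mulmxA.
by rewrite e -scalemxAr -scalemxAl h // scaler0 mulmx0 !mul0mx.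
Qed.

Lemma transvection_inv (u : 'cV[R]_N) (f : 'rV[R]_N) : korth f u ->
  invmx (transvection u f) = transvection (- u) f.
Proof.
move=> h; set T := transvection u f; set T' := transvection (- u) f.
pose Y := \sum_(A <- As) A *m (u *m f) *m A^T.
have eT : T = 1%:M + Y by [].
have eT' : T' = 1%:M - Y.
  rewrite /T' /transvection /Y -sumrN; congr (_ + _); apply: eq_bigr => A _.
  by rewrite mulNmx mulmxN mulNmx.
have TT : T *m T' = 1%:M.
  rewrite eT eT' mulmxBr mulmx1 mulmxDl mul1mx /Y avg_sq0 // addr0.
  by rewrite -/Y addrK.
have [uT _] := mulmx1_unit TT.
by rewrite -[LHS]mulmx1 -TT mulKmx.
Qed.

Lemma transvection_mul (u : 'cV[R]_N) (f : 'rV[R]_N) (x : 'cV[R]_N) :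
  (forall J, J \in js -> f *m J *m x = 0) ->
  transvection u f *m x = x + u *m (f *m x).
Proof. by move=> h; rewrite mulmxDl mul1mx avg_mulr. Qed.

Lemma mul_transvection (u : 'cV[R]_N) (f g : 'rV[R]_N) :
  (forall J, J \in js -> g *m J *m u = 0) ->
  g *m transvection u f = g + (g *m u) *m f.
Proof. by move=> h; rewrite mulmxDr mulmx1 avg_mull. Qed.

Lemma transvection_bd a b (u : 'cV[R]_N) (f : 'rV[R]_N) : bd a u -> bd b f ->
  bd (1 + (size As)%:R * (N%:R * (1%:R * (N%:R * (1 * a) * b) * 1))) (transvection u f).
Proof.
move=> hu hf; apply: bd_add.
  by move=> i j; rewrite mxE; case: eqP; rewrite ?normr1 ?normr0 ?ler01.
apply: bd_sum => A hA; apply: bd_mul; last exact: bd_tr (As_bd hA).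
rewrite mulmxA; apply: bd_mul => //; exact: bd_mul (As_bd hA) hu.
Qed.

Lemma sqnorm_mx (x : 'cV[R]_N) : x^T *m x = (qf 1%:M x)%:M.
Proof. by rewrite [LHS]mx11_scalar /bf mulmx1. Qed.

(* This is where three K-dimensions are needed. *)
Lemma orth_unit_vector k (x : 'cV[R]_N) : (2 <= k < n)%N ->
  exists y : 'cV[R]_N, [/\ y^T *m y = 1%:M, supp k.+1 y,
    (forall A, A \in As -> y^T *m A *m ev k = 0) &
    (forall A, A \in As -> y^T *m A *m x = 0)].
Proof.
case/andP=> k2 kn.
pose vs := [:: ev k, x & [seq ev l | l <- iota k.+1 (n - k.+1)]].
pose s := [seq (A *m v)^T | A <- As, v <- vs].
(* Orthogonality to [n - k + 1] vectors over K is imposed, which is less than [n] because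
   [2 <= k]. *)
have sN : (size s < N)%N.
  rewrite size_allpairs; apply: (@leq_trans (size As * n)%N); last by rewrite -N_eq.
  by rewrite ltn_pmul2l //= size_map size_iota; clear -k2 kn; lia.
have [y0 [y0n hy0]] := kernel_vector sN.
have q0 : 0 < qf 1%:M y0 by apply: (proj2 (@posdef1 R N)).
have hv A v : A \in As -> v \in vs -> y0^T *m A *m v = 0.
  move=> hA hv; apply: trmx_inj; rewrite -mulmxA !trmx_mul trmxK trmx0 -trmx_mul.
  by apply: hy0; apply/allpairsP; exists (A, v).
pose c := (Num.sqrt (qf 1%:M y0))^-1; exists (c *: y0); split.
- rewrite sqnorm_mx bfZl bfZr mulrA -expr2 exprVn sqr_sqrtr ?mulVf ?lt0r_neq0 //.
  exact: ltW.
- apply: suppZ; apply: supp_of_orth => A l hA /andP[kl ln].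
  rewrite -trmx_mul; apply: trmx_inj; rewrite [LHS]trmx_mul trmxK trmx0 mulmxA.
  by apply: hv; rewrite // !inE map_f ?orbT // mem_iota; lia.
- by move=> A hA; rewrite linearZ /= -!scalemxAl hv ?scaler0 // mem_head.
- by move=> A hA; rewrite linearZ /= -!scalemxAl hv ?scaler0 // !inE eqxx orbT.
Qed.


Variables G H : set 'M[R]_N.
Hypothesis G_comm : forall g J, G g -> J \in js -> J *m g = g *m J.
Hypothesis G_unit : forall g, G g -> g \in unitmx.
Hypothesis G_mul : forall g h, G g -> G h -> G (g *m h).
Hypothesis G_inv : forall g, G g -> G (invmx g).
Hypothesis G_tv : forall u f, korth f u -> G (transvection u f).
Hypothesis G_bd_inv : forall r, exists r', forall g, G g -> bd r g -> bd r' (invmx g).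
Hypothesis H_G : forall h, H h -> G h.
Hypothesis H_fix : forall h, H h -> forall k, (p <= k < n)%N ->
  h *m ev k = ev k /\ (ev k)^T *m h = (ev k)^T.
Hypothesis fix_H : forall g, G g -> (forall k, (p <= k < n)%N ->
  g *m ev k = ev k /\ (ev k)^T *m g = (ev k)^T) -> H g.
Hypothesis p2 : (2 <= p)%N.

Lemma G_1 : G 1%:M.
Proof.
have := @G_tv 0 0 _; rewrite /transvection big1 ?addr0; first by apply=> A _; rewrite !mul0mx.
by move=> A _; rewrite !(mulmx0, mul0mx).
Qed.

Lemma fix_inv g (x : 'cV[R]_N) : G g -> g *m x = x -> invmx g *m x = x.
Proof. by move=> /G_unit ug e; rewrite -{1}e mulKmx. Qed.

Lemma fix_inv_row g (f : 'rV[R]_N) : G g -> f *m g = f -> f *m invmx g = f.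
Proof. by move=> /G_unit ug e; rewrite -{1}e mulmxK. Qed.

Lemma G_commA g A : G g -> A \in As -> A *m g = g *m A.
Proof.
by move=> Gg; rewrite in_cons => /orP[/eqP->|/(G_comm Gg) //]; rewrite mul1mx mulmx1.
Qed.

Lemma G_commAT g A : G g -> A \in As -> A^T *m g = g *m A^T.
Proof.
move=> Gg hA; case: (As_trP hA) => [|[_ ->]]; first exact: G_commA.
by rewrite mulNmx mulmxN (G_commA Gg hA).
Qed.

Lemma supp_row k (f : 'rV[R]_N) l A : A \in As -> supp k f^T -> (k <= l < n)%N ->
  f *m A *m ev l = 0.
Proof.
move=> hA hf /andP[kl ln]; apply: trmx_inj; rewrite trmx0 !trmx_mul mulmxA.
case: (As_trP hA) => [hA'|[hJ ->]]; first exact: supp_orthA hA' ln kl hf.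
by rewrite mulmxN mulNmx (supp_orthA hA ln kl hf) oppr0.
Qed.

Lemma js_As J : J \in js -> J \in As.
Proof. by move=> hJ; rewrite in_cons hJ orbT. Qed.

Lemma one_As : 1%:M \in As.
Proof. exact: mem_head. Qed.

Lemma transvection_fix k l (u : 'cV[R]_N) (f : 'rV[R]_N) : (k <= l < n)%N ->
  supp k u -> supp k f^T ->
  transvection u f *m ev l = ev l /\ (ev l)^T *m transvection u f = (ev l)^T.
Proof.
move=> kl su sf; case/andP: (kl) => kl' ln; split.
  rewrite transvection_mul => [|J hJ]; last by apply: supp_row sf kl; exact: js_As.
  by have := supp_row one_As sf kl; rewrite mulmx1 => ->; rewrite mulmx0 addr0.
rewrite mul_transvection => [|J hJ]; last exact: supp_orthA (js_As hJ) ln kl' su.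
by rewrite (supp_orth ln kl' su) mul0mx addr0.
Qed.

Definition tv_bound (a b : R) :=
  1 + (size As)%:R * (N%:R * (1%:R * (N%:R * (1 * a) * b) * 1)).

(* The pair [(ev k, (ev k)^T)] is carried to [(x, f)] by three transvections: [ev k] to [y] to [x]
   through an auxiliary [y], and a last one that fixes [x] and corrects the functional. *)
Lemma move_pair r : exists r', forall k (x : 'cV[R]_N) (f : 'rV[R]_N), (2 <= k < n)%N ->
  supp k.+1 x -> supp k.+1 f^T -> f *m x = 1%:M ->
  (forall J, J \in js -> f *m J *m x = 0) -> bd r x -> bd r f ->
  exists T, [/\ G T, bd r' T, T *m ev k = x, f *m T = (ev k)^T &
    forall l, (k < l < n)%N -> T *m ev l = ev l /\ (ev l)^T *m T = (ev l)^T].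
Proof.
pose c0 : R := N%:R * r ^+ 2.
pose B1 := tv_bound (2 + 1) (1 + 2); pose B2 := tv_bound (r + 2) (c0 * r + 2).
pose B0 := N%:R * (N%:R * (1 * B1) * B2) + r.
pose B3 := tv_bound r B0.
exists (N%:R * ((N%:R * (B3 * B2)) * B1)) => k x f kn sx sf fx fJx bx bf_.
have [y [yy sy ye yx]] := orth_unit_vector x kn.
have {}kn : (k < n)%N by case/andP: kn.
set e := ev k in ye *.
have ee : e^T *m e = 1%:M := trmx_ev k.
have se : supp k.+1 e by apply: supp_ev.
have eJe J : J \in js -> e^T *m J *m e = 0 by exact: As_skew.
have yJy J : J \in js -> y^T *m J *m y = 0 by exact: As_skew.
have xJx J : J \in js -> x^T *m J *m x = 0 by exact: As_skew.
have ye1 : y^T *m e = 0 by have := ye _ one_As; rewrite mulmx1.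
have yx1 : y^T *m x = 0 by have := yx _ one_As; rewrite mulmx1.
have ey1 : e^T *m y = 0 by apply: trmx_inj; rewrite trmx_mul trmxK ye1 trmx0.
have xy1 : x^T *m y = 0 by apply: trmx_inj; rewrite trmx_mul trmxK yx1 trmx0.
have yJe J (hJ : J \in js) : y^T *m J *m e = 0 := ye _ (js_As hJ).
have yJx J (hJ : J \in js) : y^T *m J *m x = 0 := yx _ (js_As hJ).
have eJy J (hJ : J \in js) : e^T *m J *m y = 0 := As_skewC hJ (yJe J hJ).
have xJy J (hJ : J \in js) : x^T *m J *m y = 0 := As_skewC hJ (yJx J hJ).
have q1 : 1 <= qf 1%:M f^T * qf 1%:M x.
  have := posdef_CS_dual f x (@posdef1 R N); rewrite invmx1 fx mxE eqxx expr1n.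
  by [].
have qf1 : qf 1%:M f^T <= c0 by apply: bd_sqnorm; exact: bd_tr.
have qx0 : 0 < qf 1%:M x.
  apply: (proj2 (@posdef1 R N)); apply/eqP => x0; move: fx; rewrite x0 mulmx0.
  by move/matrixP/(_ 0 0)/eqP; rewrite !mxE eq_sym oner_eq0.
(* This makes [g2] equal to 1 at both [x] and [y], so it kills [u2 = x - y]. It is bounded because
   [f *m x = 1] with [f] bounded keeps [x] from being short. *)
pose c := (qf 1%:M x)^-1.
have c_le : `|c| <= c0.
  rewrite ger0_norm ?invr_ge0 ?(ltW qx0) // /c -div1r ler_pdivrMr //.
  by apply: le_trans q1 _; rewrite ler_wpM2r // ltW.
have by_ : bd 2 y.
  have -> : (2 : R) = 1 + 1 by ring.
  apply: sqnorm_bd; have := congr1 (fun M : 'M[R]_(1,1) => M 0 0) yy.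
  by rewrite /bf mulmx1 !mxE => ->.
pose u1 := y - e; pose g1 := (e + y)^T.
pose u2 := x - y; pose g2 := (c *: x + y)^T.
have g1E : g1 = e^T + y^T by rewrite /g1 linearD.
have g2E : g2 = c *: x^T + y^T by rewrite /g2 linearD linearZ.
have k1 : korth g1 u1.
  apply: korthE => [|J hJ]; rewrite g1E /u1 !(mulmxDl, mulmxBr, mulmxDr, mulmxN).
    by rewrite yy ee ye1 ey1 sub0r subr0 addNr.
  by rewrite eJe // yJy // eJy // yJe // !addr0 subr0.
have xx : x^T *m x = (qf 1%:M x)%:M := sqnorm_mx x.
have k2 : korth g2 u2.
  apply: korthE => [|J hJ]; rewrite g2E /u2 !(mulmxDl, mulmxBr, mulmxDr, mulmxN) -!scalemxAl.
    rewrite xx yy xy1 yx1 scaler0 subr0 add0r scale_scalar_mx /c mulVf ?lt0r_neq0 //.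
    by rewrite subrr.
  by rewrite xJx // yJy // xJy // yJx // !scaler0 !addr0 subr0.
pose T1 := transvection u1 g1; pose T2 := transvection u2 g2.
have T1e : T1 *m e = y.
  rewrite transvection_mul => [|J hJ]; last first.
    by rewrite g1E !mulmxDl eJe // yJe // addr0.
  by rewrite g1E (mulmxDl e^T) ee ye1 addr0 mulmx1 /u1 addrC subrK.
have T2y : T2 *m y = x.
  rewrite transvection_mul => [|J hJ]; last first.
    by rewrite g2E !mulmxDl -!scalemxAl xJy // yJy // scaler0 addr0.
  rewrite g2E (mulmxDl (c *: x^T)) -scalemxAl xy1 yy scaler0 add0r mulmx1.
  by rewrite /u2 addrC subrK.
have G1 : G T1 := G_tv k1. have G2 : G T2 := G_tv k2.
have i1 : invmx T1 *m y = e by rewrite -T1e mulKmx // G_unit.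
have i2 : invmx T2 *m x = y by rewrite -T2y mulKmx // G_unit.
(* The covector into which [T2 *m T1] carries [e^T]. It agrees with [f] on the K-line of [x], so the
   transvection along [x] by [eps - f] fixes [x] and satisfies [f *m T3 = eps]. *)
pose eps := e^T *m invmx T1 *m invmx T2.
have epsA A (z : 'cV[R]_N) : A \in As -> eps *m A *m z = e^T *m A *m (invmx T1 *m (invmx T2 *m z)).
  move=> hA; rewrite /eps -!mulmxA; congr (_ *m _).
  rewrite (mulmxA (invmx T2)) -(G_commA (G_inv G2) hA) -!mulmxA.
  by rewrite (mulmxA (invmx T1) A) -(G_commA (G_inv G1) hA) -!mulmxA.
have su1 : supp k.+1 u1 by apply: suppD => //; exact: suppN.
have su2 : supp k.+1 u2 by apply: suppD => //; exact: suppN.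
have sg1 : supp k.+1 g1^T by rewrite trmxK; exact: suppD.
have sg2 : supp k.+1 g2^T by rewrite trmxK; apply: suppD => //; exact: suppZ.
have seps : supp k.+1 eps^T.
  apply: supp_of_orth => A l hA kl; rewrite -!trmx_mul mulmxA epsA //.
  have [f1 _] := transvection_fix kl su1 sg1; have [f2 _] := transvection_fix kl su2 sg2.
  rewrite (fix_inv G2 f2) (fix_inv G1 f1) ev_As ?trmx0 //; clear -kl kn; lia.
pose g3 := eps - f; pose T3 := transvection x g3.
have epsx : eps *m x = 1%:M.
  by have := epsA _ x one_As; rewrite !mulmx1 i2 i1 ee.
have g3J J : J \in js -> g3 *m J *m x = 0.
  by move=> hJ; rewrite /g3 !mulmxBl fJx // epsA ?js_As // i2 i1 eJe // subr0.
have g3x : g3 *m x = 0 by rewrite mulmxBl epsx fx subrr.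
have k3 : korth g3 x by apply: korthE.
have G3 : G T3 := G_tv k3.
have T3x : T3 *m x = x by rewrite transvection_mul // g3x mulmx0 addr0.
have fT3 : f *m T3 = eps by rewrite mul_transvection // fx mul1mx /g3 addrC subrK.
exists (T3 *m T2 *m T1); split.
- by apply: G_mul => //; exact: G_mul.
- have b1 : bd B1 T1.
    by apply: transvection_bd; [apply: bd_add => //; apply: bd_opp; exact: bd_delta
       | apply: bd_tr; apply: bd_add => //; exact: bd_delta].
  have bu2 : bd (r + 2) u2 by apply: bd_add => //; exact: bd_opp.
  have bg2 : bd (c0 * r + 2) g2.
    apply: bd_tr; apply: bd_add => // i j; rewrite mxE normrM; exact: ler_pM.
  have b2 : bd B2 T2 by exact: transvection_bd.
  have b1' : bd B1 (invmx T1).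
    rewrite transvection_inv //.
    by apply: transvection_bd; [apply: bd_opp; apply: bd_add => //; apply: bd_opp; exact: bd_delta
       | apply: bd_tr; apply: bd_add => //; exact: bd_delta].
  have b2' : bd B2 (invmx T2).
    by rewrite transvection_inv //; apply: transvection_bd => //; exact: bd_opp.
  have bg3 : bd B0 g3.
    apply: bd_add; last exact: bd_opp.
    by apply: bd_mul => //; apply: bd_mul => //; apply: bd_tr; exact: bd_delta.
  have b3 : bd B3 T3 by exact: transvection_bd.
  by apply: bd_mul => //; exact: bd_mul.
- by rewrite -!mulmxA T1e T2y T3x.
- by rewrite !mulmxA fT3 /eps mulmxKV ?G_unit // mulmxKV ?G_unit.
- move=> l kl; have [a1 b1] := transvection_fix kl su1 sg1.
  have [a2 b2] := transvection_fix kl su2 sg2.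
  have sg3 : supp k.+1 g3^T.
    by rewrite /g3 linearB /=; apply: suppD => //; exact: suppN.
  have [a3 b3] := transvection_fix kl sx sg3.
  by split; [rewrite -!mulmxA a1 a2 a3 | rewrite !mulmxA b3 b2 b1].
Qed.

(* Each stage pins down one more frame vector, so [G -> G/H] has bounded preimages of bounded frames. *)
Lemma bounded_section r : exists r', forall g, G g ->
  (forall k, (p <= k < n)%N -> bd r (g *m ev k) /\ bd r ((ev k)^T *m invmx g)) ->
  exists c h, [/\ G c, bd r' c, H h & g = c *m h].
Proof.
suff stage m : exists r', forall g, G g ->
  (forall k, (p <= k < n)%N -> bd r (g *m ev k) /\ bd r ((ev k)^T *m invmx g)) ->
  exists c, [/\ G c, bd r' c & forall k, (maxn p (n - m) <= k < n)%N ->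
     c *m ev k = g *m ev k /\ (ev k)^T *m invmx c = (ev k)^T *m invmx g].
  have [r' hr'] := stage n; exists r' => g Gg hg; have [c [Gc bc hc]] := hr' g Gg hg.
  exists c, (invmx c *m g); split=> //; last by rewrite mulKVmx // G_unit.
  apply: fix_H; first by apply: G_mul => //; exact: G_inv.
  move=> k kn; have [|h1 h2] := hc k; first by rewrite subnn maxn0.
  split; first by rewrite -mulmxA -h1 mulKmx // G_unit.
  by rewrite mulmxA h2 mulmxKV // G_unit.
elim: m => [|m [r1 hr1]].
  exists 1 => g Gg hg; exists 1%:M; split; first exact: G_1.
    by move=> i j; rewrite mxE; case: eqP; rewrite ?normr1 ?normr0 ?ler01.
  by move=> k; rewrite subn0 => kn; exfalso; clear -kn; lia.
have [r2 hr2] := G_bd_inv r1.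
have [r3 hr3] := move_pair (N%:R * (r2 * r) + N%:R * (r * r1)).
exists (Num.max r1 (N%:R * (r1 * r3))) => g Gg hg.
have [c [Gc bc hc]] := hr1 g Gg hg.
have uc := G_unit Gc; have ug := G_unit Gg.
pose j := (n - m.+1)%N.
(* If [j < p], or if the truncated [n - m] is already 0, the set of pinned vectors does not grow and
   [c] is kept. *)
have [jp|jp] := boolP ((p <= j) && (m < n))%N; last first.
  exists c; split=> //; first by apply: bd_mono bc; rewrite le_max lexx.
  by move=> k kn; apply: hc; move: jp kn; rewrite /j; clear; lia.
case/andP: jp => pj mn.
have jn : (j < n)%N by rewrite /j; clear -mn; lia.
have [g' eg'] : exists g', g' = invmx c *m g by eexists.
have Gg' : G g' by rewrite eg'; apply: G_mul => //; exact: G_inv.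
have ug' := G_unit Gg'.
have ig' : invmx g' = invmx g *m c.
  apply: (can_inj (mulKmx ug')); rewrite mulmxV // eg' -mulmxA mulKVmx // mulVmx //.
(* The remainder [g'] fixes the frame beyond [j], so its own vector and covector of index [j] lie in
   the K-span of the first [j + 1] coordinates and [move_pair] applies. *)
have fix_ k : (j < k < n)%N -> g' *m ev k = ev k /\ (ev k)^T *m invmx g' = (ev k)^T.
  move=> jk; have [|h1 h2] := hc k; first by move: jk; rewrite /j; clear -pj mn; lia.
  by split; [rewrite eg' -mulmxA -h1 mulKmx | rewrite ig' mulmxA -h2 mulmxKV].
pose x := g' *m ev j; pose f := (ev j)^T *m invmx g'.
have fA A : A \in As -> f *m A *m x = (ev j)^T *m A *m ev j.
  by move=> hA; rewrite /f /x -!mulmxA (mulmxA A) (G_commA Gg' hA) -!mulmxA mulKmx.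
have [|h1 h2] := hg j; first by rewrite pj jn.
have [|||||||T [GT bT Te fT Tfix]] := hr3 j x f.
- by clear -p2 pj jn; lia.
- apply: supp_of_orth => A l hA kl; case/andP: (kl) => _ ln.
  have [_ hl] := fix_ l kl; case: (As_trP hA) => [hA'|[hJ ->]].
    rewrite /x mulmxA -(mulmxA _ A^T) (G_commA Gg' hA') mulmxA.
    by rewrite -{1}hl mulmxKV // ev_As //; clear -kl; lia.
  rewrite mulmxN mulNmx /x mulmxA -(mulmxA _ A) (G_commA Gg' hA) mulmxA.
  by rewrite -{1}hl mulmxKV // ev_As ?oppr0 //; clear -kl; lia.
- apply: supp_of_orth => A l hA kl; case/andP: (kl) => _ ln.
  have [hl _] := fix_ l kl; rewrite -!trmx_mul mulmxA /f.
  rewrite -(mulmxA (ev j)^T) -(G_commA (G_inv Gg') hA) mulmxA -(mulmxA _ (invmx g')).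
  by rewrite (fix_inv Gg' hl) ev_As ?trmx0 //; clear -kl; lia.
- by have := fA _ one_As; rewrite !mulmx1 trmx_ev.
- by move=> J hJ; rewrite fA ?js_As // ev_J.
- have bx : bd (N%:R * (r2 * r)) x.
    by rewrite /x eg' -mulmxA; apply: bd_mul => //; exact: hr2.
  apply: bd_mono bx; rewrite lerDl.
  by apply: le_trans (normr_ge0 (((ev j)^T *m invmx g *m c) 0 (rp 0))) _; apply: bd_mul.
- have bf_ : bd (N%:R * (r * r1)) f by rewrite /f ig' mulmxA; apply: bd_mul.
  apply: bd_mono bf_; rewrite lerDr.
  apply: le_trans (normr_ge0 ((invmx c *m (g *m ev j)) (rp 0) 0)) _.
  by apply: bd_mul => //; exact: hr2.
have uT := G_unit GT.
exists (c *m T); split; first exact: G_mul.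
  by apply: bd_mono (bd_mul bc bT); rewrite le_max lexx orbT.
have icT : invmx (c *m T) = invmx T *m invmx c.
  have ucT : c *m T \in unitmx by rewrite unitmx_mul uc uT.
  by apply: (can_inj (mulKmx ucT)); rewrite mulmxV // -mulmxA mulKVmx // mulmxV.
move=> k kn; have [kj|kj] := eqVneq k j.
  rewrite kj; split; first by rewrite -mulmxA Te /x eg' -mulmxA mulKVmx.
  by rewrite icT mulmxA -{1}fT mulmxK // /f ig' mulmxA mulmxK.
have jk : (j < k < n)%N by move: kn kj; rewrite /j; clear; lia.
have [t1 t2] := Tfix k jk; have [|c1 c2] := hc k.
  by move: jk; rewrite /j; clear -pj mn; lia.
split; first by rewrite -mulmxA t1.
by rewrite icT mulmxA (fix_inv_row GT t2).
Qed.

(** * The family of forms attached to a compact quotient *)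

Hypothesis pn : (p < n)%N.
Hypothesis G_cpt : forall r, compact [set g | G g /\ bd r g].

Lemma bd_mul_ev r m (g : 'M[R]_(m, N)) k : bd r g -> bd r (g *m ev k).
Proof. by move=> h i j; rewrite /ev -colE mxE. Qed.

Lemma bd_ev_mul r m (g : 'M[R]_(N, m)) k : bd r g -> bd r ((ev k)^T *m g).
Proof. by move=> h i j; rewrite /ev trmx_delta -rowE mxE. Qed.

(** The dual form is the least square norm of a covector [h] with [h *m M = f]; the inequality is
    Cauchy-Schwarz for [h] against [M *m w], where [w = invmx S *m f^T]. *)
Lemma dual_form_le m d (M : 'M[R]_(m, d)) (f : 'rV[R]_d) (h : 'rV[R]_m) :
  posdef (M^T *m M) -> f = h *m M -> qf (invmx (M^T *m M)) f^T <= qf 1%:M h^T.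
Proof.
move=> pS fE; set S := M^T *m M; have uS := posdef_unit pS.
have [sS _] := pS.
have [w wE] : exists w, w = invmx S *m f^T by eexists.
have Sw : S *m w = f^T by rewrite wE mulKVmx.
set t := qf (invmx S) f^T.
have tE : f *m w = t%:M by rewrite [LHS]mx11_scalar /t /bf trmxK wE mulmxA.
have wS : w^T *m S = f by rewrite -[f]trmxK -Sw trmx_mul sS.
have qw : qf 1%:M (M *m w) = t.
  rewrite /bf mulmx1 trmx_mul -mulmxA (mulmxA M^T) -/S mulmxA wS tE mxE eqxx //.
have t0 : 0 <= t by rewrite -qw; apply: posdef_ge0; exact: posdef1.
have := posdef_CS h^T (M *m w) (@posdef1 R m).
have -> : bf 1%:M h^T (M *m w) = t.
  by rewrite /bf trmxK mulmx1 mulmxA -fE tE mxE eqxx.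
rewrite qw; have h0 : 0 <= qf 1%:M h^T by apply: posdef_ge0; exact: posdef1.
have [->|tn0] := eqVneq t 0; first by [].
by rewrite expr2 ler_pM2r // lt_def tn0.
Qed.

(** [E] below is the inclusion of the K-span W of the first [p + 1] coordinates, [E^T] the
    orthogonal projection onto it, and [d] the real dimension of W. *)
Let P : pred 'I_N := [pred i | (co i <= p)%N].
Let d := #|P|.
Let E : 'M[R]_(N, d) := \matrix_(i, j) (i == enum_val j)%:R.

Lemma trE_E : E^T *m E = 1%:M.
Proof.
apply/matrixP => a b; rewrite !mxE (bigD1 (enum_val a)) //= !mxE eqxx mul1r.
rewrite (inj_eq enum_val_inj) big1 ?addr0 // => i ia.
by rewrite !mxE (negbTE ia) mul0r.
Qed.

Lemma E_trE x : supp p.+1 x -> E *m (E^T *m x) = x.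
Proof.
move=> sx; have [w ->] : exists w, x = E *m w.
  exists (\col_j x (enum_val j) 0); apply/matrixP => i j; rewrite ord1 !mxE {j}.
  have [Pi|Pi] := boolP (i \in P).
    rewrite (bigD1 (enum_rank_in Pi i)) //= !mxE enum_rankK_in // eqxx mul1r.
    rewrite big1 ?addr0 // => j ji; rewrite !mxE; case: eqP => [e|]; last by rewrite mul0r.
    have je : j = enum_rank_in Pi i.
      by apply: enum_val_inj; rewrite enum_rankK_in.
    by move: ji; rewrite -je eqxx.
  rewrite sx; last by move: Pi; rewrite inE -ltnNge.
  rewrite big1 // => j _; rewrite !mxE; case: eqP => [e|]; last by rewrite mul0r.
  by move: Pi; rewrite e enum_valP.
by rewrite (mulmxA E^T) trE_E mul1mx.
Qed.

Lemma supp_E w : supp p.+1 (E *m w).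
Proof.
move=> i pi; rewrite mxE big1 // => j _; rewrite !mxE; case: eqP => [e|]; last by rewrite mul0r.
have : (co i <= p)%N by rewrite e; exact: (enum_valP j).
by rewrite leqNgt pi.
Qed.

(** Frame indices start above [p]: the vector [ev p] lies in W, and its place is taken by the pairs
    [(x, f)]. *)
Definition fam (Gam : set 'M[R]_N) r (S : 'M[R]_d) := exists g, [/\ Gam g,
  forall k, (p < k < n)%N -> bd r (g *m ev k) /\ bd r ((ev k)^T *m invmx g) &
  S = (g *m E)^T *m (g *m E)].

Definition good (x : 'cV[R]_d) (f : 'rV[R]_d) :=
  forall J, J \in js -> f *m (E^T *m J *m E) *m x = 0.

Lemma fam_posdef g : G g -> posdef ((g *m E)^T *m (g *m E)).
Proof.
move=> Gg; rewrite -[(g *m E)^T]mulmx1; apply: posdef_conj; last exact: posdef1.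
move=> x h; have ug := G_unit Gg.
by rewrite -[x]mul1mx -trE_E -(mulKmx ug E) -!mulmxA (mulmxA g) h !mulmx0.
Qed.

Lemma fam_qf (g : 'M[R]_N) x : qf ((g *m E)^T *m (g *m E)) x = qf 1%:M (g *m (E *m x)).
Proof. by rewrite /bf !trmx_mul !mulmx1 !mulmxA. Qed.

(** Since [g] commutes with [J], the expression is the inner product of [y] and [J y] for
    [y = g E x], after pulling [J] through [g]; it vanishes as [J] is skew. *)
Lemma good_form g x : G g -> good x (x^T *m ((g *m E)^T *m (g *m E))).
Proof.
move=> Gg J hJ.
have -> : x^T *m ((g *m E)^T *m (g *m E)) *m (E^T *m J *m E) *m x
   = (g *m (E *m x))^T *m g *m (E *m (E^T *m (J *m (E *m x)))).
  by rewrite !trmx_mul !mulmxA.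
rewrite E_trE; last by apply: supp_As; [exact: js_As | exact: supp_E].
have [y yE] : exists y, y = E *m x by eexists.
rewrite -yE mulmxA -[_ *m g *m J]mulmxA -(G_comm Gg hJ) mulmxA -mulmxA.
exact: As_skew.
Qed.

Lemma move_to_good x f : good x f -> f *m x = 1%:M -> exists T, [/\ G T,
  T *m ev p = E *m x, f *m E^T *m T = (ev p)^T &
  forall l, (p < l < n)%N -> T *m ev l = ev l /\ (ev l)^T *m T = (ev l)^T].
Proof.
move=> gxf fx; have [r1 h1] := ex_bd (E *m x); have [r2 h2] := ex_bd (f *m E^T).
have [r' hr'] := move_pair (Num.max r1 r2).
have [|||||||T [GT _ t1 t2 t3]] := hr' p (E *m x) (f *m E^T).
- by rewrite p2 pn.
- exact: supp_E.
- by rewrite trmx_mul trmxK; exact: supp_E.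
- by rewrite mulmxA -(mulmxA f) trE_E mulmx1.
- by move=> J hJ; rewrite -[RHS](gxf J hJ) !mulmxA.
- by apply: bd_mono h1; rewrite le_max lexx.
- by apply: bd_mono h2; rewrite le_max lexx orbT.
by exists T.
Qed.

(** Cocompactness writes the [T] of [move_to_good] as [g *m c *m h]. As [h] fixes the frame from [p]
    on, [invmx g *m T] acts there like the bounded [c]. For [k > p] this puts the form of [invmx g]
    in the family; for [k = p] it bounds that form at [(x, f)]. *)
Lemma fam_near Gam C r : (forall g, Gam g -> G g) -> (forall g, Gam g -> Gam (invmx g)) ->
  (forall c, C c -> [/\ G c, bd r c & bd r (invmx c)]) ->
  (forall g, G g -> exists g' c h, [/\ Gam g', C c, H h & g = g' *m c *m h]) ->
  forall x f, good x f -> f *m x = 1%:M -> exists S,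
    [/\ fam Gam r S, qf S x <= N%:R * r ^+ 2 & qf (invmx S) f^T <= N%:R * r ^+ 2].
Proof.
move=> GamG Gami hC cov x f gxf fx; have [T [GT Tp fT Tl]] := move_to_good gxf fx.
have [g [c [h [Gg Cc Hh TE]]]] := cov T GT; have [Gc bc bc'] := hC c Cc.
have ug := G_unit (GamG g Gg); have uc := G_unit Gc; have uh := G_unit (H_G Hh).
have uT := G_unit GT.
have gT : invmx g *m T = c *m h by rewrite TE -mulmxA mulKmx.
have Tg : invmx T *m g = invmx h *m invmx c.
  apply: (can_inj (mulKmx uT)); rewrite mulKVmx // TE -!mulmxA (mulmxA h) mulmxV // mul1mx.
  by rewrite mulmxV // mulmx1.
have col_ k : (p <= k < n)%N -> invmx g *m (T *m ev k) = c *m ev k.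
  by move=> kn; have [h1 _] := H_fix Hh kn; rewrite mulmxA gT -mulmxA h1.
have row_ k : (p <= k < n)%N -> (ev k)^T *m invmx T *m g = (ev k)^T *m invmx c.
  move=> kn; have [_ h1] := H_fix Hh kn.
  by rewrite -mulmxA Tg mulmxA (fix_inv_row (H_G Hh) h1).
have pp : (p <= p < n)%N by rewrite leqnn pn.
exists ((invmx g *m E)^T *m (invmx g *m E)); split.
- exists (invmx g); split=> [|k kn|//]; first exact: Gami.
  have pk : (p <= k < n)%N by clear -kn; lia.
  have [t1 t2] := Tl k kn; have cE := col_ k pk; have rE := row_ k pk.
  rewrite t1 in cE; rewrite (fix_inv_row GT t2) in rE.
  by rewrite invmxK cE rE; split; [exact: bd_mul_ev | exact: bd_ev_mul].
- by rewrite fam_qf -Tp col_ //; apply: bd_sqnorm; exact: bd_mul_ev.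
apply: le_trans (dual_form_le (h := f *m E^T *m g) _ _) _.
- by apply: fam_posdef; apply: G_inv; exact: GamG.
- by rewrite -mulmxA mulKVmx // -mulmxA trE_E mulmx1.
apply: bd_sqnorm; apply: bd_tr.
have -> : f *m E^T *m g = (ev p)^T *m invmx c by rewrite -row_ // -fT mulmxK.
exact: bd_ev_mul.
Qed.

(* The last frame vectors control the projection that [g] transports from the complement of the first
   [p + 1] coordinates, hence also its complement. *)
Lemma frame_projection_bd r : exists b, forall g, G g ->
  (forall k, (p < k < n)%N -> bd r (g *m ev k) /\ bd r ((ev k)^T *m invmx g)) ->
  bd b (g *m E *m (E^T *m invmx g)).
Proof.
pose b1 := 1%:R * ((N%:R * (1 * r)) * (N%:R * (r * 1))) : R.
exists (1 + (size (index_enum 'I_N))%:R * `|b1|) => g Gg hg.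
have ug := G_unit Gg.
(* The complementary projection is expanded over real coordinates: those with [co i <= p] contribute
   0, the others a frame vector times a frame covector, up to units. *)
have -> : g *m E *m (E^T *m invmx g) =
    1%:M - \sum_i g *m ((1%:M - E *m E^T) *m delta_mx i i) *m invmx g.
  rewrite -mulmx_suml -mulmx_sumr -mulmx_sumr -mx1_sum_delta mulmx1 mulmxBr mulmxBl.
  by rewrite mulmx1 mulmxV // opprB addrC subrK !mulmxA.
apply: bd_add; first by move=> i j; rewrite mxE; case: eqP; rewrite ?normr1 ?normr0 ?ler01.
apply: bd_opp; apply: bd_sum => i _.
have -> : delta_mx i i = (delta_mx i 0 : 'cV[R]_N) *m (delta_mx i 0 : 'cV[R]_N)^T.
  by rewrite trmx_delta mul_delta_mx.
have [ip|pi] := leqP (co i) p.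
  have -> : (1%:M - E *m E^T) *m ((delta_mx i 0 : 'cV[R]_N) *m (delta_mx i 0)^T) = 0.
    rewrite mulmxA mulmxBl mul1mx -mulmxA E_trE ?subrr ?mul0mx // => j pj.
    by rewrite mxE; case: eqP => // e; move: pj; rewrite e leqNgt ltnS ip.
  by rewrite mulmx0 mul0mx => k l; rewrite mxE normr0.
have Ei : E^T *m (delta_mx i 0 : 'cV[R]_N) = 0.
  apply/matrixP => a b; rewrite -colE !mxE; case: eqP => // e.
  have : (co i <= p)%N by rewrite e; exact: (enum_valP a).
  by rewrite leqNgt pi.
have -> : (1%:M - E *m E^T) *m ((delta_mx i 0 : 'cV[R]_N) *m (delta_mx i 0)^T)
   = (delta_mx i 0 : 'cV[R]_N) *m (delta_mx i 0)^T.
  by rewrite mulmxA mulmxBl mul1mx -mulmxA Ei mulmx0 subr0.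
have [A [s [hA e]]] := gen i; have cn := co_lt i.
have s1 : s ^+ 2 = 1.
  have : (delta_mx i 0 : 'cV[R]_N)^T *m (delta_mx i 0 : 'cV[R]_N) = 1%:M.
    by rewrite trmx_delta mul_delta_mx; apply/matrixP => a b; rewrite !ord1 !mxE.
  rewrite e [(s *: _)^T]linearZ /= trmx_mul -!(scalemxAl, scalemxAr) scalerA -mulmxA (mulmxA A^T).
  rewrite As_orth // mul1mx trmx_ev => /matrixP/(_ 0 0); rewrite !mxE /= mulr1n mulr1.
  by rewrite expr2.
have [|h1 h2] := hg (co i); first by rewrite pi cn.
have -> : g *m ((delta_mx i 0 : 'cV[R]_N) *m (delta_mx i 0)^T) *m invmx g =
   (A *m (g *m ev (co i))) *m (((ev (co i))^T *m invmx g) *m A^T).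
  rewrite e [(s *: _)^T]linearZ /= trmx_mul -!(scalemxAl, scalemxAr) scalerA -expr2 s1.
  rewrite scale1r.
  rewrite !mulmxA -(G_commA Gg hA) -!mulmxA; do 4!congr (_ *m _).
  exact: G_commAT (G_inv Gg) hA.
apply: bd_mono (ler_norm _) _; apply: bd_mul; apply: bd_mul => //; first exact: As_bd.
by apply: bd_tr; exact: As_bd.
Qed.

(** At index [p] the vector is bounded by the form at [x]. The dual form sees only the shortest
    extension of [f], not the covector [h = f *m E^T *m invmx g] itself; but the square norm of [h]
    is [f] at [w = E^T g^-1 h^T], and the form at [w] is the square norm of [g E E^T g^-1 h^T],
    controlled by [frame_projection_bd]. *)
Lemma frame_bd r0 r : exists r', forall g x f T, G g ->
  (forall k, (p < k < n)%N -> bd r0 (g *m ev k) /\ bd r0 ((ev k)^T *m invmx g)) ->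
  G T -> T *m ev p = E *m x -> f *m E^T *m T = (ev p)^T ->
  (forall l, (p < l < n)%N -> T *m ev l = ev l /\ (ev l)^T *m T = (ev l)^T) ->
  qf ((g *m E)^T *m (g *m E)) x <= r -> qf (invmx ((g *m E)^T *m (g *m E))) f^T <= r ->
  forall k, (p <= k < n)%N -> bd r' (g *m T *m ev k) /\ bd r' ((ev k)^T *m invmx (g *m T)).
Proof.
have [b hb] := frame_projection_bd r0.
exists (Num.max r0 (Num.max (1 + r) (1 + r * (N%:R * N%:R * b ^+ 2)))).
move=> g x f T Gg hg GT Tp fT Tl qx qf_ k kn.
have ug := G_unit Gg; have uT := G_unit GT.
have igT : invmx (g *m T) = invmx T *m invmx g.
  have ugT : g *m T \in unitmx by rewrite unitmx_mul ug uT.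
  by apply: (can_inj (mulKmx ugT)); rewrite mulmxV // -mulmxA mulKVmx // mulmxV.
have [kp|kp] := eqVneq k p; last first.
  have pk : (p < k < n)%N by clear -kn kp; lia.
  have [t1 t2] := Tl k pk; have [h1 h2] := hg k pk.
  rewrite igT -mulmxA t1 mulmxA (fix_inv_row GT t2).
  by split; [apply: bd_mono h1 | apply: bd_mono h2]; rewrite le_max lexx.
rewrite kp igT mulmxA -fT mulmxK // -mulmxA Tp; split.
  apply: (@bd_mono _ _ _ (1 + r)); first by rewrite !le_max lexx orbT.
  by apply: sqnorm_bd; rewrite -fam_qf.
have pS := fam_posdef Gg; set S := (g *m E)^T *m (g *m E) in qx qf_ pS.
have [h hE] : exists h, h = f *m E^T *m invmx g by eexists.
rewrite -hE.
have [q0|q0] := boolP (qf 1%:M h^T == 0).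
  have bh : bd (1 + 0) h^T by apply: sqnorm_bd; rewrite (eqP q0).
  rewrite -[h]trmxK; apply: bd_tr; apply: bd_mono bh; rewrite addr0 !le_max.
  by rewrite lerDl (le_trans (posdef_ge0 _ pS) qx) orbT.
have qh : 0 < qf 1%:M h^T.
  by rewrite lt_def q0 posdef_ge0 //; exact: posdef1.
have hw : qf 1%:M h^T = (f *m (E^T *m invmx g *m h^T)) 0 0.
  by rewrite /bf trmxK mulmx1 {1}hE !mulmxA.
have Sw : qf S (E^T *m invmx g *m h^T) <= N%:R * N%:R * b ^+ 2 * qf 1%:M h^T.
  rewrite /S fam_qf.
  have -> : g *m (E *m (E^T *m invmx g *m h^T)) = (g *m E *m (E^T *m invmx g)) *m h^T.
    by rewrite !mulmxA.
  by apply: bd_sqnorm_mul; exact: hb.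
have := posdef_CS_dual f (E^T *m invmx g *m h^T) pS; rewrite -hw expr2 => cs.
have le_q : qf 1%:M h^T <= r * (N%:R * N%:R * b ^+ 2).
  rewrite -(ler_pM2r qh); apply: le_trans cs _; rewrite -[r * _ * _]mulrA; apply: ler_pM => //.
    by apply: posdef_ge0; exact: posdef_inv.
  exact: posdef_ge0.
rewrite -[h]trmxK; apply: bd_tr; apply: bd_mono (sqnorm_bd le_q).
by rewrite !le_max lexx !orbT.
Qed.

(** At a common bounded pair, [bounded_section] gives [g *m T = c *m h] and [g' *m T = c' *m h']
    with [c], [c'] in one compact set. So [g' *m invmx g] is among the finitely many elements left
    by proper discontinuity, and these have a common entry bound. *)
Lemma fam_unique (Gam : set 'M[R]_N) r0 : (forall g, Gam g -> G g) ->
  (forall g h, Gam g -> Gam h -> Gam (g *m h)) -> (forall g, Gam g -> Gam (invmx g)) ->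
  (forall C : set 'M[R]_N, compact C -> C `<=` G -> finite_set [set g | Gam g /\
     exists c1 c2 h1 h2, [/\ C c1, C c2, H h1, H h2 & g *m c1 *m h1 = c2 *m h2]]) ->
  forall r, exists b, forall S T x f, fam Gam r0 S -> fam Gam r0 T -> good x f ->
    f *m x = 1%:M -> qf S x <= r -> qf (invmx S) f^T <= r ->
    qf T x <= r -> qf (invmx T) f^T <= r -> comparable_forms b S T.
Proof.
move=> GamG Gamm Gami pd r.
have [r1 hr1] := frame_bd r0 r; have [r2 hr2] := bounded_section r1.
have GC : [set g | G g /\ bd r2 g] `<=` G by move=> g [].
have /finite_compact/compact_entries_le[b hb] := pd _ (@G_cpt r2) GC.
have half g g' T c c' h h' y : Gam g -> Gam g' -> G T -> G c -> bd r2 c -> G c' -> bd r2 c' ->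
    H h -> H h' -> g *m T = c *m h -> g' *m T = c' *m h' ->
    qf 1%:M (g' *m y) <= N%:R * N%:R * b ^+ 2 * qf 1%:M (g *m y).
  move=> Gg Gg' GT Gc bc Gc' bc' Hh Hh' e e'.
  have ug := G_unit (GamG g Gg).
  have -> : g' *m y = g' *m invmx g *m (g *m y) by rewrite -mulmxA mulKmx.
  apply: bd_sqnorm_mul; apply: hb; split; first by apply: Gamm => //; exact: Gami.
  by exists c, c', h, h'; split=> //; rewrite -mulmxA -e -e' mulmxA mulmxKV.
exists (N%:R * N%:R * b ^+ 2) => S S' x f [g [Gg hg ->]] [g' [Gg' hg' ->]] gxf fx q1 q2 q3 q4 y.
have [T [GT Tp fT Tl]] := move_to_good gxf fx.
have f1 := hr1 g x f T (GamG g Gg) hg GT Tp fT Tl q1 q2.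
have f2 := hr1 g' x f T (GamG g' Gg') hg' GT Tp fT Tl q3 q4.
have [c [h [Gc bc Hh e]]] := hr2 _ (G_mul (GamG g Gg) GT) f1.
have [c' [h' [Gc' bc' Hh' e']]] := hr2 _ (G_mul (GamG g' Gg') GT) f2.
by rewrite !fam_qf; split; [apply: half e' e | apply: half e e'].
Qed.

Theorem no_compact_quotient : ~ admits_compact_quotient G H.
Proof.
move=> [Gam [GamG [_ [Gamm Gami]] _ pd [C [cC CG cov]]]].
have [r1 hr1] := compact_entries_le cC.
have [r2 hr2] := G_bd_inv r1.
pose r := Num.max r1 r2.
have hC c : C c -> [/\ G c, bd r c & bd r (invmx c)].
  move=> Cc; have Gc := CG c Cc; split=> //.
    by apply: bd_mono (hr1 c Cc); rewrite le_max lexx.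
  by apply: bd_mono (hr2 c Gc (hr1 c Cc)); rewrite le_max lexx orbT.
have [e eE] : exists e : nat -> 'cV[R]_d, forall i, e i = E^T *m ev i by eexists.
have [f fE'] : exists f : nat -> 'rV[R]_d, forall i, f i = (ev i)^T *m E by eexists.
(* The coordinates 0, 1, 2 lie in W because [2 <= p]. *)
have i2n i : (i <= 2)%N -> (i < n)%N /\ (i < p.+1)%N by move=> h; clear -h p2 pn; lia.
have Ee i : (i <= 2)%N -> E *m e i = ev i.
  by move=> /i2n[h1 h2]; rewrite eE; apply: E_trE; exact: supp_ev.
have fE i : (i <= 2)%N -> f i *m E^T = (ev i)^T.
  by move=> hi; apply: trmx_inj; rewrite -[in RHS](Ee i hi) fE' eE !trmx_mul !trmxK.
have fe i j : (i <= 2)%N -> (j <= 2)%N -> f i *m e j = (i == j)%:R%:M.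
  move=> hi hj; rewrite fE' -mulmxA Ee //; have [->|ij] := eqVneq i j; first exact: trmx_ev.
  have := ev_As one_As (i2n i hi).1 (i2n j hj).1 ij; rewrite mulmx1 => ->.
  by apply/matrixP => a b; rewrite !mxE mul0rn.
have fJe J i j : J \in js -> (i <= 2)%N -> (j <= 2)%N -> f i *m (E^T *m J *m E) *m e j = 0.
  move=> hJ hi hj; rewrite !mulmxA fE // -mulmxA Ee //.
  by apply: ev_J => //; [exact: (i2n i hi).1 | exact: (i2n j hj).1].
have fe0 i j : (i <= 2)%N -> (j <= 2)%N -> i != j -> f i *m e j = 0.
  by move=> hi hj ij; rewrite fe // (negbTE ij); apply/matrixP => a b; rewrite !mxE mul0rn.
apply: (@no_form_family R d (fam Gam r) good (1 + N%:R * r ^+ 2) _ _ _ _ _ _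
  (e 0%N) (e 1%N) (e 2%N) (f 0%N) (f 1%N) (f 2%N)).
- by move=> S [g [Gg _ ->]]; apply: fam_posdef; exact: GamG.
- move=> x g s t h J hJ; rewrite -scalemxAr -!scalemxAl; rewrite h // !scaler0 //.
- by move=> S x [g [Gg _ ->]]; apply: good_form; exact: GamG.
- by rewrite lerDl mulr_ge0 // sqr_ge0.
- move=> x g h gx; have [S [h1 h2 h3]] := fam_near GamG Gami hC cov h gx.
  by exists S; split=> //; [apply: le_trans h2 _ | apply: le_trans h3 _]; rewrite lerDr.
- exact: fam_unique.
- by move=> u J hJ; rewrite !mulmxDl -scalemxAl !mulmxDl -!scalemxAl !mulmxDl !fJe // addr0 scaler0 addr0.
- by move=> u J hJ; rewrite !mulmxDl -scalemxAl !mulmxDl -!scalemxAl !mulmxDl !fJe // addr0 scaler0 addr0.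
- by move=> u J hJ; rewrite !mulmxDl -!scalemxAl !fJe // scaler0 addr0.
all: first [by rewrite fe | by rewrite fe0].
Qed.

End KStructure.

(** * Groups defined by a determinant *)

(** For a full-rank factorisation [M = X Y], the relation [M M = 0] forces [Y X = 0], and
    Sylvester's identity applies. *)
Lemma det_1D_sq0 (F : fieldType) n (M : 'M[F]_n) : M *m M = 0 -> \det (1%:M + M) = 1.
Proof.
move=> MM; rewrite -(mulmx_base M) det_1DmulC.
suff -> : row_base M *m col_base M = 0 by rewrite addr0 det1.
have [/mulVpmx U /mulmxVp V] := (col_base_full M, row_base_free M).
rewrite -[LHS]mul1mx -[LHS]mulmx1 -{1}U -V.
have -> : pinvmx (col_base M) *m col_base M *m (row_base M *m col_base M) *m (row_base M *m pinvmx (row_base M))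
  = pinvmx (col_base M) *m ((col_base M *m row_base M) *m (col_base M *m row_base M)) *m pinvmx (row_base M).
  by rewrite !mulmxA.
by rewrite mulmx_base MM mulmx0 mul0mx.
Qed.

(** * Continuity of polynomial expressions in matrix entries *)

Section RingClosed.
Variables (T : Type) (S : comNzRingType) (Q : (T -> S) -> Prop).
(** Stands for continuity, either real or through real and imaginary parts, so that determinants and
    adjugates are treated once. *)
Definition ring_closed := [/\ forall c, Q (fun=> c),
  forall f g, Q f -> Q g -> Q (fun t => f t + g t) &
  forall f g, Q f -> Q g -> Q (fun t => f t * g t)].
Hypothesis Qr : ring_closed.

Lemma ring_closed_sum (I : Type) (s : seq I) (P : pred I) (f : I -> T -> S) :
  (forall i, Q (f i)) -> Q (fun t => \sum_(i <- s | P i) f i t).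
Proof.
case: Qr => Qc Qa Qm hf; elim: s => [|i s IH].
  have -> : (fun t => \sum_(i <- [::] | P i) f i t) = fun=> 0; last exact: Qc.
  by apply/funext => t; rewrite big_nil.
have -> : (fun t => \sum_(j <- i :: s | P j) f j t) =
   if P i then (fun t => f i t + \sum_(j <- s | P j) f j t)
   else (fun t => \sum_(j <- s | P j) f j t).
  by apply/funext => t; rewrite big_cons; case: (P i).
by case: (P i) => //; apply: Qa.
Qed.

Lemma ring_closed_prod (I : Type) (s : seq I) (P : pred I) (f : I -> T -> S) :
  (forall i, Q (f i)) -> Q (fun t => \prod_(i <- s | P i) f i t).
Proof.
case: Qr => Qc Qa Qm hf; elim: s => [|i s IH].
  have -> : (fun t => \prod_(i <- [::] | P i) f i t) = fun=> 1; last exact: Qc.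
  by apply/funext => t; rewrite big_nil.
have -> : (fun t => \prod_(j <- i :: s | P j) f j t) =
   if P i then (fun t => f i t * \prod_(j <- s | P j) f j t)
   else (fun t => \prod_(j <- s | P j) f j t).
  by apply/funext => t; rewrite big_cons; case: (P i).
by case: (P i) => //; apply: Qm.
Qed.

Lemma ring_closed_det m (M : T -> 'M[S]_m) :
  (forall i j, Q (fun t => M t i j)) -> Q (fun t => \det (M t)).
Proof.
move=> hM; case: (Qr) => Qc _ Qm; apply: ring_closed_sum => s; apply: Qm; first exact: Qc.
exact: ring_closed_prod.
Qed.

Lemma ring_closed_mulmx m n k (A : T -> 'M[S]_(m, n)) (B : T -> 'M[S]_(n, k)) :
  (forall i j, Q (fun t => A t i j)) -> (forall i j, Q (fun t => B t i j)) ->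
  forall i j, Q (fun t => (A t *m B t) i j).
Proof.
move=> hA hB i j; case: (Qr) => Qc _ Qm.
have -> : (fun t => (A t *m B t) i j) = fun t => \sum_k A t i k * B t k j.
  by apply/funext => t; rewrite mxE.
by apply: ring_closed_sum => l; apply: Qm.
Qed.

Lemma ring_closed_adj m (M : T -> 'M[S]_m) :
  (forall i j, Q (fun t => M t i j)) -> forall i j, Q (fun t => (\adj (M t)) i j).
Proof.
move=> hM i j; case: (Qr) => Qc _ Qm.
have -> : (fun t => (\adj (M t)) i j) =
    fun t => (-1) ^+ (j + i) * \det (row' j (col' i (M t))).
  by apply/funext => t; rewrite mxE.
apply: Qm; first exact: Qc; apply: ring_closed_det => a b.
have -> : (fun t => row' j (col' i (M t)) a b) = fun t => M t (lift j a) (lift i b).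
  by apply/funext => t; rewrite !mxE.
exact: hM.
Qed.
End RingClosed.

Lemma continuous_ring_closed (R : realType) (T : topologicalType) :
  ring_closed (fun f : T -> R => continuous f).
Proof.
split=> [c x|f g hf hg x|f g hf hg x]; first exact: cvg_cst.
- by apply: cvgD; [exact: hf | exact: hg].
- by apply: cvgM; [exact: hf | exact: hg].
Qed.

Lemma complex_continuous_ring_closed (R : realType) (T : topologicalType) :
  ring_closed (fun f : T -> R[i] => continuous (fun t => complex.Re (f t)) /\ continuous (fun t => complex.Im (f t))).
Proof.
have [Qc Qa Qm] := @continuous_ring_closed R T.
split=> [c|f g [f1 f2] [g1 g2]|f g [f1 f2] [g1 g2]].
- by split; [exact: (Qc (complex.Re c)) | exact: (Qc (complex.Im c))].
- split.
    have -> : (fun t => complex.Re (f t + g t)) = (fun t => complex.Re (f t) + complex.Re (g t)).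
      by apply/funext => t; case: (f t) (g t) => a b [c d].
    exact: Qa.
  have -> : (fun t => complex.Im (f t + g t)) = (fun t => complex.Im (f t) + complex.Im (g t)).
    by apply/funext => t; case: (f t) (g t) => a b [c d].
  exact: Qa.
split.
  have -> : (fun t => complex.Re (f t * g t)) = (fun t => complex.Re (f t) * complex.Re (g t) + (-1) * (complex.Im (f t) * complex.Im (g t))).
    by apply/funext => t; rewrite mulN1r; case: (f t) (g t) => a b [c d].
  by apply: (Qa); [exact: Qm | apply: (Qm); [exact: Qc | exact: Qm]].
have -> : (fun t => complex.Im (f t * g t)) = (fun t => complex.Re (f t) * complex.Im (g t) + complex.Im (f t) * complex.Re (g t)).
  by apply/funext => t; case: (f t) (g t) => a b [c d].
by apply: (Qa); exact: Qm.
Qed.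

Lemma closed_level (R : realType) (T : topologicalType) (f : T -> R) c :
  continuous f -> closed [set t | f t = c].
Proof. by move=> hf; apply: (@closed_comp _ _ f [set x | x = c]) => //; exact: closed_eq. Qed.

Lemma closed_forall (I : Type) (T : topologicalType) (P : I -> T -> Prop) :
  (forall i, closed [set t | P i t]) -> closed [set t | forall i, P i t].
Proof.
move=> h; have -> : [set t | forall i, P i t] = \bigcap_(i in setT) [set t | P i t].
  by apply/seteqP; split=> t; [move=> ht i _; exact: ht | move=> ht i; exact: ht].
exact: closed_bigI.
Qed.

(** * Groups of determinant one, uniformly in K *)

Section Embedded.
Variables (R : realType) (S : fieldType) (N m n p : nat) (js : seq 'M[R]_N) (i0 : 'I_N).
Variables (emb : 'M[S]_m -> 'M[R]_N) (ext : 'M[R]_N -> 'M[S]_m).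
Variable Q : ('M[R]_N -> S) -> Prop.
Local Notation As := (1%:M :: js).
Local Notation ev k := (delta_mx (insubd i0 k) 0 : 'cV[R]_N).
Hypothesis n0 : (0 < n)%N.
Hypothesis N_eq : N = (size As * n)%N.
Hypothesis J_skew : forall J, J \in js -> J^T = - J.
Hypothesis J_orth : forall J, J \in js -> J^T *m J = 1%:M.
Hypothesis J_mul : forall A B, A \in As -> B \in As ->
  exists C s, C \in As /\ A^T *m B = s *: C.
Hypothesis J_avg : forall J X, J \in js ->
  J *m (\sum_(A <- As) A *m X *m A^T) = (\sum_(A <- As) A *m X *m A^T) *m J.
Hypothesis J_diag : forall J (i j : 'I_N), J \in js -> (i %% n != j %% n)%N -> J i j = 0.
Hypothesis gen : forall i : 'I_N, exists A s, A \in As /\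
  (delta_mx i 0 : 'cV[R]_N) = s *: (A *m ev (i %% n)%N).
Hypothesis embM : forall Z W, emb (Z *m W) = emb Z *m emb W.
Hypothesis emb1 : emb 1%:M = 1%:M.
Hypothesis embK : cancel emb ext.
Hypothesis extK : forall X, (forall J, J \in js -> J *m X = X *m J) -> emb (ext X) = X.
Hypothesis extD : forall X Y, ext (X + Y) = ext X + ext Y.
Hypothesis Qr : ring_closed Q.
Hypothesis Qext : forall i j, Q (fun X => ext X i j).
Hypothesis Q_closed : forall f c, Q f -> closed [set X | f X = c].
Hypothesis Q_emb : forall F : 'M[R]_N -> 'M[S]_m, (forall i j, Q (fun X => F X i j)) ->
  continuous (fun X => emb (F X)).

Definition special := [set X : 'M[R]_N |
  (forall J, J \in js -> J *m X = X *m J) /\ \det (ext X) = 1].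

(** The smaller group as a joint stabiliser of basis vectors and covectors, the description on which
    [bounded_section] rests. *)
Definition special_fix := [set X | special X /\
  forall k, (p <= k < n)%N -> X *m ev k = ev k /\ (ev k)^T *m X = (ev k)^T].

Lemma ext_mul X Y : special X -> special Y -> ext (X *m Y) = ext X *m ext Y.
Proof. by move=> [hX _] [hY _]; rewrite -[in LHS](extK hX) -[in LHS](extK hY) -embM embK. Qed.

Lemma special_mul X Y : special X -> special Y -> special (X *m Y).
Proof.
move=> hX hY; split; last by rewrite ext_mul // det_mulmx hX.2 hY.2 mulr1.
by move=> J hJ; rewrite mulmxA hX.1 // -mulmxA hY.1 // mulmxA.
Qed.

Lemma special_mulV X : special X -> X *m emb (\adj (ext X)) = 1%:M.
Proof. by move=> [hX dX]; rewrite -{1}(extK hX) -embM mul_mx_adj dX emb1. Qed.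

Lemma special_unit X : special X -> X \in unitmx.
Proof. by move=> /special_mulV/mulmx1_unit[]. Qed.

Lemma special_invmx X : special X -> invmx X = emb (\adj (ext X)).
Proof. by move=> hX; rewrite -[LHS]mulmx1 -(special_mulV hX) mulKmx // special_unit. Qed.

Lemma special_inv X : special X -> special (invmx X).
Proof.
move=> hX; have uX := special_unit hX; split.
  move=> J hJ; apply: (can_inj (mulKmx uX)); rewrite mulmxA -(hX.1 _ hJ).
  by rewrite -mulmxA mulmxV // mulmx1 mulKVmx.
have : ext X *m ext (invmx X) = 1%:M.
  by rewrite special_invmx // embK mul_mx_adj hX.2.
by move/(congr1 determinant); rewrite det_mulmx hX.2 mul1r det1.
Qed.

Lemma special_transvection u f : korth js f u -> special (transvection js u f).
Proof.
move=> fu; pose M := \sum_(A <- As) A *m (u *m f) *m A^T.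
have hM J : J \in js -> J *m M = M *m J by move=> hJ; exact: J_avg.
split; first by move=> J hJ; rewrite mulmxDr mulmxDl mulmx1 mul1mx hM.
have -> : ext (transvection js u f) = 1%:M + ext M.
  have e : ext 1%:M = 1%:M by rewrite -emb1 embK.
  by rewrite -{1}e -extD.
apply: det_1D_sq0; rewrite -[LHS]embK embM (extK hM) (avg_sq0 J_mul fu).
have : ext 0 + ext 0 = ext 0 + 0 by rewrite -extD !addr0.
exact: addrI.
Qed.

Lemma special_compact r : compact [set g | special g /\ bd r g].
Proof.
apply: (@closed_entries_le_compact _ _ _ r) => [|g [_ h] //].
have cc := @continuous_ring_closed R 'M[R]_N.
apply: closedI; first apply: closedI.
- apply: closed_forall => J; have [hJ|hJ] := boolP (J \in js); last first.
    by have -> : [set t : 'M[R]_N | false -> J *m t = t *m J] = setT by apply/seteqP; split.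
  have -> : [set t | true -> J *m t = t *m J] =
      [set t | forall i j, (J *m t) i j + (-1) * (t *m J) i j = 0].
    apply/seteqP; split=> t /= h; first by move=> i j; rewrite h // mulN1r subrr.
    move=> _; apply/matrixP => i j; have /eqP := h i j.
    by rewrite mulN1r subr_eq0 => /eqP.
  apply: closed_forall => i; apply: closed_forall => j; apply: closed_level.
  case: (cc) => Qc Qa Qm; apply: Qa.
    apply: (ring_closed_mulmx cc); first by move=> a b; exact: Qc.
    by move=> a b; exact: coord_continuous.
  apply: Qm; first exact: Qc.
  apply: (ring_closed_mulmx cc); first by move=> a b; exact: coord_continuous.
  by move=> a b; exact: Qc.
- by apply: Q_closed; apply: ring_closed_det => // i j; exact: Qext.
apply: closed_forall => i; apply: closed_forall => j.
have -> : [set t : 'M[R]_N | `|t i j| <= r] = (fun t : 'M[R]_N => t i j) @^-1` `[- r, r].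
  by apply/seteqP; split=> t /=; rewrite in_itv /= ler_norml.
apply: closed_comp => [t _|]; first exact: coord_continuous.
exact: itv_closed.
Qed.

(** On this group the inverse comes from the adjugate, which is continuous, and the bounded part of
    the group is compact. *)
Lemma special_bd_inv r : exists r', forall g, special g -> bd r g -> bd r' (invmx g).
Proof.
have : compact [set emb (\adj (ext g)) | g in [set g | special g /\ bd r g]].
  apply: continuous_compact; last exact: special_compact.
  apply: continuous_subspaceT; apply: Q_emb; apply: ring_closed_adj => // i j; exact: Qext.
move/compact_entries_le => [r' hr']; exists r' => g Gg bg; rewrite special_invmx //.
by apply: hr'; exists g.
Qed.

Lemma special_no_compact_quotient : (2 <= p < n)%N ->
  ~ admits_compact_quotient special special_fix.
Proof.
case/andP=> p2 pn.
have valk k : (k < n)%N -> nat_of_ord (insubd i0 k) = k.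
  by move=> kn; rewrite val_insubd ifT // N_eq /= mulSn ltn_addr.
(* Real coordinates come in [size As] consecutive blocks of length [n], so the residue modulo [n] is
   the K-coordinate, represented by [k] itself in the first block. *)
apply: (@no_compact_quotient R N n p js (fun i : 'I_N => (i %% n)%N) (insubd i0)) => //.
- by move=> k kn; rewrite valk // modn_small.
- by move=> i; rewrite ltn_mod.
- by move=> g J [h _] /h.
- exact: special_unit.
- exact: special_mul.
- exact: special_inv.
- exact: special_transvection.
- exact: special_bd_inv.
- by move=> h [].
- by move=> h [_ hh] k /hh.
exact: special_compact.
Qed.
End Embedded.

(** * The three fields *)

Section Fixing.
Variable S : nzRingType.

Definition fixes n (X : 'M[S]_n) (i : 'I_n) :=
  forall a, X a i = (a == i)%:R /\ X i a = (i == a)%:R.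

Lemma fixes_delta n (X : 'M[S]_n) i : fixes X i <->
  X *m (delta_mx i 0 : 'cV[S]_n) = delta_mx i 0 /\
  (delta_mx i 0 : 'cV[S]_n)^T *m X = (delta_mx i 0 : 'cV[S]_n)^T.
Proof.
rewrite -colE trmx_delta -rowE; split=> [h|[hc hr] a].
  split; apply/matrixP => a b; rewrite !mxE !ord1; first by rewrite (h a).1 andbT.
  by rewrite (h b).2 eq_sym.
have /matrixP/(_ a 0) := hc; have /matrixP/(_ 0 a) := hr.
by rewrite !mxE eqxx andbT /= => -> ->; rewrite eq_sym.
Qed.

Lemma fixes_block p q (X : 'M[S]_(p + q)) : (forall j, fixes X (rshift p j)) <->
  X = block_mx (ulsubmx X) 0 0 1%:M.
Proof.
split=> [h|-> j a].
  apply/matrixP => a b; case: (split_ordP a) => a' ->; case: (split_ordP b) => b' ->.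
  - by rewrite block_mxEul !mxE.
  - by rewrite block_mxEur mxE (h b' _).1 eq_lrshift.
  - by rewrite block_mxEdl mxE (h a' _).2 eq_rlshift.
  - by rewrite block_mxEdr mxE (h b' _).1 eq_rshift.
case: (split_ordP a) => b ->.
  by rewrite block_mxEur block_mxEdl !mxE eq_lrshift eq_rlshift.
by rewrite !block_mxEdr !mxE !eq_rshift.
Qed.

Lemma zero_block p q (X : 'M[S]_(p + q)) :
  (forall j a, X a (rshift p j) = 0 /\ X (rshift p j) a = 0) <->
  X = block_mx (ulsubmx X) 0 0 0.
Proof.
split=> [h|-> j a].
  apply/matrixP => a b; case: (split_ordP a) => a' ->; case: (split_ordP b) => b' ->.
  - by rewrite block_mxEul !mxE.
  - by rewrite block_mxEur mxE (h b' _).1.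
  - by rewrite block_mxEdl mxE (h a' _).2.
  - by rewrite block_mxEdr mxE (h b' _).1.
by case: (split_ordP a) => b ->; rewrite ?block_mxEur ?block_mxEdl ?block_mxEdr !mxE.
Qed.

End Fixing.

Lemma fixes_range (S : nzRingType) (N p q : nat) (sh : 'I_(p + q) -> 'I_N) (i0 : 'I_N) (X : 'M[S]_N) :
  (forall i, sh i = i :> nat) -> (p + q <= N)%N ->
  (forall k, (p <= k < p + q)%N -> X *m (delta_mx (insubd i0 k) 0 : 'cV[S]_N) = delta_mx (insubd i0 k) 0 /\
    (delta_mx (insubd i0 k) 0 : 'cV[S]_N)^T *m X = (delta_mx (insubd i0 k) 0 : 'cV[S]_N)^T) <->
  (forall j, fixes X (sh (rshift p j))).
Proof.
move=> shE pqN; have e (j : 'I_q) : insubd i0 (p + j)%N = sh (rshift p j).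
  apply: val_inj; rewrite val_insubd /= shE /= ifT //.
  by apply: leq_trans pqN; rewrite ltn_add2l.
split=> [h j|h k /andP[pk kpq]].
  apply/fixes_delta; rewrite -e; apply: h.
  by rewrite leq_addr ltn_add2l ltn_ord.
have kq : (k - p < q)%N by rewrite ltn_subLR.
have := fixes_delta X (sh (rshift p (Ordinal kq))); rewrite -e /= subnKC // => - [h' _].
by apply: h'; rewrite -(subnKC pk) (e (Ordinal kq)).
Qed.

Section RealCase.
Variable R : realType.

Lemma SLR_no_compact_quotient p q : (2 <= p)%N -> (1 <= q)%N ->
  ~ admits_compact_quotient (@SLK R KR (p + q)) (@SLKsub R KR p q).
Proof.
move=> p2 q1; have n0 : (0 < p + q)%N by rewrite addn_gt0 q1 orbT.
pose i0 := Ordinal n0.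
have -> : @SLK R KR (p + q) = special [::] (@id 'M[R]_(p + q)).
  by apply/seteqP; split=> [X h|X []].
have -> : @SLKsub R KR p q = special_fix (p + q) p [::] i0 (@id 'M[R]_(p + q)).
  apply/seteqP; split=> [_ [Y [dY ->]]|X [[_ dX] hX]].
    split; first by split=> //; rewrite /= det_ublock dY det1 mulr1.
    apply/(@fixes_range _ _ _ _ id) => //; apply/fixes_block.
    by rewrite block_mxKul.
  have /fixes_block e : forall j, fixes X (id (rshift p j)).
    by apply/(@fixes_range _ _ _ _ id) => //; exact: hX.
  exists (ulsubmx X); split=> //.
  by move: dX; rewrite /= {1}e det_ublock det1 mulr1.
apply: (@special_no_compact_quotient R R _ _ _ _ [::] i0 id id
  (fun f => continuous f)) => //.
- by rewrite mul1n.
- move=> A B; rewrite !inE => /eqP-> /eqP->; exists 1%:M, 1.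
  by rewrite inE eqxx scale1r trmx1 mulmx1.
- move=> i; exists 1%:M, 1; rewrite inE eqxx; split=> //.
  rewrite scale1r mul1mx modn_small //; congr (delta_mx _ _).
  by apply: val_inj; rewrite val_insubd ltn_ord.
- exact: continuous_ring_closed.
- by move=> i j; exact: coord_continuous.
- by move=> f c hf; exact: closed_level.
- by move=> F hF; exact: mx_continuous.
- by rewrite p2 -addn1 leq_add2l.
Qed.
End RealCase.

(** * Averages over complex and quaternionic units *)

Section Units.
Variables (R : comNzRingType) (N : nat).
Implicit Types (A B C J X : 'M[R]_N) (js : seq 'M[R]_N).

(* If left multiplication by [J] permutes the list up to sign, [J] commutes with the average over the list. *)
Lemma avg_comm js J X : J^T *m J = 1%:M ->
  \sum_(A <- js) J *m A *m X *m (J *m A)^T = \sum_(A <- js) A *m X *m A^T ->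
  J *m (\sum_(A <- js) A *m X *m A^T) = (\sum_(A <- js) A *m X *m A^T) *m J.
Proof.
move=> JJ e; rewrite -[in RHS]e mulmx_sumr mulmx_suml; apply: eq_bigr => A _.
by rewrite trmx_mul -!mulmxA JJ mulmx1.
Qed.

Lemma conj_opp A X : (- A) *m X *m (- A)^T = A *m X *m A^T.
Proof. by rewrite linearN /= mulmxN !mulNmx opprK. Qed.

Section Complex.
Variable I : 'M[R]_N.
Hypotheses (trI : I^T = - I) (II : I *m I = - 1%:M).

Lemma trmx_mul_skew : I^T *m I = 1%:M.
Proof. by rewrite trI mulNmx II opprK. Qed.

Lemma complex_mul A B : A \in [:: 1%:M; I] -> B \in [:: 1%:M; I] ->
  exists C s, C \in [:: 1%:M; I] /\ A^T *m B = s *: C.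
Proof.
rewrite !inE => /orP[]/eqP-> /orP[]/eqP->; rewrite ?trmx1 ?mul1mx ?mulmx1.
- by exists 1%:M, 1; rewrite !inE eqxx scale1r.
- by exists I, 1; rewrite !inE eqxx orbT scale1r.
- by exists I, (-1); rewrite !inE eqxx orbT scaleN1r trI.
by exists 1%:M, 1; rewrite !inE eqxx scale1r trmx_mul_skew.
Qed.

Lemma complex_avg J X : J \in [:: I] ->
  J *m (\sum_(A <- [:: 1%:M; I]) A *m X *m A^T)
  = (\sum_(A <- [:: 1%:M; I]) A *m X *m A^T) *m J.
Proof.
rewrite inE => /eqP->; apply: avg_comm; first exact: trmx_mul_skew.
by rewrite !big_cons !big_nil mulmx1 II conj_opp !addr0 addrC.
Qed.
End Complex.

Section Quaternion.
Variables I J : 'M[R]_N.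
Hypotheses (trI : I^T = - I) (II : I *m I = - 1%:M) (trJ : J^T = - J) (JJ : J *m J = - 1%:M).
Hypothesis JI : J *m I = - (I *m J).
Local Notation K := (I *m J).
Local Notation js := [:: I; J; K].

Let IK : I *m K = - J. Proof. by rewrite mulmxA II mulNmx mul1mx. Qed.
Let JK : J *m K = I.
Proof. by rewrite mulmxA JI mulNmx -mulmxA JJ mulmxN mulmx1 opprK. Qed.
Let KI : K *m I = J. Proof. by rewrite -mulmxA JI mulmxN IK opprK. Qed.
Let KJ : K *m J = - I. Proof. by rewrite -mulmxA JJ mulmxN mulmx1. Qed.
Let KK : K *m K = - 1%:M. Proof. by rewrite -mulmxA JK II. Qed.
Let trK : K^T = - K. Proof. by rewrite trmx_mul trI trJ mulmxN mulNmx opprK JI. Qed.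

Lemma quaternion_skew A : A \in js -> A^T = - A.
Proof. by rewrite !inE => /or3P[]/eqP->; rewrite ?trI ?trJ ?trK. Qed.

Lemma quaternion_orth A : A \in js -> A^T *m A = 1%:M.
Proof. by move=> h; rewrite quaternion_skew // mulNmx; move: h; rewrite !inE => /or3P[]/eqP->; rewrite ?II ?JJ ?KK opprK. Qed.

Lemma quaternion_mul A B : A \in 1%:M :: js -> B \in 1%:M :: js ->
  exists C s, C \in 1%:M :: js /\ A^T *m B = s *: C.
Proof.
have p1 C : C \in 1%:M :: js -> exists D s, D \in 1%:M :: js /\ C = s *: D.
  by move=> hC; exists C, 1; rewrite scale1r.
have p2 C : C \in 1%:M :: js -> exists D s, D \in 1%:M :: js /\ - C = s *: D.
  by move=> hC; exists C, (-1); rewrite scaleN1r.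
have h1 : 1%:M \in 1%:M :: js by rewrite !inE eqxx.
have hI : I \in 1%:M :: js by rewrite !inE eqxx !orbT.
have hJ : J \in 1%:M :: js by rewrite !inE eqxx !orbT.
have hK : K \in 1%:M :: js by rewrite !inE eqxx !orbT.
rewrite in_cons => /orP[/eqP-> hB|hA]; first by rewrite trmx1 mul1mx; exact: p1.
rewrite in_cons => /orP[/eqP->|hB].
  by rewrite mulmx1 quaternion_skew //; apply: p2; rewrite in_cons hA orbT.
rewrite quaternion_skew // mulNmx; move: hA hB.
rewrite !inE => /or3P[]/eqP-> /or3P[]/eqP->.
all: rewrite ?II ?JJ ?KK ?JI ?IK ?JK ?KI ?KJ ?opprK; first [exact: p1 | exact: p2].
Qed.

Lemma quaternion_avg A X : A \in js ->
  A *m (\sum_(B <- 1%:M :: js) B *m X *m B^T)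
  = (\sum_(B <- 1%:M :: js) B *m X *m B^T) *m A.
Proof.
move=> hA; apply: avg_comm; first exact: quaternion_orth.
rewrite !big_cons !big_nil !addr0 mulmx1; move: hA; rewrite !inE => /or3P[]/eqP->.
- by rewrite II IK !conj_opp addrCA; congr (_ + (_ + _)); rewrite addrC.
- by rewrite JI JJ JK !conj_opp addrA addrC -addrA.
by rewrite KI KJ KK !conj_opp addrA [X in X + _]addrC [X in _ + X]addrC addrC -addrA.
Qed.
End Quaternion.
End Units.

Lemma modn_lshift n (a : 'I_n) : (lshift n a %% n)%N = a.
Proof. by rewrite modn_small /=. Qed.

Lemma modn_rshift n (a : 'I_n) : (rshift n a %% n)%N = a.
Proof. by rewrite /= modnDl modn_small. Qed.

(** The realification of the scalar matrix i. *)
Definition omega (R : nzRingType) n : 'M[R]_(n + n) := block_mx 0 (- 1%:M) 1%:M 0.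

Section Omega.
Variables (R : comNzRingType) (n : nat).

Lemma omega_tr : (omega R n)^T = - omega R n.
Proof. by rewrite tr_block_mx opp_block_mx linearN /= !trmx1 !trmx0 oppr0 opprK. Qed.

Lemma omega_sq : omega R n *m omega R n = - 1%:M.
Proof.
rewrite mulmx_block !mul0mx !mulmx0 !mulmx1 mul1mx !addr0 !add0r.
by rewrite scalar_mx_block opp_block_mx oppr0.
Qed.

Lemma omega_mulmx (A B C D : 'M[R]_n) :
  omega R n *m block_mx A B C D = block_mx (- C) (- D) A B.
Proof. by rewrite mulmx_block !mul0mx !mul1mx !mulNmx !mul1mx !addr0 !add0r. Qed.

Lemma mulmx_omega (A B C D : 'M[R]_n) :
  block_mx A B C D *m omega R n = block_mx B (- A) D (- C).
Proof. by rewrite mulmx_block !mulmx0 !mulmx1 !mulmxN !mulmx1 !addr0 !add0r. Qed.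

Lemma omega_delta (i : 'I_n) :
  omega R n *m (delta_mx (lshift n i) 0 : 'cV_(n + n)) = delta_mx (rshift n i) 0.
Proof.
apply/matrixP => a b; rewrite -colE mxE ord1 [RHS]mxE andbT.
case: (split_ordP a) => c ->; first by rewrite block_mxEul mxE eq_lrshift.
by rewrite block_mxEdl mxE eq_rshift.
Qed.

Lemma omega_diag (i j : 'I_(n + n)) : (i %% n != j %% n)%N -> omega R n i j = 0.
Proof.
case: (split_ordP i) => a ->; case: (split_ordP j) => b ->.
- by rewrite block_mxEul mxE.
- by rewrite modn_lshift modn_rshift block_mxEur !mxE -val_eqE /= => /negbTE->; rewrite oppr0.
- by rewrite modn_lshift modn_rshift block_mxEdl !mxE -val_eqE /= => /negbTE->.
by rewrite block_mxEdr mxE.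
Qed.
End Omega.

Section Realification.
Variable R : realType.
Local Notation C := (complex.complex R).
Local Notation Re := (@complex.Re R).
Local Notation Im := (@complex.Im R).

(** Only the first block column is read; for matrices commuting with [omega] it determines the
    rest. *)
Definition unrealC n (X : 'M[R]_(n + n)) : 'M[C]_n :=
  \matrix_(i, j) (X (lshift n i) (lshift n j) +i* X (rshift n i) (lshift n j))%C.

Lemma ReD (x y : C) : Re (x + y) = Re x + Re y. Proof. by case: x y => [a b] [c d]. Qed.
Lemma ImD (x y : C) : Im (x + y) = Im x + Im y. Proof. by case: x y => [a b] [c d]. Qed.
Lemma ReM (x y : C) : Re (x * y) = Re x * Re y - Im x * Im y.
Proof. by case: x y => [a b] [c d]. Qed.
Lemma ImM (x y : C) : Im (x * y) = Re x * Im y + Im x * Re y.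
Proof. by case: x y => [a b] [c d]. Qed.
Lemma Re_sum (I : Type) (s : seq I) (f : I -> C) : Re (\sum_(i <- s) f i) = \sum_(i <- s) Re (f i).
Proof. by elim/big_ind2: _ => // x1 x2 y1 y2 <- <-; exact: ReD. Qed.
Lemma Im_sum (I : Type) (s : seq I) (f : I -> C) : Im (\sum_(i <- s) f i) = \sum_(i <- s) Im (f i).
Proof. by elim/big_ind2: _ => // x1 x2 y1 y2 <- <-; exact: ImD. Qed.
Lemma Re_nat (b : bool) : Re b%:R = b%:R. Proof. by case: b. Qed.
Lemma Im_nat (b : bool) : Im b%:R = 0. Proof. by case: b. Qed.

Lemma realC_mul n (Z W : 'M[C]_n) : realC (Z *m W) = realC Z *m realC W.
Proof.
have hR : map_mx Re (Z *m W) = map_mx Re Z *m map_mx Re W - map_mx Im Z *m map_mx Im W.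
  apply/matrixP => i j; rewrite !mxE Re_sum -sumrB; apply: eq_bigr => k _.
  by rewrite ReM !mxE.
have hI : map_mx Im (Z *m W) = map_mx Re Z *m map_mx Im W + map_mx Im Z *m map_mx Re W.
  apply/matrixP => i j; rewrite !mxE Im_sum -big_split; apply: eq_bigr => k _.
  by rewrite ImM !mxE.
rewrite /realC mulmx_block hR hI !mulNmx !mulmxN; congr block_mx.
- by rewrite opprD.
- by rewrite addrC.
by rewrite addrC.
Qed.

Lemma realC_1 n : realC (1%:M : 'M[C]_n) = 1%:M.
Proof.
rewrite [RHS]scalar_mx_block; congr block_mx; apply/matrixP => i j; rewrite !mxE.
- by rewrite Re_nat.
- by rewrite Im_nat oppr0.
- by rewrite Im_nat.
by rewrite Re_nat.
Qed.

Lemma realCK n : cancel (@realC R n) (@unrealC n).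
Proof.
move=> Z; apply/matrixP => i j; rewrite mxE block_mxEul block_mxEdl !mxE.
by case: (Z i j).
Qed.

Lemma unrealCD n (X Y : 'M[R]_(n + n)) : unrealC (X + Y) = unrealC X + unrealC Y.
Proof. by apply/matrixP => i j; rewrite !mxE. Qed.

Lemma realC_omega n (Z : 'M[C]_n) : omega R n *m realC Z = realC Z *m omega R n.
Proof.
by rewrite omega_mulmx mulmx_omega.
Qed.

Lemma unrealCK n (X : 'M[R]_(n + n)) :
  omega R n *m X = X *m omega R n -> realC (unrealC X) = X.
Proof.
rewrite -{1 2}[X]submxK omega_mulmx mulmx_omega.
case/eq_block_mx => e1 e2 _ _.
rewrite -[RHS]submxK -e1 -[drsubmx X]opprK e2 opprK; congr block_mx.
all: by apply/matrixP => i j; rewrite !mxE.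
Qed.

Definition complex_continuous (T : topologicalType) (f : T -> C) :=
  continuous (fun t => Re (f t)) /\ continuous (fun t => Im (f t)).

Lemma unrealC_continuous n (i j : 'I_n) :
  complex_continuous (fun X : 'M[R]_(n + n) => unrealC X i j).
Proof.
split.
  have -> : (fun X : 'M[R]_(n + n) => Re (unrealC X i j)) = fun X => X (lshift n i) (lshift n j).
    by apply/funext => X; rewrite mxE.
  exact: coord_continuous.
have -> : (fun X : 'M[R]_(n + n) => Im (unrealC X i j)) = fun X => X (rshift n i) (lshift n j).
  by apply/funext => X; rewrite mxE.
exact: coord_continuous.
Qed.

Lemma complex_closed_level (T : topologicalType) (f : T -> C) c :
  complex_continuous f -> closed [set t | f t = c].
Proof.
move=> [h1 h2].
have -> : [set t | f t = c] = [set t | Re (f t) = Re c] `&` [set t | Im (f t) = Im c].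
  apply/seteqP; split=> t /= => [->|] //.
  by case: (f t) c => a b [a' b'] /= [-> ->].
by apply: closedI; exact: closed_level.
Qed.

Lemma realC_continuous (T : topologicalType) n (F : T -> 'M[C]_n) :
  (forall i j, complex_continuous (fun t => F t i j)) -> continuous (fun t => realC (F t)).
Proof.
move=> hF; have [Qc _ Qm] := @continuous_ring_closed R T.
apply: mx_continuous => i j.
case: (split_ordP i) => a ->; case: (split_ordP j) => b ->; have [h1 h2] := hF a b.
- have -> : (fun t => realC (F t) (lshift n a) (lshift n b)) = fun t => Re (F t a b) => //.
  by apply/funext => t; rewrite block_mxEul mxE.
- have -> : (fun t => realC (F t) (lshift n a) (rshift n b)) = fun t => (-1) * Im (F t a b).
    by apply/funext => t; rewrite block_mxEur !mxE mulN1r.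
  by apply: Qm => //; exact: Qc.
- have -> : (fun t => realC (F t) (rshift n a) (lshift n b)) = fun t => Im (F t a b) => //.
  by apply/funext => t; rewrite block_mxEdl mxE.
have -> : (fun t => realC (F t) (rshift n a) (rshift n b)) = fun t => Re (F t a b) => //.
by apply/funext => t; rewrite block_mxEdr mxE.
Qed.

Lemma fixes_realC n (Z : 'M[C]_n) i : fixes (realC Z) (lshift n i) <-> fixes Z i.
Proof.
have eqC (x : C) (b : bool) : x = b%:R <-> Re x = b%:R /\ Im x = 0.
  split=> [->|]; first by rewrite Re_nat Im_nat.
  by case: x => c d /= [-> ->]; case: b.
split=> h a.
  have [] := h (lshift n a); rewrite !block_mxEul !mxE !eq_lshift => h1 h2.
  have [] := h (rshift n a); rewrite block_mxEdl block_mxEur !mxE eq_rlshift eq_lrshift => h3 h4.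
  split; apply/eqC; split=> //; apply: oppr_inj; by rewrite h4 oppr0.
have [b ->|b ->] := split_ordP a; have [/eqC[r1 i1] /eqC[r2 i2]] := h b.
  by rewrite !block_mxEul !mxE !eq_lshift.
by rewrite block_mxEdl block_mxEur !mxE eq_rlshift eq_lrshift i1 i2 oppr0.
Qed.

End Realification.

(** * The complex and quaternionic groups *)

Section Instances.
Variable R : realType.
Local Notation C := (complex.complex R).

Lemma insubd_val N (i0 j : 'I_N) k : k = j :> nat -> insubd i0 k = j.
Proof. by move=> ->; apply: val_inj; rewrite val_insubd ltn_ord. Qed.

Lemma SLC_no_compact_quotient p q : (2 <= p)%N -> (1 <= q)%N ->
  ~ admits_compact_quotient (@SLK R KC (p + q)) (@SLKsub R KC p q).
Proof.
move=> p2 q1; pose n := (p + q)%N.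
have n0 : (0 < n)%N by rewrite addn_gt0 q1 orbT.
pose i0 : 'I_(n + n) := lshift n (Ordinal n0).
pose js := [:: omega R n].
have comm X : (forall J, J \in js -> J *m X = X *m J) <-> omega R n *m X = X *m omega R n.
  split=> [h|h J]; first by apply: h; rewrite inE.
  by rewrite inE => /eqP->.
have rangeP := @fixes_range R (n + n) p q (@lshift n n) i0 _ (fun=> erefl) (leq_addr _ _).
have -> : @SLK R KC (p + q) = special js (@unrealC R n).
  apply/seteqP; split=> [_ [Z [dZ ->]]|X [/comm/unrealCK e dX]].
    by split; [apply/comm; exact: realC_omega | rewrite realCK].
  by exists (unrealC X).
have -> : @SLKsub R KC p q = special_fix n p js i0 (@unrealC R n).
  apply/seteqP; split=> [_ [Z [dZ ->]]|X [[/comm/unrealCK e dX] hX]].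
    split; first split; first by apply/comm; exact: realC_omega.
      by rewrite realCK det_ublock dZ det1 mulr1.
    apply/rangeP => j; apply/fixes_realC; move: j; apply/fixes_block.
    by rewrite block_mxKul.
  have /fixes_block eZ : forall j, fixes (unrealC X) (rshift p j).
    by move=> j; apply/fixes_realC; rewrite e; move: j; apply/rangeP.
  exists (ulsubmx (unrealC X)); rewrite -eZ e; split=> //.
  by move: dX; rewrite {1}eZ det_ublock det1 mulr1.
apply: (@special_no_compact_quotient R C _ n n p js i0 (@realC R n) (@unrealC R n)
  (@complex_continuous R 'M[R]_(n + n))).
- exact: n0.
- by rewrite /= mul2n addnn.
- by move=> J; rewrite inE => /eqP->; exact: omega_tr.
- by move=> J; rewrite inE => /eqP->; apply: trmx_mul_skew; [exact: omega_tr | exact: omega_sq].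
- by apply: complex_mul; [exact: omega_tr | exact: omega_sq].
- by apply: complex_avg; [exact: omega_tr | exact: omega_sq].
- by move=> J i j; rewrite inE => /eqP->; exact: omega_diag.
- move=> i; case: (split_ordP i) => a ->.
    exists 1%:M, 1; rewrite inE eqxx mul1mx scale1r modn_lshift; split=> //.
    by rewrite (@insubd_val _ i0 (lshift n a)).
  exists (omega R n), 1; rewrite !inE eqxx orbT scale1r modn_rshift; split=> //.
  by rewrite (@insubd_val _ i0 (lshift n a)) // omega_delta.
- exact: realC_mul.
- exact: realC_1.
- exact: realCK.
- by move=> X /comm/unrealCK.
- exact: unrealCD.
- exact: complex_continuous_ring_closed.
- exact: unrealC_continuous.
- exact: complex_closed_level.
- exact: realC_continuous.
by rewrite p2 -addn1 leq_add2l.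
Qed.

(** On realified pairs [(z, w)] of complex vectors this is the antilinear map to
    [(- conj w, conj z)]; the sign of the second block is the conjugation. *)
Definition quatJ n : 'M[R]_((n + n) + (n + n)) := block_mx (omega R n) 0 0 (- omega R n).

Lemma quatJ_tr n : (quatJ n)^T = - quatJ n.
Proof. by rewrite [LHS]tr_block_mx [RHS]opp_block_mx [(- _)^T]linearN /= omega_tr !trmx0 oppr0. Qed.

Lemma quatJ_sq n : quatJ n *m quatJ n = - 1%:M.
Proof.
rewrite mulmx_block !mul0mx !mulmx0 !addr0 !add0r mulmxN mulNmx opprK omega_sq.
by rewrite [in RHS]scalar_mx_block [RHS]opp_block_mx oppr0.
Qed.

Lemma quatJ_omega n : quatJ n *m omega R (n + n) = - (omega R (n + n) *m quatJ n).
Proof.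
by rewrite mulmx_omega omega_mulmx [RHS]opp_block_mx !opprK !oppr0.
Qed.

Lemma omega_quatJ n : omega R (n + n) *m quatJ n = block_mx 0 (omega R n) (omega R n) 0.
Proof.
by rewrite omega_mulmx opprK oppr0.
Qed.

Lemma modn_lshiftD n (a : 'I_(n + n)) : (lshift (n + n) a %% n = a %% n)%N.
Proof. by []. Qed.

Lemma modn_rshiftD n (a : 'I_(n + n)) : (rshift (n + n) a %% n = a %% n)%N.
Proof. by rewrite /= -addnA !modnDl. Qed.

Lemma quatJ_diag n (i j : 'I_((n + n) + (n + n))) : (i %% n != j %% n)%N -> quatJ n i j = 0.
Proof.
case: (split_ordP i) => a ->; case: (split_ordP j) => b ->; rewrite ?modn_rshiftD ?modn_lshiftD => h.
- by rewrite block_mxEul omega_diag.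
- by rewrite block_mxEur mxE.
- by rewrite block_mxEdl mxE.
by rewrite block_mxEdr mxE omega_diag ?oppr0.
Qed.

Lemma omega_quatJ_diag n (i j : 'I_((n + n) + (n + n))) :
  (i %% n != j %% n)%N -> (omega R (n + n) *m quatJ n) i j = 0.
Proof.
rewrite omega_quatJ; case: (split_ordP i) => a ->; case: (split_ordP j) => b ->; rewrite ?modn_rshiftD ?modn_lshiftD => h.
- by rewrite block_mxEul mxE.
- by rewrite block_mxEur omega_diag.
- by rewrite block_mxEdl omega_diag.
by rewrite block_mxEdr mxE.
Qed.

Lemma quatJ_delta n (i : 'I_n) :
  quatJ n *m (delta_mx (lshift (n + n) (lshift n i)) 0 : 'cV_((n + n) + (n + n)))
  = delta_mx (lshift (n + n) (rshift n i)) 0.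
Proof.
apply/matrixP => a b; rewrite -colE mxE ord1 [RHS]mxE andbT.
case: (split_ordP a) => c ->; last by rewrite block_mxEdl mxE eq_rlshift.
rewrite block_mxEul eq_lshift; case: (split_ordP c) => d ->.
  by rewrite block_mxEul mxE eq_lrshift.
by rewrite block_mxEdl mxE eq_rshift.
Qed.

Lemma quatJ_commE n (A B : 'M[R]_(n + n)) :
  quatJ n *m block_mx A (- B) B A = block_mx A (- B) B A *m quatJ n <->
  omega R n *m A = A *m omega R n /\ omega R n *m B = - (B *m omega R n).
Proof.
rewrite [quatJ n *m _]mulmx_block [_ *m quatJ n]mulmx_block.
rewrite !(mul0mx, mulmx0, add0r, addr0, mulNmx, mulmxN, opprK).
split=> [/eq_block_mx[e1 _ e3 _]|[-> ->]]; last by rewrite opprK.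
by split=> //; rewrite -e3 opprK.
Qed.

(** Among complex matrices, commuting with [quatJ] singles out the shape of [cplxH], so quaternionic
    linearity becomes commutation with real matrices. *)
Lemma quatJ_realC n (P Q S T : 'M[C]_n) :
  quatJ n *m realC (block_mx P Q S T) = realC (block_mx P Q S T) *m quatJ n <->
  Q = - map_mx (@complex.conjc R) S /\ T = map_mx (@complex.conjc R) P.
Proof.
rewrite /realC quatJ_commE !map_block_mx !omega_mulmx !mulmx_omega opp_block_mx !opprK.
split=> [[/eq_block_mx[e1 e2 _ _] /eq_block_mx[e3 e4 _ _]]|[-> ->]]; last first.
  split; congr block_mx; apply/matrixP => i j; rewrite !mxE;
    by case: (S i j) => ? ?; case: (P i j) => ? ? /=; rewrite ?opprK.
split; apply/matrixP => i j.
  move/matrixP/(_ i j): e1; move/matrixP/(_ i j): e3; rewrite !mxE.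
  by case: (Q i j) (S i j) => a b [c d] /= h1 h2; apply/eqP; rewrite eq_complex /=; apply/andP; split; apply/eqP; lra.
move/matrixP/(_ i j): e2; move/matrixP/(_ i j): e4; rewrite !mxE.
by case: (T i j) (P i j) => a b [c d] /= h1 h2; apply/eqP; rewrite eq_complex /=; apply/andP; split; apply/eqP; lra.
Qed.

Lemma fixes_cplxH n (Z W : 'M[C]_n) i : fixes (cplxH Z W) (lshift n i) <->
  fixes Z i /\ forall a, W a i = 0 /\ W i a = 0.
Proof.
have c0 (x : C) : - conjc x = 0 <-> x = 0.
  by case: x => a b; split=> /eqP; rewrite eq_complex /= ?opprK ?oppr_eq0 => /andP[/eqP-> /eqP->]; rewrite ?oppr0.
split=> [h|[hZ hW] a].
  split=> a.
    by have := h (lshift n a); rewrite !block_mxEul !eq_lshift.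
  have := h (rshift n a); rewrite block_mxEdl block_mxEur eq_rlshift eq_lrshift !mxE.
  by case=> -> /c0.
have [b ->|b ->] := split_ordP a.
  by rewrite !block_mxEul !eq_lshift; exact: hZ.
rewrite block_mxEdl block_mxEur eq_rlshift eq_lrshift !mxE (hW b).1 (hW b).2.
by split=> //; apply/c0.
Qed.

Lemma col_mx1_conj p q (M : 'M[C]_p) :
  (col_mx 1%:M 0 : 'M[C]_(p + q, p)) *m M *m (col_mx 1%:M 0 : 'M[C]_(p + q, p))^T = block_mx M 0 0 0.
Proof.
rewrite mul_col_mx mul1mx mul0mx tr_col_mx trmx1 trmx0 mul_col_row.
by rewrite !mulmx1 !mulmx0.
Qed.

Lemma col_mx1_tr p q : (col_mx 1%:M 0 : 'M[C]_(p + q, p))^T *m (col_mx 1%:M 0 : 'M[C]_(p + q, p)) = 1%:M.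
Proof. by rewrite tr_col_mx mul_row_col trmx1 mulmx1 mulmx0 addr0. Qed.

(* The stabilised matrix is [1 + E Y E^T] for an isometry [E], hence has the determinant of [1 + Y]. *)
Lemma det_cplxH_block p q (Z W : 'M[C]_p) :
  \det (cplxH (block_mx Z 0 0 1%:M : 'M[C]_(p + q)) (block_mx W 0 0 0)) = \det (cplxH Z W).
Proof.
pose e := col_mx 1%:M 0 : 'M[C]_(p + q, p).
pose E : 'M[C]_((p + q) + (p + q), p + p) := block_mx e 0 0 e.
pose Y := cplxH Z W - 1%:M.
have -> : cplxH (block_mx Z 0 0 1%:M : 'M[C]_(p + q)) (block_mx W 0 0 0) = 1%:M + E *m (Y *m E^T).
  rewrite mulmxA /Y /cplxH (scalar_mx_block p p) opp_block_mx add_block_mx oppr0 !addr0.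
  rewrite tr_block_mx !trmx0 mulmx_block !mul0mx !addr0 !add0r mulmx_block !mulmx0 !addr0 !add0r.
  rewrite !col_mx1_conj (scalar_mx_block (p + q) (p + q)) add_block_mx !add0r.
  rewrite !map_block_mx !map_mx0 opp_block_mx !oppr0.
  by rewrite (scalar_mx_block p q) !add_block_mx !addr0 map_mx1 ![1%:M + _]addrC !subrK.
rewrite det_1DmulC -mulmxA.
have -> : E^T *m E = 1%:M.
  rewrite tr_block_mx !trmx0 mulmx_block !mulmx0 !mul0mx !addr0 !add0r col_mx1_tr.
  by rewrite [RHS]scalar_mx_block.
by rewrite mulmx1 /Y addrC subrK.
Qed.

Lemma SLH_no_compact_quotient p q : (2 <= p)%N -> (1 <= q)%N ->
  ~ admits_compact_quotient (@SLK R KH (p + q)) (@SLKsub R KH p q).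
Proof.
move=> p2 q1; pose n := (p + q)%N.
have n0 : (0 < n)%N by rewrite addn_gt0 q1 orbT.
pose sh := lshift (n + n) \o @lshift n n.
pose i0 := sh (Ordinal n0).
pose I := omega R (n + n); pose J := quatJ n.
pose js := [:: I; J; I *m J].
have comm X : (forall A, A \in js -> A *m X = X *m A) <-> I *m X = X *m I /\ J *m X = X *m J.
  split=> [h|[hI hJ] A]; first by split; apply: h; rewrite !inE eqxx ?orbT.
  rewrite !inE => /or3P[]/eqP-> //.
  by rewrite -mulmxA hJ mulmxA hI mulmxA.
have rangeP := @fixes_range R _ p q sh i0 _ (fun=> erefl) (leq_trans (leq_addr _ _) (leq_addr _ _)).
have commH (Z W : 'M[C]_n) : forall A, A \in js -> A *m realC (cplxH Z W) = realC (cplxH Z W) *m A.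
  by apply/comm; split; [exact: realC_omega | apply/quatJ_realC].
have ofH X : (forall A, A \in js -> A *m X = X *m A) ->
    X = realC (cplxH (ulsubmx (unrealC X)) (dlsubmx (unrealC X))).
  move=> /comm[/unrealCK e hJ]; rewrite -[LHS]e; congr realC.
  move: hJ; rewrite -{1 2}e -{1 2}[unrealC X]submxK => /quatJ_realC[e1 e2].
  by rewrite -{1}[unrealC X]submxK e1 e2.
have -> : @SLK R KH (p + q) = special js (@unrealC R (n + n)).
  apply/seteqP; split=> [_ [Z [W [dZ ->]]]|X [hX dX]].
    by split; [exact: commH | rewrite realCK].
  have e := ofH X hX; exists (ulsubmx (unrealC X)), (dlsubmx (unrealC X)); split=> //.
  by rewrite -(realCK (cplxH _ _)) -e.
have -> : @SLKsub R KH p q = special_fix n p js i0 (@unrealC R (n + n)).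
  apply/seteqP; split=> [_ [Z [W [dZ ->]]]|X [[hX dX] fX]].
    split; first by split; [exact: commH | rewrite realCK det_cplxH_block].
    apply/rangeP => j; apply/fixes_realC/fixes_cplxH; split; move: j.
      by apply/fixes_block; rewrite block_mxKul.
    by apply/zero_block; rewrite block_mxKul.
  have e := ofH X hX; set Z := ulsubmx _ in e; set W := dlsubmx _ in e.
  have h j : fixes Z (rshift p j) /\ forall a, W a (rshift p j) = 0 /\ W (rshift p j) a = 0.
    by apply/fixes_cplxH/fixes_realC; rewrite -e; move: j; apply/rangeP.
  have /fixes_block eZ : forall j, fixes Z (rshift p j) by move=> j; exact: (h j).1.
  have /zero_block eW : forall j a, W a (rshift p j) = 0 /\ W (rshift p j) a = 0.
    by move=> j; exact: (h j).2.
  exists (ulsubmx Z), (ulsubmx W); rewrite -eZ -eW; split=> //.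
  by rewrite -(@det_cplxH_block p q) -eZ -eW -(realCK (cplxH _ _)) -e.
have trI : I^T = - I := omega_tr _ _. have II : I *m I = - 1%:M := omega_sq _ _.
have trJ : J^T = - J := quatJ_tr n. have JJ : J *m J = - 1%:M := quatJ_sq n.
have JI : J *m I = - (I *m J) := quatJ_omega n.
(* Quaternionic matrices enter as complex ones of size [n + n], while the K-dimension remains
   [n]. *)
apply: (@special_no_compact_quotient R C _ (n + n) n p js i0 (@realC R (n + n))
  (@unrealC R (n + n)) (@complex_continuous R 'M[R]_((n + n) + (n + n)))).
- exact: n0.
- by rewrite /= 3!mulSn mul1n !addnA.
- exact: quaternion_skew.
- exact: quaternion_orth.
- exact: quaternion_mul.
- exact: quaternion_avg.
- move=> A i j; rewrite !inE => /or3P[]/eqP-> h.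
  + apply: omega_diag; apply: contra h => /eqP h; apply/eqP.
    have nn : (n %| n + n)%N by rewrite dvdn_add.
    by rewrite -(modn_dvdm i nn) h modn_dvdm.
  + exact: quatJ_diag.
  exact: omega_quatJ_diag.
- move=> i; case: (split_ordP i) => c ->; case: (split_ordP c) => a ->.
  + exists 1%:M, 1; rewrite !inE eqxx mul1mx scale1r modn_lshiftD modn_lshift; split=> //.
    by rewrite (@insubd_val _ i0 (sh a)).
  + exists J, 1; rewrite !inE eqxx !orbT scale1r modn_lshiftD modn_rshift; split=> //.
    by rewrite (@insubd_val _ i0 (sh a)) // quatJ_delta.
  + exists I, 1; rewrite !inE eqxx !orbT scale1r modn_rshiftD modn_lshift; split=> //.
    by rewrite (@insubd_val _ i0 (sh a)) // omega_delta.
  exists (I *m J), 1; rewrite !inE eqxx !orbT scale1r modn_rshiftD modn_rshift; split=> //.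
  by rewrite (@insubd_val _ i0 (sh a)) // -mulmxA quatJ_delta omega_delta.
- exact: realC_mul.
- exact: realC_1.
- exact: realCK.
- by move=> X /comm[/unrealCK].
- exact: unrealCD.
- exact: complex_continuous_ring_closed.
- exact: unrealC_continuous.
- exact: complex_closed_level.
- exact: realC_continuous.
by rewrite p2 -addn1 leq_add2l.
Qed.
End Instances.

Theorem mainTheorem11 (R : realType) (K : KK) (p q : nat) :
  (2 <= p)%N -> (1 <= q)%N ->
  ~ (K = KR /\ ((p = 3 /\ q = 1) \/ (p = 7 /\ q = 1)))%N ->
  ~ admits_compact_quotient (@SLK R K (p + q)) (@SLKsub R K p q).
Proof.
move=> p2 q1 _; case: K.
- exact: SLR_no_compact_quotient.
- exact: SLC_no_compact_quotient.
exact: SLH_no_compact_quotient.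
Qed.
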